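(* Let $\Bbbk$ be a field, $Q$ a finite connected quiver, $l\ge 2$, and let $A=\frac{\Bbbk Q}{J^l}$ be a truncated path algebra. If $\mathrm{findim}(A^{op})>0$, then $$\mathrm{dell}(A)=\mathrm{Dell}(A)=\mathrm{findim}(A^{op}).$$
   Context: Modules are right modules; $\mathrm{mod}\,A$ is the category of finitely generated right $A$-modules and $\underline{\mathrm{mod}}\,A$ is its stable category (modulo morphisms factoring through projectives). $J$ is the ideal of the path algebra $\Bbbk Q$ generated by the arrows of $Q$. $A^{op}$ is the opposite algebra. $\Omega(M)$ is the syzygy of $M$ (kernel of a projective cover), $\Omega^0(M)=M$, $\Omega^{n+1}(M)=\Omega(\Omega^n(M))$. For $M\in\mathrm{mod}\,A$, the delooping level is $\mathrm{dell}(M)=\inf\{n\ge 0:\Omega^n(M)$ is a direct summand of $\Omega^{n+1}(N)$ in $\underline{\mathrm{mod}}\,A$ for some $N\in\mathrm{mod}\,A\}$, and $\mathrm{dell}(M)=\infty$ if no such $n$ exists. For the algebra: $\mathrm{dell}(A)=\sup\{\mathrm{dell}(S): S \text{ a simple } A\text{-module}\}$ (delooping level) and $\mathrm{Dell}(A)=\sup\{\mathrm{dell}(M): M\in\mathrm{mod}\,A\}$ (global delooping level); note that dell and Dell are different invariants. For an Artin algebra $B$, $\mathrm{findim}(B)=\sup\{\mathrm{pd}(M): M\in\mathrm{mod}\,B,\ \mathrm{pd}(M)<\infty\}$. *)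

(* Defs.v *)
From HB Require Import structures.
From mathcomp Require Import all_boot all_algebra finmap.
From mathcomp Require Import boolp classical_sets.
From mathcomp Require Import monalg.

Set Implicit Arguments.
Unset Strict Implicit.
Unset Printing Implicit Defensive.

Import GRing.Theory.

Local Open Scope ring_scope.
Local Open Scope quotient_scope.
Local Open Scope classical_set_scope.

(* [None] stands for infinity. *)
Definition enat := option nat.

Definition enat_le (x y : enat) : bool :=
  match x, y with
  | _, None => true
  | None, Some _ => false
  | Some m, Some n => (m <= n)%N
  end.

Definition enat_lt (x y : enat) : bool := ~~ enat_le y x.

Definition enat_inf (S : set nat) : enat :=
  if pselect (exists n, `[< S n >]) is left exS then Some (ex_minn exS)
  else None.

(* The least natural upper bound, and infinity if there is none; in particular
   the supremum of the empty set is 0. *)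
Definition enat_sup (S : set enat) : enat :=
  enat_inf [set n | forall x, S x -> enat_le x (Some n)].

Record ideal (R : pzRingType) := Ideal {
  in_ideal :> R -> Prop;
  ideal0 : in_ideal 0;
  idealB : forall x y, in_ideal x -> in_ideal y -> in_ideal (x - y);
  idealMl : forall a x, in_ideal x -> in_ideal (a * x);
  idealMr : forall a x, in_ideal x -> in_ideal (x * a) }.

Section Ideals.
Variable R : pzRingType.
Implicit Types (I : ideal R) (X : set R).

Lemma idealD I x y : I x -> I y -> I (x + y).
Proof.
move=> Ix Iy; rewrite -[y]opprK; apply: idealB => //.
by rewrite -[- y]add0r; apply: idealB => //; apply: ideal0.
Qed.

Definition full_ideal : ideal R.
Proof. by exists setT. Defined.

Definition ideal_gen X : ideal R.
Proof.
exists [set x | forall I, X `<=` I -> I x].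
- by move=> I _; apply: ideal0.
- by move=> x y Ix Iy I XI; apply: idealB; [apply: Ix | apply: Iy].
- by move=> a x Ix I XI; apply: idealMl; apply: Ix.
- by move=> a x Ix I XI; apply: idealMr; apply: Ix.
Defined.

Definition ideal_mul I1 I2 : ideal R.
Proof.
exists [set x | exists s : seq (R * R),
  (forall u, u \in s -> I1 u.1 /\ I2 u.2) /\ x = \sum_(u <- s) u.1 * u.2].
- by exists [::]; split=> //; rewrite big_nil.
- move=> _ _ [s [hs ->]] [t [ht ->]].
  exists (s ++ [seq (- u.1, u.2) | u <- t]); split.
    move=> u; rewrite mem_cat => /orP[/hs //|/mapP[v /ht [h1 h2] ->]] /=.
    by split=> //; rewrite -[- _]add0r; apply: idealB => //; apply: ideal0.
  rewrite big_cat big_map /= -sumrN; congr (_ + _).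
  by apply: eq_bigr => u _; rewrite mulNr.
- move=> a _ [s [hs ->]]; exists [seq (a * u.1, u.2) | u <- s]; split.
    by move=> u /mapP[v /hs [h1 h2] ->]; split=> //=; apply: idealMl.
  by rewrite big_map mulr_sumr; apply: eq_bigr => u _; rewrite mulrA.
- move=> a _ [s [hs ->]]; exists [seq (u.1, u.2 * a) | u <- s]; split.
    by move=> u /mapP[v /hs [h1 h2] ->]; split=> //=; apply: idealMr.
  by rewrite big_map mulr_suml; apply: eq_bigr => u _; rewrite mulrA.
Defined.

Definition ideal_pow I n : ideal R := iter n (ideal_mul I) full_ideal.

Definition ideal_pred I : {pred R} := fun x => `[< I x >].

Lemma ideal_pred_zmod_closed I : zmod_closed (ideal_pred I).
Proof.
split; first exact/asboolP/ideal0.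
by move=> x y /asboolP Ix /asboolP Iy; apply/asboolP/idealB.
Qed.

HB.instance Definition _ I :=
  GRing.isZmodClosed.Build R (ideal_pred I) (ideal_pred_zmod_closed I).

Definition quotient_ring I := Quotient.quot (ideal_pred I).

End Ideals.

(* [ring_quotient] makes {quot _} a ring for commutative rings only. *)
Section QuotientRing.
Variables (R : pzRingType) (I : ideal R).

HB.instance Definition _ := GRing.Zmodule.on (quotient_ring I).

Definition qproj (x : R) : quotient_ring I :=
  \pi_(Quotient.quot (ideal_pred I)) x.

Lemma qprojP x y : qproj x = qproj y <-> I (x - y).
Proof.
rewrite /qproj; split=> [/eqP|h].
  by rewrite -Quotient.idealrBE => /asboolP.
by apply/eqP; rewrite -Quotient.idealrBE; apply/asboolP.
Qed.

Lemma qproj_surj u : exists x, qproj x = u.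
Proof. by exists (repr u); apply: reprK. Qed.

Lemma qprojB x y : qproj (x - y) = qproj x - qproj y.
Proof. exact: (raddfB (\pi_(Quotient.quot (ideal_pred I)))). Qed.

Lemma qprojD x y : qproj (x + y) = qproj x + qproj y.
Proof. exact: (raddfD (\pi_(Quotient.quot (ideal_pred I)))). Qed.

Definition qmul (u v : quotient_ring I) : quotient_ring I :=
  qproj (repr u * repr v).

Lemma qmulE x y : qmul (qproj x) (qproj y) = qproj (x * y).
Proof.
apply/qprojP; set x' := repr _; set y' := repr _.
have hx : I (x' - x) by apply/qprojP; apply: reprK.
have hy : I (y' - y) by apply/qprojP; apply: reprK.
have -> : x' * y' - x * y = (x' - x) * y' + x * (y' - y).
  by rewrite mulrBl mulrBr addrA subrK.
by apply: idealD; [apply: idealMr | apply: idealMl].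
Qed.

Lemma qmulA : associative qmul.
Proof.
move=> u v w; have [x <-] := qproj_surj u; have [y <-] := qproj_surj v.
by have [z <-] := qproj_surj w; rewrite !qmulE mulrA.
Qed.

Lemma qmul1u : left_id (qproj 1) qmul.
Proof. by move=> u; have [x <-] := qproj_surj u; rewrite qmulE mul1r. Qed.

Lemma qmulu1 : right_id (qproj 1) qmul.
Proof. by move=> u; have [x <-] := qproj_surj u; rewrite qmulE mulr1. Qed.

Lemma qmulDl : left_distributive qmul +%R.
Proof.
move=> u v w; have [x <-] := qproj_surj u; have [y <-] := qproj_surj v.
by have [z <-] := qproj_surj w; rewrite -qprojD !qmulE mulrDl qprojD.
Qed.

Lemma qmulDr : right_distributive qmul +%R.
Proof.
move=> u v w; have [x <-] := qproj_surj u; have [y <-] := qproj_surj v.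
by have [z <-] := qproj_surj w; rewrite -qprojD !qmulE mulrDr qprojD.
Qed.

HB.instance Definition _ := GRing.Zmodule_isPzRing.Build (quotient_ring I)
  qmulA qmul1u qmulu1 qmulDl qmulDr.

Lemma qproj_is_zmod_morphism : zmod_morphism qproj.
Proof. exact: qprojB. Qed.

Lemma qproj_is_monoid_morphism : monoid_morphism qproj.
Proof. by split=> // x y; apply: esym; apply: qmulE. Qed.

HB.instance Definition _ :=
  GRing.isZmodMorphism.Build R (quotient_ring I) qproj qproj_is_zmod_morphism.
HB.instance Definition _ :=
  GRing.isMonoidMorphism.Build R (quotient_ring I) qproj
    qproj_is_monoid_morphism.

End QuotientRing.

Record quiver := Quiver {
  vertex : finType;
  arrow : finType;
  source : arrow -> vertex;
  target : arrow -> vertex }.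

Definition adjacent (Q : quiver) : rel (vertex Q) := fun x y =>
  [exists a : arrow Q, ((source a == x) && (target a == y))
                    || ((source a == y) && (target a == x))].

Definition connected_quiver (Q : quiver) : Prop :=
  (0 < #|vertex Q|)%N /\ forall x y : vertex Q, connect (@adjacent Q) x y.

Section Paths.
Variable Q : quiver.

Fixpoint is_qpath (v : vertex Q) (s : seq (arrow Q)) : bool :=
  if s is a :: s' then (source a == v) && is_qpath (target a) s' else true.

(* The start vertex is recorded so as to distinguish the trivial paths. *)
Record qpath := QPath {
  qpath_val : vertex Q * seq (arrow Q);
  _ : is_qpath qpath_val.1 qpath_val.2 }.

HB.instance Definition _ := [isSub for qpath_val].
HB.instance Definition _ := [Choice of qpath by <:].

Definition path_src (p : qpath) : vertex Q := (val p).1.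
Definition path_tgt (p : qpath) : vertex Q :=
  last (val p).1 [seq target a | a <- (val p).2].

Definition trivial_path (v : vertex Q) : qpath := @QPath (v, [::]) isT.

Fact arrow_path_subproof (a : arrow Q) : is_qpath (source a) [:: a].
Proof. by rewrite /= eqxx. Qed.

Definition arrow_path (a : arrow Q) : qpath :=
  @QPath (source a, [:: a]) (arrow_path_subproof a).

Lemma is_qpath_cat v s t :
  is_qpath v (s ++ t)
  = is_qpath v s && is_qpath (last v [seq target a | a <- s]) t.
Proof. by elim: s v => //= a s IHs v; rewrite IHs andbA. Qed.

Fact path_cat_subproof (p q : qpath) : path_tgt p = path_src q ->
  is_qpath (path_src p) ((val p).2 ++ (val q).2).
Proof.
case: p q => [[v s] /= hs] [[w t] /= ht]; rewrite /path_tgt /path_src /=.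
by move=> e; rewrite is_qpath_cat hs e.
Qed.

(* Paths compose from left to right: [p] first, then [q]. *)
Definition path_cat (p q : qpath) : option qpath :=
  match path_tgt p =P path_src q with
  | ReflectT e =>
      Some (@QPath (path_src p, (val p).2 ++ (val q).2) (path_cat_subproof e))
  | ReflectF _ => None
  end.

Variant path_cat_spec (p q : qpath) : option qpath -> Prop :=
| PathCatSome r of path_tgt p = path_src q
    & val r = (path_src p, (val p).2 ++ (val q).2) :
    path_cat_spec p q (Some r)
| PathCatNone of path_tgt p <> path_src q : path_cat_spec p q None.

Lemma path_catP p q : path_cat_spec p q (path_cat p q).
Proof. by rewrite /path_cat; case: eqP => e; constructor. Qed.

Lemma path_tgt_cat (p q r : qpath) : path_tgt p = path_src q ->
  val r = (path_src p, (val p).2 ++ (val q).2) -> path_tgt r = path_tgt q.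
Proof. by move=> e er; rewrite /path_tgt er /= map_cat last_cat -/(path_tgt p) e. Qed.

Lemma path_src_cat (p q r : qpath) :
  val r = (path_src p, (val p).2 ++ (val q).2) -> path_src r = path_src p.
Proof. by move=> er; rewrite /path_src er. Qed.

Lemma path_catA p q r :
  obind (path_cat p) (path_cat q r) = obind (path_cat^~ r) (path_cat p q).
Proof.
case: (path_catP q r) => [qr e1 h1|n1]; case: (path_catP p q) => [pq e2 h2|n2] //=.
- case: path_catP => [s e3 h3|]; last by rewrite (path_src_cat h1).
  case: path_catP => [t e4 h4|]; last by rewrite (path_tgt_cat e2 h2).
  congr Some; apply: val_inj.
  by rewrite h3 h4 (path_src_cat h2) h1 h2 /= catA.
- by case: path_catP => // s e3 _; case: n2; rewrite -(path_src_cat h1).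
- by case: path_catP => // s e3 _; case: n1; rewrite -(path_tgt_cat e2 h2).
Qed.

Lemma path_cat1p v p :
  path_cat (trivial_path v) p = if v == path_src p then Some p else None.
Proof.
case: path_catP => [r e er|/eqP/negPf-> //].
rewrite -e eqxx; congr Some; apply: val_inj; rewrite er /=.
have -> : path_src (trivial_path v) = path_src p := e.
by rewrite /path_src /=; case: (qpath_val p).
Qed.

Lemma path_catp1 v p :
  path_cat p (trivial_path v) = if v == path_tgt p then Some p else None.
Proof.
case: path_catP => [r e er|/eqP]; last by rewrite eq_sym => /negPf->.
rewrite e eqxx; congr Some; apply: val_inj; rewrite er /= cats0.
by rewrite /path_src /=; case: (qpath_val p).
Qed.

End Paths.

(* The k-vector space with basis the paths of Q, trivial paths included. *)
Definition pathalg (k : fieldType) (Q : quiver) := {malg k[qpath Q]}.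

Section PathAlgebra.
Variables (k : fieldType) (Q : quiver).
Local Notation kQ := (pathalg k Q).


HB.instance Definition _ := GRing.Lmodule.on kQ.

Implicit Types (f g h : kQ) (p q : qpath Q) (c d : k).

Definition pathalg_one : kQ := \sum_(v : vertex Q) << trivial_path v >>.

Definition scaled_cat c p q : kQ :=
  if path_cat p q is Some r then << c *g r >> else 0.

Definition pathalg_mul f g : kQ :=
  \sum_(p <- msupp f) \sum_(q <- msupp g) scaled_cat (f@_p * g@_q) p q.

Lemma scaled_cat0 p q : scaled_cat 0 p q = 0.
Proof. by rewrite /scaled_cat; case: path_cat => // r; rewrite monalgU0. Qed.

Lemma scaled_catD c d p q :
  scaled_cat (c + d) p q = scaled_cat c p q + scaled_cat d p q.
Proof.
rewrite /scaled_cat; case: path_cat => [r|]; last by rewrite addr0.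
exact: monalgUD.
Qed.

Lemma scaler_monalgU c d p : c *: (<< d *g p >> : kQ) = << c * d *g p >>.
Proof.
by apply/malgP=> q; rewrite mcoeffZ [RHS]mcoeffU [in LHS]mcoeffU mulrnAr.
Qed.

Lemma scaler_scaled_cat c d p q :
  c *: scaled_cat d p q = scaled_cat (c * d) p q.
Proof.
rewrite /scaled_cat; case: path_cat => [r|]; last exact: scaler0.
exact: scaler_monalgU.
Qed.

Lemma pathalg_mulw (d1 d2 : {fset qpath Q}) f g :
  (msupp f `<=` d1)%fset -> (msupp g `<=` d2)%fset ->
  pathalg_mul f g = \sum_(p <- d1) \sum_(q <- d2) scaled_cat (f@_p * g@_q) p q.
Proof.
move=> le1 le2; rewrite /pathalg_mul (big_fset_incl _ le1) /=.
  apply: eq_bigr => p _; apply: big_fset_incl => // q _ /mcoeff_outdom ->.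
  by rewrite mulr0 scaled_cat0.
move=> p _ /mcoeff_outdom fp; rewrite big1 // => q _.
by rewrite fp mul0r scaled_cat0.
Qed.

Lemma pathalg_mulDl : left_distributive pathalg_mul +%R.
Proof.
move=> f g h.
rewrite [in RHS](pathalg_mulw (fsubsetUl _ (msupp g)) (fsubset_refl _)).
rewrite [in RHS](pathalg_mulw (fsubsetUr (msupp f) _) (fsubset_refl _)).
rewrite (pathalg_mulw (msuppD_le _ _) (fsubset_refl _)).
rewrite -big_split /=; apply: eq_bigr => p _.
rewrite -big_split /=; apply: eq_bigr => q _.
by rewrite mcoeffD mulrDl scaled_catD.
Qed.

Lemma pathalg_mulDr : right_distributive pathalg_mul +%R.
Proof.
move=> f g h.
rewrite [in RHS](pathalg_mulw (fsubset_refl _) (fsubsetUl _ (msupp h))).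
rewrite [in RHS](pathalg_mulw (fsubset_refl _) (fsubsetUr (msupp g) _)).
rewrite (pathalg_mulw (fsubset_refl _) (msuppD_le _ _)).
rewrite -big_split /=; apply: eq_bigr => p _.
rewrite -big_split /=; apply: eq_bigr => q _.
by rewrite mcoeffD mulrDr scaled_catD.
Qed.

Lemma pathalg_mul0g : left_zero 0 pathalg_mul.
Proof. by move=> g; rewrite /pathalg_mul msupp0 big_seq_fset0. Qed.

Lemma pathalg_mulg0 : right_zero 0 pathalg_mul.
Proof.
by move=> g; rewrite /pathalg_mul big1 // => p _; rewrite msupp0 big_seq_fset0.
Qed.

Lemma pathalg_mulUU c d p q :
  pathalg_mul << c *g p >> << d *g q >> = scaled_cat (c * d) p q.
Proof.
by rewrite (pathalg_mulw msuppU_le msuppU_le) !big_seq_fset1 !mcoeffUU.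
Qed.

Lemma scaled_catA a b c p q r :
  pathalg_mul << a *g p >> (scaled_cat (b * c) q r)
  = pathalg_mul (scaled_cat (a * b) p q) << c *g r >>.
Proof.
rewrite /scaled_cat; have := path_catA p q r.
case: (path_cat q r) => [qr|] /=; case: (path_cat p q) => [pq|] /= e.
- by rewrite [LHS]pathalg_mulUU [RHS]pathalg_mulUU /scaled_cat e mulrA.
- by rewrite [LHS]pathalg_mulUU [RHS]pathalg_mul0g /scaled_cat e.
- by rewrite [LHS]pathalg_mulg0 [RHS]pathalg_mulUU /scaled_cat -e.
- by rewrite [LHS]pathalg_mulg0 [RHS]pathalg_mul0g.
Qed.

Lemma pathalg_mul_suml (I : Type) (r : seq I) (F : I -> kQ) g :
  pathalg_mul (\sum_(i <- r) F i) g = \sum_(i <- r) pathalg_mul (F i) g.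
Proof.
apply: (big_morph (pathalg_mul^~ g)); last exact: pathalg_mul0g.
by move=> x y; apply: pathalg_mulDl.
Qed.

Lemma pathalg_mul_sumr (I : Type) (r : seq I) (F : I -> kQ) g :
  pathalg_mul g (\sum_(i <- r) F i) = \sum_(i <- r) pathalg_mul g (F i).
Proof.
apply: (big_morph (pathalg_mul g)); last exact: pathalg_mulg0.
by move=> x y; apply: pathalg_mulDr.
Qed.

Lemma pathalg_mulA : associative pathalg_mul.
Proof.
move=> f g h; rewrite [f]monalgE [g]monalgE [h]monalgE.
rewrite [LHS]pathalg_mul_suml [X in _ = pathalg_mul X _]pathalg_mul_suml.
rewrite [RHS]pathalg_mul_suml; apply: eq_bigr => p _.
rewrite [X in pathalg_mul _ X = _]pathalg_mul_suml.
rewrite [X in _ = pathalg_mul X _]pathalg_mul_sumr.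
rewrite [LHS]pathalg_mul_sumr [RHS]pathalg_mul_suml; apply: eq_bigr => q _.
rewrite [X in pathalg_mul _ X = _]pathalg_mul_sumr.
rewrite [LHS]pathalg_mul_sumr [RHS]pathalg_mul_sumr; apply: eq_bigr => r _.
rewrite [X in pathalg_mul _ X = _]pathalg_mulUU.
rewrite [X in _ = pathalg_mul X _]pathalg_mulUU.
exact: scaled_catA.
Qed.

Lemma pathalg_mul1g : left_id pathalg_one pathalg_mul.
Proof.
move=> f; rewrite [f]monalgE pathalg_mul_sumr; apply: eq_bigr => p _.
rewrite /pathalg_one pathalg_mul_suml (bigD1 (path_src p)) //=.
rewrite pathalg_mulUU /scaled_cat path_cat1p eqxx mul1r big1 ?addr0 // => v vp.
by rewrite pathalg_mulUU /scaled_cat path_cat1p (negPf vp).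
Qed.

Lemma pathalg_mulg1 : right_id pathalg_one pathalg_mul.
Proof.
move=> f; rewrite [f]monalgE pathalg_mul_suml; apply: eq_bigr => p _.
rewrite /pathalg_one pathalg_mul_sumr (bigD1 (path_tgt p)) //=.
rewrite pathalg_mulUU /scaled_cat path_catp1 eqxx mulr1 big1 ?addr0 // => v vp.
by rewrite pathalg_mulUU /scaled_cat path_catp1 (negPf vp).
Qed.

HB.instance Definition _ := GRing.Zmodule_isPzRing.Build kQ
  pathalg_mulA pathalg_mul1g pathalg_mulg1 pathalg_mulDl pathalg_mulDr.

(* Not stated as instances: MathComp algebras are over nontrivial rings, and kQ
   is trivial when Q has no vertex. *)
Lemma pathalg_scaleAl c f g : c *: (f * g) = c *: f * g.
Proof.
rewrite [RHS](pathalg_mulw (msuppZ_le _ _) (fsubset_refl _)).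
rewrite scaler_sumr; apply: eq_bigr => p _.
rewrite scaler_sumr; apply: eq_bigr => q _.
by rewrite scaler_scaled_cat mcoeffZ mulrA.
Qed.

Lemma pathalg_scaleAr c f g : c *: (f * g) = f * (c *: g).
Proof.
rewrite [RHS](pathalg_mulw (fsubset_refl _) (msuppZ_le _ _)).
rewrite scaler_sumr; apply: eq_bigr => p _.
rewrite scaler_sumr; apply: eq_bigr => q _.
by rewrite scaler_scaled_cat mcoeffZ mulrCA.
Qed.

End PathAlgebra.

Definition arrow_ideal (k : fieldType) (Q : quiver) : ideal (pathalg k Q) :=
  ideal_gen [set x : pathalg k Q | exists a : arrow Q, x = << arrow_path a >>].

Definition truncated_pathalg (k : fieldType) (Q : quiver) (l : nat) :
    pzRingType :=
  quotient_ring (ideal_pow (arrow_ideal k Q) l).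

(* [A^c] is the opposite ring of A, and right A-modules are left A^c-modules. *)
Notation rmodType A := (lmodType A^c).

Section RightModules.
Variable A : pzRingType.
Implicit Types M N K L P : rmodType A.

Definition surj M N (f : M -> N) : Prop := forall y, exists x, f x = y.

Definition fin_gen M : Prop :=
  exists (n : nat) (g : 'I_n -> M),
    forall x, exists c : 'I_n -> A^c, x = \sum_(i < n) c i *: g i.

Definition simple M : Prop :=
  (exists x : M, x != 0) /\
  forall S : {pred M}, submod_closed S ->
    (forall x, x \in S -> x = 0) \/ (forall x, x \in S).

Definition projective P : Prop :=
  forall M N (g : {linear M -> N}) (f : {linear P -> N}), surj g ->
    exists h : {linear P -> M}, forall x, g (h x) = f x.

Definition superfluous M (X : set M) : Prop :=
  forall S : {pred M}, submod_closed S ->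
    (forall x, exists y z, [/\ y \in S, X z & x = y + z]) -> forall x, x \in S.

Definition projective_cover P M (p : {linear P -> M}) : Prop :=
  [/\ fin_gen P, projective P, surj p & superfluous [set x | p x = 0]].

(* [K] is, up to isomorphism, the syzygy of [M]. *)
Definition is_syzygy M K : Prop :=
  exists P (p : {linear P -> M}) (i : {linear K -> P}),
    [/\ projective_cover p, injective i
      & forall x, p x = 0 <-> exists y, i y = x].

Inductive nth_syzygy M : nat -> rmodType A -> Prop :=
| nth_syzygy0 : nth_syzygy M 0 M
| nth_syzygyS n L K :
    nth_syzygy M n L -> is_syzygy L K -> nth_syzygy M n.+1 K.

(* [f] and [g] become equal in the stable category of finitely generated
   modules. *)
Definition stable_eq M N (f g : {linear M -> N}) : Prop :=
  exists P (a : {linear M -> P}) (b : {linear P -> N}),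
    [/\ fin_gen P, projective P & forall x, f x - g x = b (a x)].

Definition stable_iso M N : Prop :=
  exists (f : {linear M -> N}) (g : {linear N -> M}),
    stable_eq (g \o f) idfun /\ stable_eq (f \o g) idfun.

Definition stable_summand M N : Prop :=
  exists L, fin_gen L /\ stable_iso (M * L)%type N.

Definition dell_mod M : enat :=
  enat_inf [set n | exists K N L,
    [/\ fin_gen N, nth_syzygy M n K, nth_syzygy N n.+1 L
      & stable_summand K L]].

Definition dell : enat :=
  enat_sup [set d | exists S, simple S /\ d = dell_mod S].

Definition Dell : enat :=
  enat_sup [set d | exists M, fin_gen M /\ d = dell_mod M].

(* A projective resolution of length at most [n]: the terms beyond [n] are 0. *)
Definition has_proj_resolution M (n : nat) : Prop :=
  exists (P : nat -> rmodType A) (d : forall i, {linear P i.+1 -> P i})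
         (e : {linear P 0%N -> M}),
    [/\ forall i, fin_gen (P i) /\ projective (P i),
        surj e,
        forall x, e x = 0 <-> exists y, d 0%N y = x,
        forall i x, d i x = 0 <-> exists y, d i.+1 y = x
      & forall i, (n < i)%N -> forall x : P i, x = 0].

Definition proj_dim M : enat := enat_inf [set n | has_proj_resolution M n].

Definition findim : enat :=
  enat_sup [set d | exists M,
    [/\ fin_gen M, enat_lt (proj_dim M) None & d = proj_dim M]].

End RightModules.

(* Main.v *)
From HB Require Import structures.
From mathcomp Require Import all_boot all_algebra finmap.
From mathcomp Require Import boolp monalg.
From mathcomp Require Import zify.
Require Import Defs.

(** Right modules over A = kQ/J^l are representations of Q, left modules are
    representations of the opposite quiver, and both sides of the equality
    turn out to count lengths of paths of Q.

    For a vertex v and 0 < m < l, call e_v A / e_v J^m the path module of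
    length m at v.  Its syzygy e_v J^m is the direct sum of the right ideals pA
    over the paths p of length m starting at v, and pA is the path module of
    length l - m at the end of p [path_module_syzygy].  Iterated syzygies of
    path modules therefore spread along paths made of pieces of lengths
    m, l - m, m, ..., and [alt l n j] is the total length of n such pieces, the
    first one of length j.  This gives two facts, which use the same numbers:
    - the path module of length m at x is, up to a complement, an n-th syzygy
      when a path of length [alt l n (l - m)] ends at x
      [path_module_nth_syzygy];
    - the left path module of length j at x has projective dimension n when n
      is the largest number such that a path of length [alt l n j] ends at x
      [path_module_finite_resolution], [path_generator_no_path_out].

    Upper bound.  Let d be the finitistic dimension of the opposite algebra,
    assumed positive and finite.  Every first syzygy is a direct sum of path
    modules [syzygy_path_basis].  Therefore the d-th syzygy of any module is a
    direct sum of path modules, of length m at x say, such that a path of length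
    [alt l d (l - m)] ends at x.  Suppose that one of them is not projective and
    that no path of length [alt l d.+1 (l - m)] ends at x.  Then the left path
    module of length l - m at x has projective dimension d.  As the right path
    module is not projective, a path of length m leaves x; it makes the left
    one the syzygy of a module of projective dimension d + 1 [exists_proj_dim],
    which is absurd.  Hence all the summands that are not projective are also
    summands of (d + 1)-st syzygies [delooping_bound].

    Lower bound.  Let N be a left module of projective dimension d > 0.  Going
    down a minimal resolution of N and following leading terms yields a vertex
    v such that the paths ending at v have bounded length, but some path through
    v is long [proj_dim_vertex].  Let S be the simple module at the start of a
    longest path ending at v.  For n < d the n-th syzygy of S has a generator at
    the vertex reached along this path after [alt l n 1] steps; by maximality no
    longer path ends there, whereas a stable summand of an (n + 1)-st syzygy
    would require one [has_path_in_of_syzygy].  So the delooping level of S is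
    at least d [simple_not_summand].

    All this rests on one property of free modules, [path_free]: if the sum of
    the a z_a over the arrows a lies in the (s + 1)-st power of the radical,
    then each z_a lies in the s-th power.  The arguments about A and about its
    opposite are made once, for a ring satisfying the axioms
    [truncated_path_ring]; these hold on both sides, with sources and targets
    exchanged. *)

Set Implicit Arguments.
Unset Strict Implicit.
Unset Printing Implicit Defensive.

Import GRing.Theory.
Local Open Scope ring_scope.
Local Open Scope quotient_scope.

(** * Linear maps, submodules and quotients *)

Section LinearMaps.
Variable B : pzRingType.
Implicit Types M N K P : lmodType B.

Definition lin_pack M N (f : M -> N) (fP : linear f) : {linear M -> N} :=
  HB.pack f (GRing.isLinear.Build B M N *:%R f fP).

Lemma lin_exists M N (f : M -> N) : linear f ->
  exists g : {linear M -> N}, forall x, g x = f x.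
Proof. by move=> fP; exists (lin_pack fP). Qed.

Lemma lin_inj M N (f : {linear M -> N}) :
  (forall x, f x = 0 -> x = 0) -> injective f.
Proof.
move=> f0 x y e; apply/eqP; rewrite -subr_eq0; apply/eqP/f0.
by rewrite linearB /= e subrr.
Qed.

Lemma lin_eq0 M N (f : {linear M -> N}) :
  injective f -> forall x, f x = 0 -> x = 0.
Proof. by move=> fi x e; apply: fi; rewrite e linear0. Qed.

(** Prop-valued, so that kernels, images and spans need no decision procedure. *)
Record submodule M := Submodule {
  in_submodule :> M -> Prop;
  submodule0 : in_submodule 0;
  submoduleL : forall a x y,
    in_submodule x -> in_submodule y -> in_submodule (a *: x + y) }.

Lemma submoduleD M (S : submodule M) x y : S x -> S y -> S (x + y).
Proof. by move=> Sx Sy; rewrite -[x]scale1r; apply: submoduleL. Qed.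

Lemma submoduleZ M (S : submodule M) a x : S x -> S (a *: x).
Proof.
by move=> Sx; rewrite -[a *: x]addr0; apply: submoduleL => //; apply: submodule0.
Qed.

Lemma submoduleN M (S : submodule M) x : S x -> S (- x).
Proof. by move=> Sx; rewrite -scaleN1r; apply: submoduleZ. Qed.

Lemma submoduleB M (S : submodule M) x y : S x -> S y -> S (x - y).
Proof. by move=> Sx Sy; apply: submoduleD => //; apply: submoduleN. Qed.

Lemma submodule_sum M (S : submodule M) (I : Type) (r : seq I) (p : pred I)
    (F : I -> M) : (forall i, p i -> S (F i)) -> S (\sum_(i <- r | p i) F i).
Proof.
by move=> h; apply: (big_ind S) => //; [apply: submodule0 | apply: submoduleD].
Qed.

Definition submodule_pred M (S : submodule M) : {pred M} := fun x => `[< S x >].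

Lemma submodule_pred_closed M (S : submodule M) : submod_closed (submodule_pred S).
Proof.
split; first exact/asboolP/submodule0.
by move=> a x y /asboolP Sx /asboolP Sy; apply/asboolP/submoduleL.
Qed.

Definition ker_submodule M N (f : {linear M -> N}) : submodule M.
Proof.
exists (fun x => f x = 0); first exact: linear0.
by move=> a x y fx fy; rewrite linearP fx fy scaler0 addr0.
Defined.

Definition im_submodule M N (f : {linear M -> N}) : submodule N.
Proof.
exists (fun y => exists x, f x = y); first by exists 0; rewrite linear0.
by move=> a _ _ [x <-] [y <-]; exists (a *: x + y); rewrite linearP.
Defined.

Definition submodule_of_pred M (S : {pred M}) (Sc : submod_closed S) :
    submodule M :=
  @Submodule M (fun x => x \in S) Sc.1 (fun a x y => Sc.2 a x y).

End LinearMaps.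

Section Subtype.
Variables (B : pzRingType) (M : lmodType B) (S : submodule M).

HB.instance Definition _ :=
  GRing.isSubmodClosed.Build B M (submodule_pred S) (submodule_pred_closed S).

Record submodule_type := SubmoduleElt {
  submodule_elt : M; _ : submodule_elt \in submodule_pred S }.
HB.instance Definition _ := [isSub for submodule_elt].
HB.instance Definition _ := [Choice of submodule_type by <:].
HB.instance Definition _ := [SubChoice_isSubLmodule of submodule_type by <:].

End Subtype.

Section QuotientModule.
Variables (B : pzRingType) (M : lmodType B) (S : submodule M).

Definition quotient_module := Quotient.quot (submodule_pred S).
HB.instance Definition _ := GRing.Zmodule.on quotient_module.

Definition mproj (x : M) : quotient_module :=
  \pi_(Quotient.quot (submodule_pred S)) x.

Lemma mprojP x y : mproj x = mproj y <-> S (x - y).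
Proof.
rewrite /mproj; split=> [/eqP|h].
  by rewrite -Quotient.idealrBE => /asboolP.
by apply/eqP; rewrite -Quotient.idealrBE; apply/asboolP.
Qed.

Lemma mproj_surj u : exists x, mproj x = u.
Proof. by exists (repr u); apply: reprK. Qed.

Lemma mprojD x y : mproj (x + y) = mproj x + mproj y.
Proof. exact: (raddfD (\pi_(Quotient.quot (submodule_pred S)))). Qed.

Definition mscale (a : B) (u : quotient_module) : quotient_module :=
  mproj (a *: repr u).

Lemma mscaleE a x : mscale a (mproj x) = mproj (a *: x).
Proof.
apply/mprojP; rewrite -scalerBr; apply: submoduleZ.
by apply/mprojP; apply: reprK.
Qed.

Fact mscaleA a b u : mscale a (mscale b u) = mscale (a * b) u.
Proof. by have [x <-] := mproj_surj u; rewrite !mscaleE scalerA. Qed.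

Fact mscale1 : left_id 1 mscale.
Proof. by move=> u; have [x <-] := mproj_surj u; rewrite mscaleE scale1r. Qed.

Fact mscaleDr : right_distributive mscale +%R.
Proof.
move=> a u v; have [x <-] := mproj_surj u; have [y <-] := mproj_surj v.
by rewrite -mprojD !mscaleE scalerDr mprojD.
Qed.

Fact mscaleDl u : {morph mscale^~ u : a b / a + b}.
Proof.
by move=> a b; have [x <-] := mproj_surj u; rewrite !mscaleE scalerDl mprojD.
Qed.

HB.instance Definition _ := GRing.Zmodule_isLmodule.Build B quotient_module
  mscaleA mscale1 mscaleDr mscaleDl.

End QuotientModule.

Section ModuleConstructions.
Variable B : pzRingType.
Implicit Types M N K P : lmodType B.

(** Submodules and quotients are used only through their universal maps; this
    lemma and the next one hide the carrier types. *)
Lemma exists_sub M (S : submodule M) :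
  exists (K : lmodType B) (i : {linear K -> M}),
    injective i /\ forall x, S x <-> exists y, i y = x.
Proof.
exists (submodule_type S), val; split; first exact: val_inj.
move=> x; split=> [Sx|[y <-]]; last by have := valP y; rewrite unfold_in => /asboolP.
have Sx' : x \in submodule_pred S by apply/asboolP.
by exists (Sub x Sx').
Qed.

Lemma exists_quotient M (S : submodule M) :
  exists (N : lmodType B) (p : {linear M -> N}),
    (forall y, exists x, p x = y) /\ forall x, p x = 0 <-> S x.
Proof.
have mprojL : linear (@mproj B M S).
  by move=> a x y; rewrite mprojD -mscaleE.
have [p pE] := lin_exists mprojL.
exists (quotient_module S), p; split=> [y|x].
  by have [x <-] := mproj_surj y; exists x.
rewrite pE; have <- : mproj S 0 = 0 by rewrite -pE linear0.
by split=> [/mprojP|Sx]; [|apply/mprojP]; rewrite subr0.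
Qed.

Lemma lin_factor M K P (i : {linear K -> P}) (f : {linear M -> P}) :
  injective i -> (forall x, exists y, i y = f x) ->
  exists g : {linear M -> K}, forall x, i (g x) = f x.
Proof.
move=> i_inj /choice[g gP].
have [h hE] : exists h : {linear M -> K}, forall x, h x = g x.
  by apply: lin_exists => a x y; apply: i_inj; rewrite !(gP, linearP).
by exists h => x; rewrite hE.
Qed.

(** Images of generators may be prescribed freely, subject to the relations. *)
Lemma lin_of_gens (I : finType) M N (X : {set I}) (g : I -> M) (n : I -> N) :
  (forall x, exists b : I -> B, x = \sum_(i in X) b i *: g i) ->
  (forall b : I -> B, \sum_(i in X) b i *: g i = 0 ->
     \sum_(i in X) b i *: n i = 0) ->
  exists f : {linear M -> N}, forall b : I -> B,
    f (\sum_(i in X) b i *: g i) = \sum_(i in X) b i *: n i.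
Proof.
move=> /choice[c cP] rel.
have wd (b b' : I -> B) : \sum_(i in X) b i *: g i = \sum_(i in X) b' i *: g i ->
    \sum_(i in X) b i *: n i = \sum_(i in X) b' i *: n i.
  move=> /eqP; rewrite -subr_eq0 -sumrB => /eqP e.
  apply/eqP; rewrite -subr_eq0 -sumrB; apply/eqP.
  rewrite -[RHS](rel (fun i => b i - b' i)).
    by apply: eq_bigr => i _; rewrite scalerBl.
  by rewrite -[RHS]e; apply: eq_bigr => i _; rewrite scalerBl.
have [f fE] : exists f : {linear M -> N},
    forall x, f x = \sum_(i in X) c x i *: n i.
  apply: lin_exists => a x y; rewrite scaler_sumr -big_split /=.
  rewrite -(wd (fun i => a * c x i + c y i)); last first.
    rewrite -cP {2}(cP x) {2}(cP y) scaler_sumr -big_split /=.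
    by apply: eq_bigr => i _; rewrite scalerDl scalerA.
  by apply: eq_bigr => i _; rewrite scalerDl scalerA.
by exists f => b; rewrite fE; apply: wd; rewrite -cP.
Qed.

Definition iso M N := exists f : {linear M -> N},
  injective f /\ forall y, exists x, f x = y.

Lemma iso_refl M : iso M M.
Proof. by exists idfun; split=> // y; exists y. Qed.

Lemma iso_trans N M K : iso M N -> iso N K -> iso M K.
Proof.
move=> [f [fi fs]] [g [gi gs]]; exists (g \o f); split.
  by move=> x y /= /gi /fi.
by move=> z; have [y <-] := gs z; have [x <-] := fs y; exists x.
Qed.

Lemma iso_inv M N (f : {linear M -> N}) :
  injective f -> (forall y, exists x, f x = y) ->
  exists g : {linear N -> M}, cancel f g /\ cancel g f.
Proof.
move=> fi fs; have [g gP] := lin_factor (f := idfun) fi fs.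
by exists g; split=> [x|//]; apply: fi; rewrite gP.
Qed.

Lemma iso_of_cancel M N (f : {linear M -> N}) (g : {linear N -> M}) :
  cancel f g -> cancel g f -> iso M N.
Proof. by move=> fK gK; exists f; split; [apply: can_inj fK | move=> y; exists (g y)]. Qed.

Lemma iso_sym M N : iso M N -> iso N M.
Proof.
by move=> [f [fi fs]]; have [g [fK gK]] := iso_inv fi fs; apply: iso_of_cancel gK fK.
Qed.

Lemma lin_prod M N M' N' (f : {linear M -> N}) (f' : {linear M' -> N'}) :
  exists g : {linear (M * M')%type -> (N * N')%type},
    forall x, g x = (f x.1, f' x.2).
Proof. by apply: lin_exists => a x y /=; rewrite !linearP. Qed.

Lemma lin_pair K M N (f : {linear K -> M}) (f' : {linear K -> N}) :
  exists g : {linear K -> (M * N)%type}, forall x, g x = (f x, f' x).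
Proof. by apply: lin_exists => a x y /=; rewrite !linearP. Qed.

Lemma lin_copair K M N (f : {linear M -> K}) (f' : {linear N -> K}) :
  exists g : {linear (M * N)%type -> K}, forall x, g x = f x.1 + f' x.2.
Proof.
by apply: lin_exists => a x y /=; rewrite !linearP scalerDr addrACA.
Qed.

Lemma lin_zero M N : exists z : {linear M -> N}, forall x, z x = 0.
Proof. by apply: lin_exists => a x y; rewrite scaler0 addr0. Qed.

Lemma lin_fst M N : exists p : {linear (M * N)%type -> M}, forall x, p x = x.1.
Proof. exact: lin_exists. Qed.

Lemma lin_snd M N : exists p : {linear (M * N)%type -> N}, forall x, p x = x.2.
Proof. exact: lin_exists. Qed.

Lemma lin_inl M N : exists u : {linear M -> (M * N)%type}, forall x, u x = (x, 0).
Proof.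
by apply: lin_exists => a x y; apply/eqP; rewrite xpair_eqE /= scaler0 addr0 !eqxx.
Qed.

Lemma iso_prod M N M' N' : iso M N -> iso M' N' -> iso (M * M')%type (N * N')%type.
Proof.
move=> [f [fi fs]] [g [gi gs]]; have [h hE] := lin_prod f g; exists h; split.
  by move=> [x x'] [y y']; rewrite !hE /= => -[/fi -> /gi ->].
move=> [y y']; have [x <-] := fs y; have [x' <-] := gs y'.
by exists (x, x'); rewrite hE.
Qed.

Lemma iso_prodACA M N M' N' :
  iso ((M * N) * (M' * N'))%type ((M * M') * (N * N'))%type.
Proof.
have [f fE] : exists f : {linear ((M * N) * (M' * N'))%type ->
    ((M * M') * (N * N'))%type},
    forall x, f x = ((x.1.1, x.2.1), (x.1.2, x.2.2)).
  exact: lin_exists.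
exists f; split=> [[[? ?] [? ?]] [[? ?] [? ?]]|[[a b] [c d]]].
  by rewrite !fE /= => -[-> -> -> ->].
by exists ((a, c), (b, d)); rewrite fE.
Qed.

Lemma iso_prodC M N : iso (M * N)%type (N * M)%type.
Proof.
have [f fE] : exists f : {linear (M * N)%type -> (N * M)%type},
    forall x, f x = (x.2, x.1) by exact: lin_exists.
exists f; split=> [[a b] [c d]|[a b]]; first by rewrite !fE /= => -[-> ->].
by exists (b, a); rewrite fE.
Qed.

Lemma iso_prodA M N K : iso (M * (N * K))%type ((M * N) * K)%type.
Proof.
have [f fE] : exists f : {linear (M * (N * K))%type -> ((M * N) * K)%type},
    forall x, f x = ((x.1, x.2.1), x.2.2) by exact: lin_exists.
exists f; split=> [[a [b c]] [d [e g]]|[[a b] c]]; first by rewrite !fE /= => -[-> -> ->].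
by exists (a, (b, c)); rewrite fE.
Qed.

Definition zero_module M := forall x : M, x = 0.

Lemma exists_zero_module : exists M, zero_module M.
Proof.
have h a (x y : B^o) : x = 0 -> y = 0 -> a *: x + y = 0.
  by move=> -> ->; rewrite scaler0 addr0.
have [M [i [ii iP]]] := exists_sub (Submodule (erefl 0) h).
by exists M => x; apply: ii; rewrite linear0; apply/iP; exists x.
Qed.

Lemma iso_prod0 M Z : zero_module Z -> iso (M * Z)%type M.
Proof.
move=> Z0; have [f fE] := lin_fst M Z; exists f; split=> [[a b] [c d]|x]; last by exists (x, 0); rewrite fE.
by rewrite !fE /= (Z0 b) (Z0 d) => ->.
Qed.

(** An internal direct sum of two submodules is their product.  Both are given
    together with their inclusions, because the summands are used as modules in
    their own right. *)
Lemma iso_internal_sum M (S1 S2 : submodule M) :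
  (forall x, exists y z, [/\ S1 y, S2 z & x = y + z]) ->
  (forall y z, S1 y -> S2 z -> y + z = 0 -> y = 0) ->
  exists (K1 K2 : lmodType B) (i1 : {linear K1 -> M}) (i2 : {linear K2 -> M}),
    [/\ injective i1, injective i2, (forall x, S1 x <-> exists y, i1 y = x),
        (forall x, S2 x <-> exists y, i2 y = x) & iso (K1 * K2)%type M].
Proof.
move=> gen ind; have [K1 [i1 [i1i i1P]]] := exists_sub S1.
have [K2 [i2 [i2i i2P]]] := exists_sub S2.
exists K1, K2, i1, i2; split=> //.
have [f fE] := lin_copair i1 i2; exists f; split.
  apply: lin_inj => -[a b]; rewrite fE /= => e.
  have a0 : i1 a = 0.
    by apply: ind e; [apply/i1P; exists a | apply/i2P; exists b].
  move: e; rewrite a0 add0r => b0.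
  by congr pair; [apply: i1i | apply: i2i]; rewrite linear0.
move=> x; have [y [z [/i1P[a ea] /i2P[b eb] ->]]] := gen x.
by exists (a, b); rewrite fE /= ea eb.
Qed.

End ModuleConstructions.

(** * Syzygies, projective resolutions and stable summands *)

Section Homological.
Variable A : pzRingType.
Local Notation B := (A^c).
Implicit Types M N K L P X Z W G Q : rmodType A.

Lemma fin_gen_family (I : finType) (X : {set I}) M (g : I -> M) :
  (forall x, exists b : I -> B, x = \sum_(i in X) b i *: g i) -> fin_gen M.
Proof.
move=> h; exists #|X|, (fun i => g (enum_val i)) => x.
have [b ->] := h x; exists (fun i => b (enum_val i)).
by rewrite (big_enum_val (fun i => b i *: g i)).
Qed.

Lemma fin_gen_surj M N (f : {linear M -> N}) : surj f -> fin_gen M -> fin_gen N.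
Proof.
move=> fs [n [g gP]]; exists n, (fun i => f (g i)) => y.
have [x <-] := fs y; have [c ->] := gP x; exists c.
by rewrite linear_sum; apply: eq_bigr => i _; rewrite linearZ.
Qed.

Lemma fin_gen_iso M N : iso M N -> fin_gen M -> fin_gen N.
Proof. by move=> [f [_ fs]]; apply: fin_gen_surj fs. Qed.

Lemma fin_gen_zero Z : zero_module Z -> fin_gen Z.
Proof. by move=> Z0; exists 0%N, (fun _ => 0) => x; exists (fun _ => 0); rewrite big_ord0. Qed.

Lemma fin_gen_prod M N : fin_gen M -> fin_gen N -> fin_gen (M * N)%type.
Proof.
move=> [m [g gP]] [n [h hP]].
pose gh (i : 'I_m + 'I_n) : (M * N)%type :=
  match i with inl i => (g i, 0) | inr j => (0, h j) end.
apply: (@fin_gen_family _ setT _ gh) => -[x y].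
have [c ->] := gP x; have [d ->] := hP y.
exists (fun i => match i with inl i => c i | inr j => d j end).
rewrite [RHS](eq_bigl xpredT) => [|i]; last by rewrite inE.
rewrite big_sumType /=; apply/eqP; rewrite xpair_eqE /=; apply/andP; split.
  rewrite (raddf_sum fst) (raddf_sum fst) /= [X in _ + X]big1 ?addr0 // => i _.
  exact: scaler0.
rewrite (raddf_sum snd) (raddf_sum snd) /= [X in X + _]big1 ?add0r // => i _.
exact: scaler0.
Qed.

Lemma projective_summand M N : projective (M * N)%type -> projective M.
Proof.
move=> pr X Y g f gs.
have [h hE] := lin_prod f (idfun : {linear N -> N}).
have [g' g'E] := lin_prod g (idfun : {linear N -> N}).
have g's : surj g'.
  by move=> [a b]; have [x <-] := gs a; exists (x, b); rewrite g'E.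
have [u uP] := pr _ _ g' h g's.
have [v vE] : exists v : {linear M -> X}, forall x, v x = (u (x, 0)).1.
  apply: lin_exists => a x y.
  have -> : (a *: x + y, 0) = a *: (x, 0) + (y, 0) :> (M * N)%type.
    by congr pair; rewrite /= scaler0 addr0.
  by rewrite linearP.
by exists v => x; rewrite vE; have := uP (x, 0); rewrite g'E hE => -[].
Qed.

Lemma projective_iso M N : iso M N -> projective M -> projective N.
Proof.
move=> [f [fi fs]] pr X Y g h gs; have [f' [fK f'K]] := iso_inv fi fs.
have [u uP] := pr _ _ g (h \o f) gs.
by exists (u \o f') => x /=; rewrite uP /= f'K.
Qed.

Lemma projective_prod M N : projective M -> projective N -> projective (M * N)%type.
Proof.
move=> prM prN X Y g f gs.
have [u1 u1E] := lin_inl M N.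
have [u2 u2E] : exists u : {linear N -> (M * N)%type}, forall x, u x = (0, x).
  apply: lin_exists => a x y; apply/eqP.
  by rewrite xpair_eqE /= scaler0 addr0 !eqxx.
have [h1 h1P] := prM _ _ g (f \o u1) gs.
have [h2 h2P] := prN _ _ g (f \o u2) gs.
have [h hE] := lin_copair h1 h2.
exists h => -[x y]; rewrite hE linearD h1P h2P /= -linearD u1E u2E.
by congr (f _); congr pair; rewrite /= ?addr0 ?add0r.
Qed.

Lemma projective_zero Z : zero_module Z -> projective Z.
Proof.
move=> Z0 X Y g f gs.
have [h hE] := lin_zero Z X.
by exists h => x; rewrite hE linear0 (Z0 x) linear0.
Qed.

Lemma nth_syzygy0P M K : nth_syzygy M 0 K -> K = M.
Proof. by move=> h; inversion h. Qed.

Lemma nth_syzygySP M K n : nth_syzygy M n.+1 K ->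
  exists L, nth_syzygy M n L /\ is_syzygy L K.
Proof. by move=> h; inversion h as [|m L X hL sK]; exists L. Qed.

Lemma nth_syzygy_front M K L n :
  is_syzygy M K -> nth_syzygy K n L -> nth_syzygy M n.+1 L.
Proof.
move=> sMK; elim=> [|m X Y _ IH sXY]; last exact: nth_syzygyS IH sXY.
exact: nth_syzygyS (nth_syzygy0 M) sMK.
Qed.

Lemma nth_syzygy_frontP M L n : nth_syzygy M n.+1 L ->
  exists K, is_syzygy M K /\ nth_syzygy K n L.
Proof.
elim: n L => [|n IH] L /nth_syzygySP[X [hX sXY]].
  by exists L; rewrite -{1}(nth_syzygy0P hX); split=> //; apply: nth_syzygy0.
have [K [sK hK]] := IH _ hX; exists K; split=> //; exact: nth_syzygyS hK sXY.
Qed.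

Lemma is_syzygy_iso M M' K K' :
  iso M M' -> iso K K' -> is_syzygy M K -> is_syzygy M' K'.
Proof.
move=> [f [fi fs]] /iso_sym[g [gi gs]] [P [p [i [[fg pr ps sup] ii ip]]]].
exists P, (f \o p), (i \o g); split.
- split=> //.
    by move=> y; have [x <-] := fs y; have [z <-] := ps x; exists z.
  have -> : (fun x => (f \o p) x = 0) = (fun x => p x = 0) => //.
  apply: funext => x /=; apply: propext; split=> [|->]; last exact: linear0.
  exact: lin_eq0.
- by move=> x y /= /ii /gi.
move=> x /=; split=> [|[y <-]].
  move=> /(lin_eq0 fi)/ip[y <-].
  by have [z <-] := gs y; exists z.
by have -> : p (i (g y)) = 0 by [apply/ip; exists (g y)]; exact: linear0.
Qed.

Lemma nth_syzygy_iso M M' K n : iso M M' -> nth_syzygy M n K ->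
  exists K', iso K K' /\ nth_syzygy M' n K'.
Proof.
move=> iM; case: n => [|n] h.
  by exists M'; rewrite (nth_syzygy0P h); split=> //; apply: nth_syzygy0.
have [L [sL hL]] := nth_syzygy_frontP h; exists K; split; first exact: iso_refl.
exact: nth_syzygy_front (is_syzygy_iso iM (iso_refl L) sL) hL.
Qed.

(** Schanuel's lemma.  Lifting [g] and [g'] to maps [s : G -> G'] and
    [t : G' -> G] over [W], the isomorphism is
    (z, y) |-> (y - s (z + t y), z + t y); its inverse has the same shape with
    the roles of [s] and [t] exchanged. *)
Lemma schanuel W G G' Z Z' (g : {linear G -> W}) (g' : {linear G' -> W})
    (i : {linear Z -> G}) (i' : {linear Z' -> G'}) :
  projective G -> projective G' -> surj g -> surj g' ->
  injective i -> injective i' ->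
  (forall x, g x = 0 <-> exists y, i y = x) ->
  (forall x, g' x = 0 <-> exists y, i' y = x) ->
  iso (Z * G')%type (Z' * G)%type.
Proof.
move=> prG prG' gs g's ii i'i ker ker'.
have [s sP] := prG _ _ g' g g's; have [t tP] := prG' _ _ g g' gs.
have gi y : g (i y) = 0 by apply/ker; exists y.
have g'i' y : g' (i' y) = 0 by apply/ker'; exists y.
have [h hE] : exists h : {linear (Z * G')%type -> G'},
    forall x, h x = x.2 - s (i x.1 + t x.2).
  have [c cE] := lin_copair i t; apply: lin_exists => a x y.
  by rewrite -!cE !linearP /= scalerDr addrACA.
have [h' h'E] : exists h : {linear (Z' * G)%type -> G},
    forall x, h x = x.2 - t (i' x.1 + s x.2).
  have [c cE] := lin_copair i' s; apply: lin_exists => a x y.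
  by rewrite -!cE !linearP /= scalerDr addrACA.
have [u uE] : exists u : {linear (Z * G')%type -> Z'}, forall x, i' (u x) = h x.
  apply: lin_factor => // x; apply/ker'.
  by rewrite hE linearB /= sP linearD /= gi tP add0r subrr.
have [v vE] : exists v : {linear (Z' * G)%type -> Z}, forall x, i (v x) = h' x.
  apply: lin_factor => // x; apply/ker.
  by rewrite h'E linearB /= tP linearD /= g'i' sP add0r subrr.
have [F FE] : exists F : {linear (Z * G')%type -> (Z' * G)%type},
    forall x, F x = (u x, i x.1 + t x.2).
  have [c cE] := lin_copair i t; have [F FE] := lin_pair u c.
  by exists F => x; rewrite FE cE.
have [F' F'E] : exists F : {linear (Z' * G)%type -> (Z * G')%type},
    forall x, F x = (v x, i' x.1 + s x.2).
  have [c cE] := lin_copair i' s; have [F' F'E] := lin_pair v c.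
  by exists F' => x; rewrite F'E cE.
apply: (iso_of_cancel (f := F) (g := F')) => -[x y]; rewrite FE F'E /=.
  have e : i' (u (x, y)) + s (i x + t y) = y by rewrite uE hE /= subrK.
  by congr pair => //; apply: ii; rewrite vE h'E /= e addrK.
have e : i (v (x, y)) + t (i' x + s y) = y by rewrite vE h'E /= subrK.
by congr pair => //; apply: i'i; rewrite uE hE /= e addrK.
Qed.

Lemma has_proj_resolution0 M : has_proj_resolution M 0 -> projective M.
Proof.
move=> [P [d [e [pr es ker _ z]]]]; apply: projective_iso (pr 0%N).2.
exists e; split=> //; apply: lin_inj => x /ker[y <-].
by rewrite (z 1%N isT y) linear0.
Qed.

(** Cutting off the first term of a resolution leaves a resolution of the
    kernel of the augmentation. *)
Lemma has_proj_resolutionS M n : has_proj_resolution M n.+1 ->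
  exists P (p : {linear P -> M}) K (i : {linear K -> P}),
    [/\ projective P, surj p, injective i, forall x, p x = 0 <-> exists y, i y = x
      & has_proj_resolution K n].
Proof.
move=> [P [d [e [pr es ker ex z]]]].
have [K [i [ii iP]]] := exists_sub (ker_submodule e).
have [e' e'E] : exists e' : {linear P 1%N -> K}, forall x, i (e' x) = d 0%N x.
  by apply: lin_factor => // x; apply/iP; apply/ker; exists x.
exists (P 0%N), e, K, i; split=> //; first exact: (pr 0%N).2.
exists (fun i => P i.+1), (fun i => d i.+1), e'; split.
- by move=> m; apply: pr.
- move=> y; have /ker[x ex'] : e (i y) = 0 by apply/iP; exists y.
  by exists x; apply: ii; rewrite e'E.
- move=> x; split=> [h|h]; last by apply: ii; rewrite e'E linear0; apply/ex.
  by apply/ex; rewrite -e'E h linear0.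
- by move=> m; apply: ex.
- by move=> m nm; apply: z.
Qed.

(** The given resolution need not be minimal.  By Schanuel's lemma its kernels
    and the syzygies agree up to projective summands, which is what the
    induction carries along. *)
Lemma projective_nth_syzygy M K n :
  has_proj_resolution M n -> nth_syzygy M n K -> projective K.
Proof.
suff h N P P' : projective P -> projective P' ->
    iso (N * P)%type (M * P')%type ->
    has_proj_resolution N n -> nth_syzygy M n K -> projective K.
  have [Z Z0] := exists_zero_module B.
  by apply: h (iso_refl (M * Z)%type); apply: projective_zero.
elim: n M N P P' => [|n IH] M N P P' prP prP' iNM.
  move=> /has_proj_resolution0 prN /nth_syzygy0P KM; subst.
  by apply: (@projective_summand _ P'); apply: projective_iso iNM _; apply: projective_prod.
move=> /has_proj_resolutionS[G [g [Z [i [prG gs ii ker res]]]]].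
move=> /nth_syzygy_frontP[K1 [[Q [q [j [[_ prQ qs _] ji kerq]]]] hK]].
have [f [fi fs]] := iNM.
have [g1 g1E] := lin_prod g (idfun : {linear P -> P}).
have [q1 q1E] := lin_prod q (idfun : {linear P' -> P'}).
have [i1 i1E] : exists i1 : {linear Z -> (G * P)%type}, forall x, i1 x = (i x, 0).
  by have [u uE] := lin_inl G P; exists (u \o i) => x; rewrite /= uE.
have [j1 j1E] : exists j1 : {linear K1 -> (Q * P')%type}, forall x, j1 x = (j x, 0).
  by have [u uE] := lin_inl Q P'; exists (u \o j) => x; rewrite /= uE.
have fg0 x : f (g1 x) = 0 <-> g x.1 = 0 /\ x.2 = 0.
  split=> [|[a b]]; last by rewrite g1E a b /= (_ : (0, 0) = 0) // linear0.
  by move=> /(lin_eq0 fi); rewrite g1E => -[].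
have i' : iso (Z * (Q * P'))%type (K1 * (G * P))%type.
  apply: (schanuel (g := f \o g1) (g' := q1) (i := i1) (i' := j1)).
  - exact: projective_prod.
  - exact: projective_prod.
  - move=> y; have [[a b] <-] := fs y; have [c <-] := gs a.
    by exists (c, b); rewrite /= g1E.
  - by move=> [a b]; have [c <-] := qs a; exists (c, b); rewrite q1E.
  - by move=> x y; rewrite !i1E => -[/ii].
  - by move=> x y; rewrite !j1E => -[/ji].
  - move=> x; split=> [/fg0[/ker[y e] e2]|[y <-]].
      by exists y; rewrite i1E e -e2; case: x {e e2}.
    by apply/fg0; rewrite i1E; split=> //; apply/ker; exists y.
  - move=> x; split=> [|[y <-]].
      rewrite q1E => -[/kerq[y e] e2].
      by exists y; rewrite j1E e -[0]e2; case: x {e e2}.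
    have e : q (j y) = 0 by apply/kerq; exists y.
    by rewrite q1E j1E /= e.
by apply: (IH _ _ _ _ _ _ i' res hK); apply: projective_prod.
Qed.

(** The converse: the projective covers along a chain of syzygies, followed by
    the last syzygy, form a resolution. *)
Lemma has_proj_resolution_syzygy M K n : nth_syzygy M n K ->
  fin_gen K -> projective K -> has_proj_resolution M n.
Proof.
elim: n M => [|n IH] M.
  move=> /nth_syzygy0P KM fg pr; subst M.
  have [Z Z0] := exists_zero_module B.
  have [z zE] := lin_zero Z K.
  pose P i : rmodType A := if i is 0%N then K else Z.
  pose d i : {linear P i.+1 -> P i} :=
    match i with 0%N => z | i.+1 => idfun end.
  exists P, d, (idfun : {linear K -> K}); split=> [[|i]|y|x|[|i] x|[|i] _ x] //=.
  - by split; [apply: fin_gen_zero | apply: projective_zero].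
  - by exists y.
  - by split=> [->|[y <-]] //; exists 0; rewrite zE.
  - by split=> [_|[y _]]; [exists x; rewrite [LHS]Z0 | rewrite zE].
  - by split=> [_|[y _]]; [exists x; rewrite [LHS]Z0 | rewrite [LHS]Z0].
move=> /nth_syzygy_frontP[K1 [[Q [q [j [[fgQ prQ qs _] ji kerq]]]] hK]] fg pr.
have [P [d [e [Ppr es ker ex z]]]] := IH _ hK fg pr.
pose P' i : rmodType A := if i is i.+1 then P i else Q.
pose d' i : {linear P' i.+1 -> P' i} :=
  match i with 0%N => j \o e | i.+1 => d i end.
exists P', d', q; split=> [[|i]|//|x|[|i] x|[|i] //] /=.
- by split.
- exact: Ppr.
- split=> [/kerq[y <-]|[y <-]]; first by have [t <-] := es y; exists t.
  by apply/kerq; exists (e y).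
- rewrite -ker; split=> [h|->]; last exact: linear0.
  by apply: ji; rewrite linear0.
- exact: ex.
- exact: z.
Qed.

(** What is needed of a stable summand to refute it: a retraction up to a map
    that factors through a projective module. *)
Lemma stable_summand_maps K L : stable_summand K L ->
  exists (f : {linear K -> L}) (g : {linear L -> K}) P
         (a : {linear K -> P}) (b : {linear P -> K}),
    [/\ fin_gen P, projective P & forall x, g (f x) - x = b (a x)].
Proof.
move=> [L' [_ [f [g [[P [a [b [fg pr e]]]] _]]]]].
have [u uE] := lin_inl K L'; have [v vE] := lin_fst K L'.
exists (f \o u), (v \o g), P, (a \o u), (v \o b); split=> // x /=.
rewrite -e /= linearB /= [X in _ = _ - X]vE uE /=.
by [].
Qed.

(** Adding a projective module to the ambient module does not change it
    stably, so a genuine summand of [L * P] is a stable summand of [L]. *)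
Lemma stable_summand_iso K L' L P :
  iso (K * L')%type (L * P)%type -> fin_gen L -> fin_gen P -> projective P ->
  stable_summand K L.
Proof.
move=> iKL fgL fgP prP.
have [f [fi fs]] := iKL; have [g [fK gK]] := iso_inv fi fs.
have [v vE] := lin_snd K L'.
exists L'; split.
  apply: (fin_gen_surj (f := v \o g)); last exact: fin_gen_prod.
  by move=> y; exists (f (0, y)); rewrite /= fK vE.
have [p1 p1E] := lin_fst L P; have [p2 p2E] := lin_snd L P.
have [i1 i1E] := lin_inl L P.
have [i2 i2E] : exists u : {linear P -> (L * P)%type}, forall x, u x = (0, - x).
  apply: lin_exists => c x y; apply/eqP.
  by rewrite xpair_eqE /= scaler0 addr0 scalerN opprD !eqxx.
exists (p1 \o f), (g \o i1); split.
  exists P, (p2 \o f), (g \o i2); split=> // x /=.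
  rewrite -[X in _ - X]fK -linearB; congr (g _).
  rewrite i1E i2E p1E p2E; case: (f x) => a b; apply/eqP.
  by rewrite xpair_eqE /= subrr add0r !eqxx.
have [Z Z0] := exists_zero_module B.
have [z zE] := lin_zero L Z; have [z' z'E] := lin_zero Z L.
exists Z, z, z'; split; [exact: fin_gen_zero | exact: projective_zero |].
by move=> x /=; rewrite gK i1E p1E z'E subrr.
Qed.

End Homological.

(** * Alternating lengths *)

(** The length of a path made of [n] pieces of lengths j, l - j, j, ...: the
    position reached after [n] syzygies of a path module of length [j]. *)
Fixpoint alt (l n j : nat) : nat :=
  if n is n'.+1 then (j + alt l n' (l - j))%N else 0%N.

Section Alt.
Variable l : nat.
Implicit Types n j : nat.

Lemma altE n j : (j <= l)%N -> alt l n j = (n./2 * l + odd n * j)%N.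
Proof.
elim: n j => [|n IH] j jl; first by [].
rewrite /= IH ?leq_subr // uphalf_half mulnDl; case: (odd n) => /=; lia.
Qed.

Lemma alt_leq_r n j j' : (j <= j' <= l)%N -> (alt l n j <= alt l n j')%N.
Proof.
move=> /andP[jj' j'l]; rewrite !altE ?(leq_trans jj') // leq_add2l.
by rewrite leq_mul2l jj' orbT.
Qed.

Lemma alt_leq_l n n' j : (n <= n')%N -> (j <= l)%N -> (alt l n j <= alt l n' j)%N.
Proof.
move=> nn' jl; rewrite -(subnKC nn'); elim: (n' - n)%N => [|m IH]; first by rewrite addn0.
apply: leq_trans IH _; rewrite addnS !altE //= uphalf_half mulnDl.
by case: (odd (n + m)) => /=; lia.
Qed.

Lemma altS2 n j : (j <= l)%N -> alt l n.+2 j = (l + alt l n j)%N.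
Proof. by move=> jl /=; rewrite subKn // addnA subnKC. Qed.

End Alt.

(** * The radical filtration and truncated path rings *)

(** The product of the r-th power of the radical and the module. *)
Fixpoint fil (Ar : finType) (B : pzRingType) (ar : Ar -> B) (M : lmodType B)
    (r : nat) : M -> Prop :=
  if r is r'.+1 then
    fun x => exists z : Ar -> M,
      (forall a, fil ar r' (z a)) /\ x = \sum_a ar a *: z a
  else fun _ => True.

Section FilAdditive.
Variables (Ar : finType) (B : pzRingType) (ar : Ar -> B) (M : lmodType B).
Local Notation Fil := (fil ar).
Implicit Types (x y : M) (r : nat).

Lemma fil_0 r : Fil r (0 : M).
Proof.
elim: r => //= r IH; exists (fun _ => 0); split=> //.
by rewrite big1 // => a _; rewrite scaler0.
Qed.

Lemma fil_D r x y : Fil r x -> Fil r y -> Fil r (x + y).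
Proof.
elim: r x y => //= r IH x y [z [zP ->]] [t [tP ->]].
exists (fun a => z a + t a); split=> [a|]; first exact: IH.
by rewrite -big_split; apply: eq_bigr => a _; rewrite scalerDr.
Qed.

Lemma fil_sum r (I : Type) (s : seq I) (p : pred I) (F : I -> M) :
  (forall i, p i -> Fil r (F i)) -> Fil r (\sum_(i <- s | p i) F i).
Proof. by move=> h; apply: big_ind => //; [apply: fil_0 | apply: fil_D]. Qed.

End FilAdditive.

(** What the proof uses of kQ/J^l, seen as acting on the left: the arrow [a]
    maps the part of a module at [src a] to the part at [tgt a].  The field
    [tp_expand] says that the idempotents span the ring modulo the radical,
    [tp_nil] that words of length [l] vanish, and [tp_free] that below length
    [l] there are no other relations between arrows.  For right modules over
    the truncated algebra the ring is its opposite, and [src], [tgt] are the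
    source and the target in the quiver; for left modules they are exchanged. *)
Record truncated_path_ring (k : fieldType) (V Ar : finType) (src tgt : Ar -> V)
    (l : nat) (B : pzRingType) := TruncatedPathRing {
  tp_sc : {rmorphism k -> B};
  tp_e : V -> B;
  tp_ar : Ar -> B;
  tp_scC : forall c b, tp_sc c * b = b * tp_sc c;
  tp_eM : forall v w, tp_e v * tp_e w = if v == w then tp_e v else 0;
  tp_e1 : \sum_v tp_e v = 1;
  tp_tgt : forall a, tp_e (tgt a) * tp_ar a = tp_ar a;
  tp_src : forall a, tp_ar a * tp_e (src a) = tp_ar a;
  tp_expand : forall b, exists (c : V -> k) (y : Ar -> B),
    b = \sum_v tp_sc (c v) * tp_e v + \sum_a tp_ar a * y a;
  tp_e_neq0 : forall c v, fil tp_ar 1 (tp_sc c * tp_e v : B^o) -> c = 0;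
  tp_nil : forall b : B^o, fil tp_ar l b -> b = 0;
  tp_free : forall s (z : Ar -> B^o), (s < l)%N ->
    (forall a, tp_e (src a) *: z a = z a) ->
    fil tp_ar s.+1 (\sum_a tp_ar a *: z a) -> forall a, fil tp_ar s (z a) }.

(** Only the existence of a path of a given length matters, not the path. *)
Fixpoint reach (V Ar : finType) (src tgt : Ar -> V) (m : nat) (x w : V) : bool :=
  if m is m'.+1 then
    [exists a : Ar, (tgt a == w) && reach src tgt m' x (src a)]
  else x == w.

Section Reach.
Variables (V Ar : finType) (src tgt : Ar -> V).
Local Notation reach := (reach src tgt).

Lemma reach_cat m n x y z : reach m x y -> reach n y z -> reach (n + m) x z.
Proof.
move=> xy; elim: n z => [|n IH] z /=; first by move/eqP <-.
by case/existsP=> a /andP[az h]; apply/existsP; exists a; rewrite az IH.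
Qed.

Lemma reach_split m n x z : reach (n + m) x z ->
  exists2 y, reach m x y & reach n y z.
Proof.
elim: n z => [|n IH] z /=; first by exists z.
case/existsP=> a /andP[az /IH[y xy ya]]; exists y => //.
by apply/existsP; exists a; rewrite az.
Qed.

Definition has_path_in n v := [exists u, reach n u v].
Definition has_path_out n v := [exists u, reach n v u].

Lemma has_path_in_le m n v : (m <= n)%N -> has_path_in n v -> has_path_in m v.
Proof.
move=> mn /existsP[u]; rewrite -(subnKC mn) => /reach_split[w _ h].
by apply/existsP; exists w.
Qed.

Lemma has_path_out_le m n v : (m <= n)%N -> has_path_out n v -> has_path_out m v.
Proof.
move=> mn /existsP[u]; rewrite -(subnK mn) => /reach_split[w h _].
by apply/existsP; exists w.
Qed.

Lemma has_path_in_cat m n x y : has_path_in m x -> reach n x y -> has_path_in (n + m) y.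
Proof. by move=> /existsP[u h] h'; apply/existsP; exists u; apply: reach_cat h h'. Qed.

Lemma has_path_out_cat m n x y : reach m x y -> has_path_out n y -> has_path_out (n + m) x.
Proof. by move=> h /existsP[u h']; apply/existsP; exists u; apply: reach_cat h h'. Qed.

Lemma reach1 a : reach 1 (src a) (tgt a).
Proof. by apply/existsP; exists a; rewrite !eqxx. Qed.

End Reach.

Lemma reach_rev (V Ar : finType) (src tgt : Ar -> V) m x w :
  reach src tgt m x w -> reach tgt src m w x.
Proof.
elim: m w => [|m IH] w; first by rewrite /= eq_sym.
case/existsP=> a /andP[/eqP <- /IH h].
by rewrite -addn1; apply: reach_cat h; apply: reach1.
Qed.

Lemma has_path_in_rev (V Ar : finType) (src tgt : Ar -> V) n v :
  has_path_in src tgt n v = has_path_out tgt src n v.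
Proof. by apply/existsP/existsP=> -[u /reach_rev h]; exists u. Qed.

Section Truncated.
Variables (k : fieldType) (V Ar : finType) (src tgt : Ar -> V) (l : nat).
Variables (A : pzRingType).
Local Notation B := (A^c).
Variable T : truncated_path_ring k src tgt l B.
Hypothesis l_gt1 : (1 < l)%N.

Local Notation sc := (tp_sc T).
Local Notation e := (tp_e T).
Local Notation ar := (tp_ar T).
Local Notation Fil := (fil ar).
Implicit Types M N K L P X Z : rmodType A.
Implicit Types (v w : V) (a : Ar) (r s m n : nat).

Lemma e_idem v : e v * e v = e v.
Proof. by rewrite tp_eM eqxx. Qed.

Lemma e_orth v w : v != w -> e v * e w = 0.
Proof. by rewrite tp_eM => /negPf->. Qed.

Lemma sum_e M (x : M) : \sum_v e v *: x = x.
Proof. by rewrite -scaler_suml tp_e1 scale1r. Qed.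

Lemma e_ar a v : e v * ar a = if v == tgt a then ar a else 0.
Proof. by rewrite -tp_tgt mulrA tp_eM; case: eqP => [->|_] //; rewrite mul0r. Qed.

Lemma e_arZ M a v (x : M) : e v *: (ar a *: x) = if v == tgt a then ar a *: x else 0.
Proof. by rewrite scalerA e_ar; case: eqP => // _; rewrite scale0r. Qed.

Lemma ar_e M a (x : M) : ar a *: (e (src a) *: x) = ar a *: x.
Proof. by rewrite scalerA tp_src. Qed.

Lemma eZ_idem M v (x : M) : e v *: (e v *: x) = e v *: x.
Proof. by rewrite scalerA e_idem. Qed.

Section Filtration.
Variable M : rmodType A.
Implicit Types x y : M.

Lemma fil_ar r a x : Fil r x -> Fil r.+1 (ar a *: x).
Proof.
move=> h; exists (fun b => if b == a then x else 0); split.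
  by move=> b; case: eqP => // _; apply: fil_0.
rewrite (bigD1 a) //= eqxx big1 ?addr0 // => b /negPf->; exact: scaler0.
Qed.

(** Stability under scalars and monotonicity have to be proved together: moving
    a scalar past an arrow produces a word that is longer by one arrow. *)
Lemma fil_Z_le r :
  (forall b x, Fil r x -> Fil r (b *: x)) /\ (forall x, Fil r.+1 x -> Fil r x).
Proof.
elim: r => [//|r [IHZ IHle]]; split; last first.
  by move=> x [z [zP ->]]; exists z; split=> // a; apply: IHle; apply: zP.
move=> b _ [z [zP ->]]; rewrite scaler_sumr; apply: fil_sum => a _.
have [c [y ->]] := tp_expand T b; rewrite scalerDl !scaler_suml.
apply: fil_D; apply: fil_sum.
  move=> v _; rewrite -scalerA e_arZ; case: eqP => _; last by rewrite scaler0; apply: fil_0.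
  by rewrite scalerA tp_scC -scalerA; apply/fil_ar/IHZ/zP.
by move=> d _; rewrite -scalerA; apply/fil_ar/IHZ/IHle/fil_ar/zP.
Qed.

Lemma fil_Z r b x : Fil r x -> Fil r (b *: x).
Proof. exact: (fil_Z_le r).1. Qed.

Lemma fil_le r s x : (r <= s)%N -> Fil s x -> Fil r x.
Proof.
by move=> /subnK <-; elim: (s - r)%N x => // n IH x /(fil_Z_le _).2/IH.
Qed.

Definition fil_submodule r : submodule M :=
  Submodule (fil_0 ar M r) (fun b x y hx hy => fil_D (fil_Z b hx) hy).

Lemma fil_N r x : Fil r x -> Fil r (- x).
Proof. exact: (submoduleN (S := fil_submodule r)). Qed.

Lemma fil_B r x y : Fil r x -> Fil r y -> Fil r (x - y).
Proof. exact: (submoduleB (S := fil_submodule r)). Qed.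

Lemma fil_M r s (b : B^o) x : Fil r b -> Fil s x -> Fil (r + s) (b *: x).
Proof.
elim: r b => [|r IH] b; first by move=> _; apply: fil_Z.
move=> [z [zP ->]] h; rewrite scaler_suml; apply: fil_sum => a _.
by rewrite -scalerA; apply/fil_ar/IH => //; apply: zP.
Qed.

Lemma fil_Zl r (b : B^o) x : Fil r b -> Fil r (b *: x).
Proof. by move=> hb; rewrite -[r]addn0; apply: fil_M. Qed.

(** An arrow only sees the part of a module at its source. *)
Lemma fil_split r x : Fil r.+1 x -> exists z : Ar -> M,
  [/\ forall a, Fil r (z a), forall a, e (src a) *: z a = z a
    & x = \sum_a ar a *: z a].
Proof.
move=> [z [zP ->]]; exists (fun a => e (src a) *: z a); split=> [a|a|].
- exact/fil_Z/zP.
- exact: eZ_idem.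
- by apply: eq_bigr => a _; rewrite ar_e.
Qed.

Lemma fil_split_at r v x : e v *: x = x -> Fil r.+1 x ->
  exists z : Ar -> M,
  [/\ forall a, Fil r (z a), forall a, e (src a) *: z a = z a
    & x = \sum_(a | tgt a == v) ar a *: z a].
Proof.
move=> ev /fil_split[z [zP ze ex]]; exists z; split=> //.
rewrite -ev ex scaler_sumr [RHS]big_mkcond; apply: eq_bigr => a _.
by rewrite e_arZ eq_sym.
Qed.

End Filtration.

(** Elements of degree [r] are sums of multiples [b *: x] with [b] of degree [r]
    in the ring, so additive statements reduce to such multiples. *)
Lemma fil_ind M r (S : M -> Prop) : S 0 -> (forall x y, S x -> S y -> S (x + y)) ->
  (forall (b : B^o) x, Fil r b -> S (b *: x)) -> forall x, Fil r x -> S x.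
Proof.
elim: r S => [|r IH] S S0 SD SZ x; first by rewrite -[x]scale1r => _; apply: SZ.
move=> [z [zP ->]]; apply: (big_ind S) => // a _.
apply: (IH (fun x => S (ar a *: x))) (zP a).
- by rewrite scaler0.
- by move=> y t; rewrite scalerDr; apply: SD.
- by move=> b y hb; rewrite scalerA; apply: SZ; exact: (fil_ar (M := B^o) a hb).
Qed.

Lemma fil_lin M N (f : {linear M -> N}) r x : Fil r x -> Fil r (f x).
Proof.
elim: r x => // r IH x [z [zP ->]]; exists (fun a => f (z a)); split.
  by move=> a; apply/IH/zP.
by rewrite linear_sum; apply: eq_bigr => a _; rewrite linearZ.
Qed.

Lemma fil_surj M N (f : {linear M -> N}) r y : surj f -> Fil r y ->
  exists x, Fil r x /\ f x = y.
Proof.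
move=> fs; elim: r y => [|r IH] y; first by have [x <-] := fs y; exists x.
move=> [z [zP ->]]; have /choice[x xP] : forall a, exists x, Fil r x /\ f x = z a.
  by move=> a; apply/IH/zP.
exists (\sum_a ar a *: x a); split; first by exists x; split=> // a; have [] := xP a.
rewrite linear_sum; apply: eq_bigr => a _.
by rewrite linearZ; have [_ ->] := xP a.
Qed.

Lemma fil_nil M (x : M) : Fil l x -> x = 0.
Proof.
move: x; apply: (fil_ind (S := fun x : M => x = 0)) => // [y z -> ->|b y].
  exact: addr0.
move=> /tp_nil->.
exact: scale0r.
Qed.

Lemma fil_ge_nil M (x : M) r : (l <= r)%N -> Fil r x -> x = 0.
Proof. by move=> lr /(fil_le lr)/fil_nil. Qed.

(** Nonzero elements have a leading degree because the filtration ends at zero. *)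
Lemma exact_order M (x : M) j : x != 0 -> Fil j x ->
  exists r, [/\ (j <= r)%N, (r < l)%N, Fil r x & ~ Fil r.+1 x].
Proof.
move=> x0 hj; apply: contrapT => no.
have h n : Fil (j + n) x.
  elim: n => [|n IH]; rewrite ?addn0 // addnS; apply: contrapT => nh.
  apply: no; exists (j + n)%N; split=> //; first exact: leq_addr.
  rewrite ltnNge; apply/negP=> ln; case/eqP: x0; exact: fil_ge_nil ln IH.
by case/eqP: x0; apply: (fil_ge_nil (leq_addl j l) (h l)).
Qed.

Lemma not_fil_vtx M r (x : M) : ~ Fil r x -> exists v, ~ Fil r (e v *: x).
Proof.
move=> nx; apply: contrapT => no; apply: nx; rewrite -[x]sum_e.
by apply: fil_sum => v _; apply: contrapT => h; apply: no; exists v.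
Qed.

(** Substituting the decomposition into its own radical part pushes the error
    term down the filtration, which is finite. *)
Lemma nakayama M (S : submodule M) :
  (forall x, exists y z, [/\ S y, Fil 1 z & x = y + z]) -> forall x, S x.
Proof.
move=> gen x.
have h r : exists y z, [/\ S y, Fil r z & x = y + z].
  elim: r => [|r [y [z [Sy hz ->]]]].
    by exists 0, x; split=> //; [apply: submodule0 | rewrite add0r].
  have [u [t [Su ht ->]]] : exists u t, [/\ S u, Fil r.+1 t & z = u + t].
    move: z hz; apply: fil_ind.
    - by exists 0, 0; split; [apply: submodule0 | apply: fil_0 | rewrite addr0].
    - move=> _ _ [u [t [Su ht ->]]] [u' [t' [Su' ht' ->]]].
      exists (u + u'), (t + t'); split; last exact: addrACA.
        exact: submoduleD.
      exact: fil_D.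
    - move=> b d hb; have [u [t [Su ht ->]]] := gen d.
      exists (b *: u), (b *: t); split; last exact: scalerDr.
        exact: submoduleZ.
      by rewrite -addn1; apply: fil_M.
  by exists (y + u), t; split; [apply: submoduleD | | rewrite addrA].
have [y [z [Sy /fil_nil-> ->]]] := h l; by rewrite addr0.
Qed.

Lemma nakayama0 M : (forall x : M, Fil 1 x) -> zero_module M.
Proof.
move=> h; have S0 (a : B) (u u' : M) : u = 0 -> u' = 0 -> a *: u + u' = 0.
  by move=> -> ->; rewrite scaler0 addr0.
apply: (nakayama (S := Submodule (erefl 0) S0)) => u.
by exists 0, u; split=> //; rewrite add0r.
Qed.

(** * Freeness of projective modules *)

(** Multiplication by arrows is injective on leading terms, jointly for all
    arrows.  This holds for projective modules and fails, for example, for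
    simple modules at the source of an arrow. *)
Definition path_free M := forall s (z : Ar -> M), (s < l)%N ->
  (forall a, e (src a) *: z a = z a) ->
  Fil s.+1 (\sum_a ar a *: z a) -> forall a, Fil s (z a).

Lemma path_free_at M s v (z : Ar -> M) : path_free M -> (s < l)%N ->
  (forall a, e (src a) *: z a = z a) ->
  Fil s.+1 (\sum_(a | tgt a == v) ar a *: z a) ->
  forall a, tgt a = v -> Fil s (z a).
Proof.
move=> fM sl ez h a av.
have := fM s (fun b => if tgt b == v then z b else 0) sl.
move=> /(_ _ _ a); rewrite av eqxx; apply.
  by move=> b; case: ifP => // _; rewrite scaler0.
rewrite [X in Fil _ X](_ : _ = \sum_(a | tgt a == v) ar a *: z a) //.
rewrite [RHS]big_mkcond; apply: eq_bigr => b _.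
by case: ifP => // _; rewrite scaler0.
Qed.

Lemma path_free_ar M s a (x : M) : path_free M -> (s < l)%N ->
  e (src a) *: x = x -> Fil s.+1 (ar a *: x) -> Fil s x.
Proof.
move=> fM sl ex h.
have := fM s (fun b => if b == a then x else 0) sl.
move=> /(_ _ _ a); rewrite eqxx; apply.
  by move=> b; case: eqP => [->|_] //; rewrite scaler0.
rewrite (bigD1 a) //= eqxx big1 ?addr0 // => b /negPf->; exact: scaler0.
Qed.

Lemma path_free_reg : path_free (B^o).
Proof. by move=> s z sl ez h a; exact: (tp_free sl ez h a). Qed.

Lemma path_free_ffun n : path_free {ffun 'I_n -> B^o}.
Proof.
move=> s z sl ez h a.
have /choice[p pE] : forall i, exists p : {linear {ffun 'I_n -> B^o} -> B^o},
    forall x, p x = x i.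
  by move=> i; apply: lin_exists => b x y; rewrite !ffunE.
have /choice[u uE] : forall i, exists u : {linear B^o -> {ffun 'I_n -> B^o}},
    forall x, u x = [ffun j => if j == i then x else 0].
  move=> i; apply: lin_exists => b x y; apply/ffunP=> j; rewrite !ffunE.
  by case: eqP => // _; rewrite scaler0 addr0.
have zi i : Fil s (z a i).
  apply: (@path_free_reg s (fun a => z a i) sl).
    by move=> b; rewrite -[in RHS]ez !ffunE.
  have := fil_lin (p i) h; rewrite linear_sum.
  by under eq_bigr do rewrite linearZ /= pE.
have -> : z a = \sum_i u i (z a i).
  apply/ffunP=> j; rewrite sum_ffunE (bigD1 j) //= big1 ?addr0.
    by rewrite uE ffunE eqxx.
  by move=> i /negPf ij; rewrite uE ffunE eq_sym ij.
by apply: fil_sum => i _; apply: fil_lin.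
Qed.

(** Linear maps respect the filtration, so the property passes to retracts, in
    particular from free modules to projective ones. *)
Lemma path_free_retract M N (f : {linear M -> N}) (g : {linear N -> M}) :
  cancel f g -> path_free N -> path_free M.
Proof.
move=> fK fN s z sl ez h a; rewrite -[z a]fK; apply: fil_lin.
apply: (fN s (fun a => f (z a)) sl).
  by move=> b; rewrite -linearZ_LR ez.
have := fil_lin f h; rewrite linear_sum.
by under eq_bigr do rewrite linearZ.
Qed.

Lemma path_free_projective P : fin_gen P -> projective P -> path_free P.
Proof.
move=> [n [g gP]] pr.
have [f fE] : exists f : {linear {ffun 'I_n -> B^o} -> P},
    forall x, f x = \sum_i x i *: g i.
  apply: lin_exists => a x y; rewrite scaler_sumr -big_split /=.
  by apply: eq_bigr => i _; rewrite !ffunE scalerDl scalerA.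
have fs : surj f.
  move=> x; have [c ->] := gP x; exists [ffun i => c i]; rewrite fE.
  by apply: eq_bigr => i _; rewrite ffunE.
have [h hP] := pr _ _ f idfun fs.
exact: path_free_retract hP (@path_free_ffun n).
Qed.

(** The component of [tp_expand] at one vertex. *)
Lemma expand_at w (b : B) : b * e w = b ->
  exists (c : k) (y : Ar -> B), [/\ b = sc c * e w + \sum_a ar a * y a,
    forall a, y a * e w = y a & forall a, e (src a) * y a = y a].
Proof.
move=> bw; have [c [y by_]] := tp_expand T b.
exists (c w), (fun a => e (src a) * y a * e w); split=> [|a|a].
- rewrite -{1}bw by_ mulrDl !mulr_suml; congr (_ + _).
    rewrite (bigD1 w) //= -mulrA e_idem big1 ?addr0 // => v vw.
    by rewrite -mulrA e_orth // mulr0.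
  by apply: eq_bigr => a _; rewrite -(mulrA (e _)) !mulrA tp_src.
- by rewrite -!mulrA e_idem.
- by rewrite !mulrA e_idem.
Qed.

Lemma sc_inv M (x : M) (c : k) : c != 0 -> sc c^-1 *: (sc c *: x) = x.
Proof. by move=> c0; rewrite scalerA -rmorphM mulVf // rmorph1 scale1r. Qed.

Lemma scZ_comm M (x : M) (c : k) (b : B) : sc c *: (b *: x) = b *: (sc c *: x).
Proof. by rewrite !scalerA tp_scC. Qed.

Lemma fil_sc M (x : M) (c : k) r : c != 0 -> Fil r (sc c *: x) -> Fil r x.
Proof. by move=> c0 /(fil_Z (sc c^-1)); rewrite sc_inv. Qed.

Lemma sum_ar_fil1 M (x : M) (y : Ar -> B) : Fil 1 ((\sum_a ar a * y a) *: x).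
Proof.
rewrite scaler_suml; apply: fil_sum => a _.
by rewrite -scalerA; apply: fil_ar.
Qed.

Lemma e_not_fil1 v : ~ Fil 1 (e v : B^o).
Proof.
rewrite -[e v]mul1r -(rmorph1 sc) => /tp_e_neq0/eqP.
by rewrite oner_eq0.
Qed.

(** Multiplying an element of exact order [r] adds [r] to the order of the
    coefficient.  Induction on [s]: the scalar part of [c] has to vanish, since
    [y] is not of order [r.+1], and the rest is a combination of arrows, which
    freeness removes. *)
Lemma fil_cancel P r s (y : P) (c : B) x : path_free P ->
  Fil r y -> ~ Fil r.+1 y -> e x *: y = y -> (r + s <= l)%N ->
  Fil (r + s) (c *: y) -> Fil s (c * e x : B^o).
Proof.
move=> fP hy ny ey.
suff h (d : B) : d * e x = d -> (r + s <= l)%N -> Fil (r + s) (d *: y) ->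
    Fil s (d : B^o).
  move=> rs hc; apply: h => //; first by rewrite -mulrA e_idem.
  by rewrite -scalerA ey.
elim: s d => [//|s IH] d dx rsl hd.
have [c0 [z [dE zx ze]]] := expand_at dx.
have c00 : c0 = 0.
  apply/eqP/negPn/negP => c0n; apply: ny; apply: (fil_sc c0n).
  have -> : sc c0 *: y = d *: y - (\sum_a ar a * z a) *: y.
    by rewrite -scalerBl dE addrK -scalerA ey.
  apply: fil_B; first by apply: fil_le hd; rewrite addnS ltnS leq_addr.
  rewrite scaler_suml; apply: fil_sum => a _.
  by rewrite -scalerA; apply/fil_ar/fil_Z.
move: dE; rewrite c00 rmorph0 mul0r add0r => dE.
have hz : forall a, Fil (r + s) (z a *: y).
  apply: fP; first by rewrite -addnS.
    by move=> a; rewrite scalerA ze.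
  rewrite -addnS; move: hd; rewrite dE scaler_suml.
  by under eq_bigr do rewrite -scalerA.
rewrite dE; exists z; split=> // a.
by apply: IH => //; apply: leq_trans rsl; rewrite addnS.
Qed.

(** Freeness keeps each further arrow from raising the order by more than one. *)
Lemma path_elt m x w : reach src tgt m x w -> (m < l)%N ->
  exists p : B^o, [/\ e w * p = p, p * e x = p, Fil m p & ~ Fil m.+1 p].
Proof.
elim: m w => [|m IH] w /=.
  move=> /eqP <- _; exists (e x); rewrite !e_idem; split=> //.
  exact: e_not_fil1.
case/existsP=> a /andP[/eqP <- /IH h] ml.
have [p [ep pe hp np]] := h (ltnW ml).
exists (ar a * p); split.
- by rewrite mulrA tp_tgt.
- by rewrite -mulrA pe.
- exact: (fil_ar (M := B^o) a hp).
- by move=> /(path_free_ar path_free_reg ml ep)/np.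
Qed.

(** A nonzero combination of words of length [r] ending at [v] needs at least
    one word that is a path. *)
Lemma has_path_in_of_fil M r v (y : M) : Fil r y -> e v *: y = y -> y != 0 ->
  has_path_in src tgt r v.
Proof.
elim: r v y => [|r IH] v y; first by move=> *; apply/existsP; exists v => /=.
move=> hy ey y0; have [z [hz ez yE]] := fil_split_at ey hy.
have [a /andP[/eqP av za]] : exists a, (tgt a == v) && (z a != 0).
  apply: contrapT => no; case/eqP: y0; rewrite yE big1 // => a av.
  case: (eqVneq (z a) 0) => [->|za]; first exact: scaler0.
  by case: no; exists a; rewrite av.
by rewrite -av -addn1 addnC; apply: has_path_in_cat (reach1 _ _ a); apply: IH (hz a) (ez a) za.
Qed.

(** * Minimal generators and projective covers *)

(** The direct sum of the projective modules [B e (w i)]. *)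
Lemma exists_vproj (I : finType) (X : {set I}) (w : I -> V) :
  exists P (g : I -> P), [/\ fin_gen P, projective P,
    forall i, e (w i) *: g i = g i,
    forall x, exists b : I -> B, x = \sum_(i in X) b i *: g i
    & forall b : I -> B, \sum_(i in X) b i *: g i = 0 ->
        forall i, i \in X -> b i * e (w i) = 0].
Proof.
pose F : lmodType B := {ffun I -> B^o}.
pose S (f : F) := forall i, f i = if i \in X then f i * e (w i) else 0 :> B.
have S0 : S 0 by move=> i; rewrite ffunE; case: ifP => _ //; rewrite mul0r.
have SL b f g : S f -> S g -> S (b *: f + g).
  move=> hf hg i; rewrite !ffunE; move: (hf i) (hg i); case: ifP => _.
    move=> fi gi; rewrite {1}fi {1}gi mulrDl; congr (_ + _).
    exact: mulrA.
  by move=> -> ->; rewrite scaler0 addr0.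
have [P [u [ui uP]]] := exists_sub (Submodule S0 SL).
pose d i : F := [ffun j => if (j == i) && (i \in X) then e (w i) else 0].
have /choice[g gE] : forall i, exists y, u y = d i.
  move=> i; apply/uP => j; rewrite ffunE.
  case: (eqVneq j i) => [->|_] /=; last by case: ifP => _ //; rewrite mul0r.
  by case: ifP => // _; rewrite e_idem.
have sumE (b : I -> B) i : i \in X ->
    u (\sum_(j in X) b j *: g j) i = b i * e (w i) :> B.
  move=> iX; rewrite linear_sum sum_ffunE (bigD1 i) //= big1 ?addr0.
    by rewrite linearZ ffunE gE ffunE eqxx iX.
  by move=> j /andP[_ /negPf ji]; rewrite linearZ ffunE gE ffunE eq_sym ji scaler0.
have ge i : e (w i) *: g i = g i.
  apply: ui; rewrite linearZ gE; apply/ffunP=> j; rewrite !ffunE.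
  by case: ifP => _; [apply: e_idem | apply: scaler0].
have gen x : exists b : I -> B, x = \sum_(i in X) b i *: g i.
  have Sx : S (u x) by apply/uP; exists x.
  exists (u x); apply: ui; apply/ffunP=> i; case iX: (i \in X).
    by rewrite sumE // {1}Sx iX.
  rewrite Sx iX linear_sum sum_ffunE big1 // => j jX.
  by rewrite linearZ ffunE gE ffunE; case: eqP => [ij|_];
    rewrite ?scaler0 //; move: iX; rewrite ij jX.
have rel (b : I -> B) : \sum_(i in X) b i *: g i = 0 ->
    forall i, i \in X -> b i * e (w i) = 0.
  by move=> h i iX; rewrite -sumE // h linear0 ffunE.
exists P, g; split=> //; first exact: fin_gen_family gen.
move=> M N q f qs; have /choice[t tP] : forall i, exists y, q y = f (g i).
  by move=> i; apply: qs.
have [|h hE] := lin_of_gens (n := fun i => e (w i) *: t i) gen.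
  move=> b /rel h; rewrite big1 // => i iX.
  by rewrite scalerA h // scale0r.
exists h => x; have [b ->] := gen x; rewrite hE !linear_sum.
by apply: eq_bigr => i _; rewrite !linearZ /= tP -linearZ_LR ge.
Qed.

Definition gen_submodule (I : finType) M (X : {set I}) (g : I -> M) : submodule M.
Proof.
exists (fun x => exists b : I -> B, x = \sum_(i in X) b i *: g i).
  by exists (fun _ => 0); rewrite big1 // => i _; rewrite scale0r.
move=> a _ _ [b ->] [c ->]; exists (fun i => a * b i + c i).
rewrite scaler_sumr -big_split; apply: eq_bigr => i _ /=.
by rewrite scalerDl scalerA.
Defined.

Lemma vertex_generators M : fin_gen M ->
  exists (I : finType) (g : I -> M) (w : I -> V),
    (forall i, e (w i) *: g i = g i) /\
    forall x, exists b : I -> B, x = \sum_(i in setT) b i *: g i.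
Proof.
move=> [n [g gP]]; exists ('I_n * V)%type, (fun i => e i.2 *: g i.1), snd.
split=> [i|x]; first exact: eZ_idem.
have [c ->] := gP x; exists (fun i => c i.1).
rewrite [RHS](eq_bigl xpredT) => [|i]; last by rewrite inE.
rewrite -(pair_bigA _ (fun i v => c i *: (e v *: g i))) /=.
by apply: eq_bigr => i _; rewrite -scaler_sumr sum_e.
Qed.

(** In a generating family of least size no coefficient of a relation is
    invertible modulo the radical: otherwise that generator lies in the span of
    the others plus the radical, hence in the span of the others by Nakayama. *)
Lemma minimal_generators M : fin_gen M ->
  exists (I : finType) (X : {set I}) (g : I -> M) (w : I -> V),
    [/\ forall i, e (w i) *: g i = g i,
        forall x, exists b : I -> B, x = \sum_(i in X) b i *: g i
      & forall b : I -> B, Fil 1 (\sum_(i in X) b i *: g i) ->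
          forall i, i \in X -> Fil 1 (b i * e (w i) : B^o)].
Proof.
move=> /vertex_generators[I [g [w [ge gen]]]].
pose gens (X : {set I}) := forall x, gen_submodule X g x.
have exX : exists n, `[< exists X : {set I}, #|X| = n /\ gens X >].
  by exists #|[set: I]|; apply/asboolP; exists setT.
case: (ex_minnP exX) => n /asboolP[X [Xn genX]] minX.
exists I, X, g, w; split=> // b hb i iX; apply: contrapT => nb.
suff : gens (X :\ i).
  move=> h; have /minX : `[< exists U : {set I}, #|U| = #|X :\ i| /\ gens U >].
    by apply/asboolP; exists (X :\ i).
  by rewrite -Xn (cardsD1 i X) iX add1n ltnn.
have be : b i * e (w i) * e (w i) = b i * e (w i) by rewrite -mulrA e_idem.
have [c [y [bE _ _]]] := expand_at be.
have c0 : c != 0.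
  apply/negP => /eqP c0; apply: nb; rewrite bE c0 rmorph0 mul0r add0r.
  by exists y; split.
apply: nakayama => x; have [d ->] := genX x.
pose S := gen_submodule (X :\ i) g.
have [s [t [Ss ht gi]]] : exists s t : M, [/\ S s, Fil 1 t & g i = s + t].
  pose s := \sum_(j in X :\ i) b j *: g j.
  (* solve the relation for g i *)
  exists (sc c^-1 *: - s), (sc c^-1 *: (\sum_(j in X) b j *: g j
      - (\sum_a ar a * y a) *: g i)); split.
  - by apply: submoduleZ; apply: submoduleN; exists b.
  - by apply: fil_Z; apply: fil_B => //; apply: sum_ar_fil1.
  rewrite -scalerDr -[LHS](sc_inv (g i) c0); congr (_ *: _).
  rewrite (big_setD1 i) //= -/s addrA [- s + _]addrC addrK.
  have -> : b i *: g i = sc c *: g i + (\sum_a ar a * y a) *: g i.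
    by rewrite -{1}ge scalerA bE scalerDl -scalerA ge.
  by rewrite addrK.
exists (\sum_(j in X :\ i) d j *: g j + d i *: s), (d i *: t); split.
- by apply: submoduleD; [exists d | apply: submoduleZ].
- exact: fil_Z ht.
by rewrite -addrA -scalerDr -gi (big_setD1 i) //= addrC.
Qed.

(** For projective covers, superfluous kernels are the ones inside the radical.
    If a kernel element had an invertible coefficient at a minimal generator
    [g i], then the other generators and the radical would already span, with
    the kernel, all of [P], hence all of [P] by superfluity; this contradicts
    minimality. *)
Lemma projective_cover_ker P M (p : {linear P -> M}) x :
  projective_cover p -> p x = 0 -> Fil 1 x.
Proof.
move=> [fg _ _ sup] px0.
have [I [X [g [w [ge gen ind]]]]] := minimal_generators fg.
have [b xE] := gen x; rewrite xE; apply: fil_sum => i iX.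
rewrite -ge scalerA -[1%N]addn0; apply: fil_M => //.
apply: contrapT => nb.
have be : b i * e (w i) * e (w i) = b i * e (w i) by rewrite -mulrA e_idem.
have [c [y [bE _ _]]] := expand_at be.
have c0 : c != 0.
  apply/negP => /eqP c0; apply: nb; rewrite bE c0 rmorph0 mul0r add0r.
  by exists y; split.
pose S0 := gen_submodule (X :\ i) g.
have SL (a : B) (u u' : P) : (exists s t : P, [/\ S0 s, Fil 1 t & u = s + t]) ->
    (exists s t : P, [/\ S0 s, Fil 1 t & u' = s + t]) ->
    exists s t : P, [/\ S0 s, Fil 1 t & a *: u + u' = s + t].
  move=> [s [t [Ss ht ->]]] [s' [t' [Ss' ht' ->]]].
  exists (a *: s + s'), (a *: t + t'); split.
  - exact: submoduleL.
  - by apply: fil_D => //; apply: fil_Z.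
  - by rewrite scalerDr addrACA.
have S00 : exists s t : P, [/\ S0 s, Fil 1 t & 0 = s + t :> P].
  exists 0, 0; split; [exact: submodule0 | exact: fil_0 | by rewrite addr0].
pose S := Submodule S00 SL.
(* S, the span of the other generators and the radical, is all of P *)
have /asboolP[s [t [[d sE] ht gi]]] : g i \in submodule_pred S.
  apply: sup; first exact: submodule_pred_closed.
  move=> u; have [d ->] := gen u.
  pose s := \sum_(j in X :\ i) b j *: g j.
  exists (\sum_(j in X :\ i) d j *: g j
     + d i *: (sc c^-1 *: (- s - (\sum_a ar a * y a) *: g i))).
  exists (d i *: (sc c^-1 *: x)); split.
  - apply/asboolP; apply: (submoduleD (S := S)).
      exists (\sum_(j in X :\ i) d j *: g j), 0.
      by split; [exists d | apply: fil_0 | rewrite addr0].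
    apply: submoduleZ; apply: submoduleZ; exists (- s).
    exists (- ((\sum_a ar a * y a) *: g i)); split=> //.
      by apply: submoduleN; exists b.
    by apply: fil_N; apply: sum_ar_fil1.
  - by rewrite /= !linearZ /= px0 !scaler0.
  rewrite -addrA -scalerDr -scalerDr (big_setD1 i) //= addrC.
  congr (_ + _ *: _); rewrite -[LHS](sc_inv (g i) c0); congr (_ *: _).
  rewrite xE (big_setD1 i) //= -/s.
  have -> : b i *: g i = sc c *: g i + (\sum_a ar a * y a) *: g i.
    by rewrite -{1}ge scalerA bE scalerDl -scalerA ge.
  by rewrite -opprD [s + _]addrC -addrA [RHS]addrC addrK.
apply: (@e_not_fil1 (w i)).
have := ind (fun j => if j == i then 1 else - d j) _ i iX.
rewrite eqxx mul1r; apply; rewrite (big_setD1 i) //= eqxx scale1r.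
rewrite [X in _ + X](_ : _ = - s).
  by rewrite gi addrC addrA addNr add0r.
rewrite sE -sumrN; apply: eq_bigr => j; rewrite !inE => /andP[/negPf-> _].
by rewrite scaleNr.
Qed.

Lemma projective_coverI P M (p : {linear P -> M}) :
  fin_gen P -> projective P -> surj p -> (forall x, p x = 0 -> Fil 1 x) ->
  projective_cover p.
Proof.
move=> fg pr ps ker; split=> // S Sc gen x.
apply: (nakayama (S := submodule_of_pred Sc)) => {}x.
by have [y [z [yS /ker hz ->]]] := gen x; exists y, z.
Qed.

Lemma exists_projective_cover M : fin_gen M ->
  exists P (p : {linear P -> M}), projective_cover p.
Proof.
move=> /minimal_generators[I [X [g [w [ge gen ind]]]]].
have [P [u [fg pr ue genP relP]]] := exists_vproj X w.
have [|p pE] := lin_of_gens (n := g) genP.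
  move=> b /relP h; rewrite big1 // => i iX.
  by rewrite -ge scalerA h // scale0r.
exists P, p; apply: projective_coverI => // [y|x].
  by have [b ->] := gen y; exists (\sum_(i in X) b i *: u i); rewrite pE.
have [b ->] := genP x; rewrite pE => e0; apply: fil_sum => i iX.
rewrite -ue scalerA -[1%N]addn0; apply: fil_M => //.
by apply: ind => //; rewrite e0; apply: fil_0.
Qed.


(** * Finite generation of submodules *)

(** The span over the field.  The list is consumed one vector at a time, which
    makes the elimination in [kspan_subspace] a plain induction. *)
Fixpoint kspan M (s : seq M) (x : M) : Prop :=
  if s is y :: s' then exists c : k, kspan s' (x - sc c *: y) else x = 0.

Section Span.
Variable M : rmodType A.
Implicit Types (x y : M) (us ts : seq M).

Lemma kspan0 us : kspan us 0.
Proof.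
by elim: us => //= y us IH; exists 0; rewrite rmorph0 scale0r subr0.
Qed.

Lemma kspanL us (c : k) x y : kspan us x -> kspan us y -> kspan us (sc c *: x + y).
Proof.
elim: us x y => [x y -> ->|z us IH x y [a xa] [b yb]]; first by rewrite scaler0 addr0.
exists (c * a + b); rewrite rmorphD rmorphM scalerDl -scalerA.
by rewrite opprD addrACA -scalerBr; apply: IH.
Qed.

Lemma kspanD us x y : kspan us x -> kspan us y -> kspan us (x + y).
Proof. by move=> sx sy; rewrite -[x]scale1r -(rmorph1 sc); apply: kspanL. Qed.

Lemma kspanZ us (c : k) x : kspan us x -> kspan us (sc c *: x).
Proof. by move=> sx; rewrite -[_ *: _]addr0; apply: kspanL => //; apply: kspan0. Qed.

Lemma kspan_sum us (I : Type) (r : seq I) (F : I -> M) :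
  (forall i, kspan us (F i)) -> kspan us (\sum_(i <- r) F i).
Proof. by move=> h; apply: big_ind => //; [apply: kspan0 | apply: kspanD]. Qed.

Lemma kspan_mem us y : y \in us -> kspan us y.
Proof.
elim: us => //= z us IH; rewrite inE => /orP[/eqP->|/IH ys].
  by exists 1; rewrite rmorph1 scale1r subrr; apply: kspan0.
by exists 0; rewrite rmorph0 scale0r subr0.
Qed.

Lemma kspan_nth us x : kspan us x ->
  exists c : nat -> B, x = \sum_(i < size us) c i *: us`_i.
Proof.
elim: us x => [x ->|y us IH x [a /IH[c xE]]]; first by exists (fun _ => 0); rewrite big_ord0.
exists (fun i => if i is i.+1 then c i else sc a).
by rewrite big_ord_recl /= -xE addrC subrK.
Qed.

(** Gaussian elimination: either some vector of the subspace involves the first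
    spanning vector, and it serves as a pivot, or none does. *)
Lemma kspan_subspace us (S : M -> Prop) :
  (forall x y, S x -> S y -> S (x - y)) ->
  (forall (c : k) x, S x -> S (sc c *: x)) -> (forall x, S x -> kspan us x) ->
  exists ts, (forall y, y \in ts -> S y) /\ forall x, S x -> kspan ts x.
Proof.
elim: us S => [|y us IH] S SB SZ Ss; first by exists [::].
have [||x [] //|ts [tS tP]] := IH (fun x => S x /\ kspan us x).
- move=> x z [Sx sx] [Sz sz]; split; first exact: SB.
  apply: kspanD => //; rewrite -scaleN1r -(rmorph1 sc) -rmorphN; exact: kspanZ.
- by move=> c x [Sx sx]; split; [apply: SZ | apply: kspanZ].
have [[z [c [Sz c0 sz]]]|no] :=
    EM (exists z (c : k), [/\ S z, c != 0 & kspan us (z - sc c *: y)]).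
  (* z is the pivot, and ts spans the vectors of S that do not involve y *)
  exists (z :: ts); split=> [x|x Sx].
    by rewrite inE => /orP[/eqP->|/tS[]].
  have [a xa] := Ss x Sx; exists (a / c); apply: tP; split.
    by apply: SB => //; apply: SZ.
  have -> : x - sc (a / c) *: z =
      sc (- (a / c)) *: (z - sc c *: y) + (x - sc a *: y).
    have -> : sc a *: y = sc (a / c) *: (sc c *: y).
      by rewrite scalerA -rmorphM -mulrA mulVf // mulr1.
    by rewrite rmorphN scaleNr scalerBr opprB [RHS]addrC addrA subrK.
  exact: kspanL.
exists ts; split=> [x /tS[]//|x Sx].
have [a xa] := Ss x Sx; case: (eqVneq a 0) => [a0|a0].
  by apply: tP; split=> //; move: xa; rewrite a0 rmorph0 scale0r subr0.
by case: no; exists x, a.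
Qed.

End Span.

Lemma kspan_image M N (f : M -> N) (s : seq M) (t : seq N) x :
  (forall (c : k) x y, f (sc c *: x + y) = sc c *: f x + f y) ->
  (forall y, y \in s -> kspan t (f y)) -> kspan s x -> kspan t (f x).
Proof.
move=> fL; elim: s x => [x _ ->|y s IH x st [c xc]].
  have := fL 0 0 0; rewrite rmorph0 !scale0r !add0r => _.
  have := fL (-1) 0 0; rewrite rmorphN rmorph1 scaler0 add0r scaleN1r addNr => ->.
  exact: kspan0.
rewrite -[x](subrK (sc c *: y)) addrC fL; apply: kspanL.
  by apply: st; rewrite mem_head.
by apply: IH => // z zs; apply: st; rewrite inE zs orbT.
Qed.

Lemma kspan_reg r : exists s : seq B^o, forall b : B^o,
  exists b' : B^o, kspan s (b - b') /\ Fil r b'.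
Proof.
elim: r => [|r [s sP]]; first by exists [::] => b; exists b; rewrite subrr.
pose t : seq B^o := [seq e v | v <- enum V] ++
  flatten [seq [seq ar a * x | x <- s] | a <- enum Ar].
exists t => b; have [c [y bE]] := tp_expand T b.
have /choice[y' y'P] : forall a, exists b' : B^o, kspan s ((y a : B^o) - b') /\ Fil r b'.
  by move=> a; apply: sP.
exists (\sum_a ar a *: y' a); split; last first.
  by exists y'; split=> // a; have [] := y'P a.
rewrite bE -addrA; apply: kspanD.
  apply: kspan_sum => v; apply: kspanZ; apply: kspan_mem.
  by rewrite mem_cat map_f // mem_enum.
rewrite -sumrB; apply: kspan_sum => a.
have -> : ar a * y a - ar a *: y' a = ar a *: ((y a : B^o) - y' a).
  by rewrite scalerBr.
apply: kspan_image (y'P a).1.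
  by move=> d x z; rewrite scalerDr scZ_comm.
move=> x xs; apply: kspan_mem; rewrite mem_cat; apply/orP; right.
by apply/flatten_mapP; exists a; rewrite ?mem_enum //; apply: map_f.
Qed.

Lemma kspan_fin_gen M : fin_gen M -> exists s : seq M, forall x, kspan s x.
Proof.
move=> [n [g gP]]; have [s sP] := kspan_reg l.
exists (flatten [seq [seq b *: g i | b <- s] | i <- enum 'I_n]) => x.
have [c ->] := gP x; apply: kspan_sum => i.
have [b' [h /fil_nil b'0]] := sP (c i); move: h; rewrite b'0 subr0.
apply: (kspan_image (f := fun b : B^o => b *: g i)).
  by move=> d y z; rewrite scalerDl -scalerA.
move=> b bs; apply: kspan_mem; apply/flatten_mapP; exists i; rewrite ?mem_enum //.
exact: map_f.
Qed.

(** Finitely generated modules are finite-dimensional, hence Noetherian. *)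
Lemma fin_gen_sub M K (i : {linear K -> M}) : injective i -> fin_gen M -> fin_gen K.
Proof.
move=> ii /kspan_fin_gen[s sP].
have [|||t [tS tP]] := @kspan_subspace M s (im_submodule i).
- exact: submoduleB.
- by move=> c x; apply: submoduleZ.
- by move=> x _; apply: sP.
have /choice[u uP] : forall j, exists u, (j < size t)%N -> i u = t`_j.
  move=> j; case: (ltnP j (size t)) => jt; last by exists 0.
  by have [u <-] := tS _ (mem_nth 0 jt); exists u.
exists (size t), (fun j => u j) => x.
have [|c xE] := kspan_nth (tP (i x) _); first by exists x.
exists (fun j => c j); apply: ii; rewrite xE linear_sum.
by apply: eq_bigr => j _; rewrite linearZ /= uP.
Qed.

Lemma is_syzygy_fin_gen M K : is_syzygy M K -> fin_gen K.
Proof. by move=> [P [p [i [[fg _ _ _] ii _]]]]; apply: fin_gen_sub ii fg. Qed.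

Lemma nth_syzygy_fin_gen M K n : fin_gen M -> nth_syzygy M n K -> fin_gen K.
Proof. by move=> fg; case=> // m L X _; apply: is_syzygy_fin_gen. Qed.

Lemma exists_syzygy M : fin_gen M -> exists K, is_syzygy M K.
Proof.
move=> fg; have [P [p cov]] := exists_projective_cover fg.
have [K [i [ii iP]]] := exists_sub (ker_submodule p).
by exists K, P, p, i; split.
Qed.

Lemma exists_nth_syzygy M n : fin_gen M -> exists K, nth_syzygy M n K.
Proof.
move=> fg; elim: n => [|n [L hL]]; first by exists M; apply: nth_syzygy0.
have [K hK] := exists_syzygy (nth_syzygy_fin_gen fg hL).
by exists K; apply: nth_syzygyS hL hK.
Qed.

Lemma fil_pair M N r (x : M) (y : N) :
  Fil r x -> Fil r y -> Fil r ((x, y) : (M * N)%type).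
Proof.
elim: r x y => // r IH _ _ [z [zP ->]] [t [tP ->]].
exists (fun a => (z a, t a)); split=> [a|]; first exact: IH (zP a) (tP a).
by rewrite [RHS]surjective_pairing (raddf_sum fst) (raddf_sum snd).
Qed.

Lemma is_syzygy_prod M M' K K' :
  is_syzygy M K -> is_syzygy M' K' -> is_syzygy (M * M')%type (K * K')%type.
Proof.
move=> [P [p [i [cov ii ip]]]] [P' [p' [i' [cov' ii' ip']]]].
have [q qE] := lin_prod p p'; have [j jE] := lin_prod i i'.
have [fg pr ps _] := cov; have [fg' pr' ps' _] := cov'.
exists (P * P')%type, q, j; split.
- apply: (projective_coverI).
  + exact: fin_gen_prod.
  + exact: projective_prod.
  + by move=> [b c]; have [x <-] := ps b; have [y <-] := ps' c; exists (x, y); rewrite qE.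
  + move=> [x y]; rewrite qE => -[/(projective_cover_ker cov) hx].
    by move=> /(projective_cover_ker cov') hy; apply: fil_pair.
- by move=> [x y] [z t]; rewrite !jE => -[/ii -> /ii' ->].
move=> [x y]; rewrite qE; split=> [[/ip[a <-] /ip'[b <-]]|[[a b]]].
  by exists (a, b); rewrite jE.
rewrite jE => -[<- <-]; congr pair; first by apply/ip; exists a.
by apply/ip'; exists b.
Qed.

Lemma nth_syzygy_prod M M' K K' n :
  nth_syzygy M n K -> nth_syzygy M' n K' ->
  nth_syzygy (M * M')%type n (K * K')%type.
Proof.
elim: n K K' => [|n IH] K K' h h'.
  by rewrite (nth_syzygy0P h) (nth_syzygy0P h'); apply: nth_syzygy0.
have [X [hX sX]] := nth_syzygySP h; have [X' [hX' sX']] := nth_syzygySP h'.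
exact: nth_syzygyS (IH _ _ hX hX') (is_syzygy_prod sX sX').
Qed.


(** * Paths traced by syzygies *)

Lemma projective_cover_fil1 P M (p : {linear P -> M}) z :
  projective_cover p -> Fil 1 (p z) -> Fil 1 z.
Proof.
move=> cov; have [_ _ ps _] := cov => /(fil_surj ps)[t [ht e0]].
rewrite -[z](subrK t); apply: fil_D => //; apply: (projective_cover_ker cov).
by rewrite linearB e0 subrr.
Qed.

Lemma projective_cover_free P M (p : {linear P -> M}) :
  projective_cover p -> path_free P.
Proof. by move=> [fg pr _ _]; apply: path_free_projective. Qed.

(** The leading term of [y] is a combination of paths of length [r] whose
    coefficients are not all in the radical.  Freeness of [P'] applied along
    such a path shows that the image of its coefficient has lost at most [r]
    degrees.  It is used with [f y = 0], that is [s = l], where the image of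
    the coefficient is nonzero and of order at least [l - r]. *)
Lemma path_free_descend P P' (f : {linear P -> P'}) r s v y :
  path_free P -> path_free P' -> Fil r y -> ~ Fil r.+1 y -> e v *: y = y ->
  (r <= s <= l)%N -> (r < l)%N -> Fil s (f y) ->
  exists v' z, [/\ reach src tgt r v' v, e v' *: z = z, ~ Fil 1 z
                 & Fil (s - r) (f z)].
Proof.
move=> fP fP'; elim: r s v y => [|r IH] s v y hy ny ey /andP[rs sl] rl hf.
  by exists v, y; split; rewrite /= ?eqxx // subn0.
have [z [hz ez yE]] := fil_split_at ey hy.
have [a [/eqP av na]] : exists a, tgt a == v /\ ~ Fil r.+1 (z a).
  apply: contrapT => no; apply: ny; rewrite yE; apply: fil_sum => a av.
  by apply: fil_ar; apply: contrapT => h; apply: no; exists a.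
case: s rs sl hf => // s rs sl hf.
have hfz : Fil s (f (z a)).
  apply: (path_free_at (v := v) (z := fun a => f (z a)) fP') => //.
    by move=> b; rewrite -linearZ_LR ez.
  move: hf; rewrite yE linear_sum.
  by under eq_bigr do rewrite linearZ.
have [|v' [t [h1 h2 h3 h4]]] := IH s (src a) (z a) (hz a) na (ez a) _ (ltnW rl) hfz.
  by rewrite -ltnS rs ltnW.
exists v', t; split=> //=; apply/existsP; exists a.
by rewrite av eqxx.
Qed.

(** One application of [path_free_descend] for each syzygy.  The order [r] of
    [y] is at least [j], and the element found one syzygy below has order at
    least [l - r]; the lengths of the paths found add up to an alternating sum. *)
Lemma has_path_in_of_syzygy N n L P (p : {linear P -> L}) v y j :
  nth_syzygy N n L -> projective_cover p -> p y = 0 -> y != 0 ->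
  e v *: y = y -> Fil j y -> has_path_in src tgt (alt l n.+1 j) v.
Proof.
elim: n L P p v y j => [|n IH] L P p v y j hL cov py y0 ey hj.
  by rewrite /= addn0; apply: has_path_in_of_fil hj ey y0.
have [r [jr rl hr nr]] := exact_order y0 hj.
have [L2 [hL2 [P' [p' [i [cov' ii ip]]]]]] := nth_syzygySP hL.
have [||v' [z [vz ez nz hz]]] := path_free_descend (f := i \o p) (s := l)
    (projective_cover_free cov) (projective_cover_free cov') hr nr ey _ rl.
- by rewrite (ltnW rl) leqnn.
- by rewrite /= py linear0; apply: fil_0.
have pz0 : i (p z) != 0.
  apply/eqP => h; apply: nz; apply: (projective_cover_ker cov).
  by apply: ii; rewrite h linear0.
have p'0 : p' (i (p z)) = 0 by apply/ip; exists (p z).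
have ep : e v' *: i (p z) = i (p z) by rewrite -!linearZ_LR ez.
have := IH _ _ _ _ _ _ hL2 cov' p'0 pz0 ep hz.
move=> /has_path_in_cat/(_ vz); apply: has_path_in_le.
by apply: (alt_leq_r n.+2 (j := j) (j' := r)); rewrite jr ltnW.
Qed.

(** A member of a minimal generating system that generates a path module of
    length [m] at [v]. *)
Definition path_generator M (y : M) v m :=
  [/\ e v *: y = y, ~ Fil 1 y & forall c : B, c *: y = 0 <-> Fil m (c * e v : B^o)].

(** A syzygy lies in the radical of its cover, so it is killed one step before
    the cover. *)
Lemma syzygy_fil_nil M K (x : K) : is_syzygy M K -> Fil l.-1 x -> x = 0.
Proof.
move=> [P [p [i [cov ii ip]]]] hx; apply: ii; rewrite linear0.
move: x hx; apply: (fil_ind (S := fun x => i x = 0)).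
- exact: linear0.
- by move=> x y hx hy; rewrite linearD /= hx hy addr0.
move=> b x hb; rewrite linearZ /=; apply: (fil_ge_nil (r := (l.-1 + 1)%N)).
  by rewrite addn1 prednK // ltnW.
apply: fil_M => //.
by apply: (projective_cover_ker cov); apply/ip; exists x.
Qed.

(** If [t] lifts the generator [y] and [b] is a path of length [m], then [b t]
    lies in the syzygy and generates a path module of length l - m.  It is not
    in the radical of the syzygy: freeness would let the last arrow of [b] be
    cancelled, and a multiple of [y] by a path of length m - 1 would vanish. *)
Lemma path_generator_syzygy M K P (p : {linear P -> M}) (i : {linear K -> P}) (y : M) v m v' :
  projective_cover p -> injective i ->
  (forall x, p x = 0 <-> exists y, i y = x) ->
  (forall x : M, Fil l.-1 x -> x = 0) ->
  path_generator y v m -> (0 < m < l)%N -> reach src tgt m v v' ->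
  exists y' : K, path_generator y' v' (l - m).
Proof.
move=> cov ii ip nilM [ey ny ty]; case: m ty => // m ty /andP[_ ml].
case/existsP=> a /andP[/eqP <- /path_elt h].
have [q [eq qe hq nq]] := h (ltnW ml).
have fB := path_free_reg.
have fP := projective_cover_free cov.
have [_ _ ps _] := cov; have [t0 pt0] := ps y.
pose t := e v *: t0.
have et : e v *: t = t by apply: eZ_idem.
have pt : p t = y by rewrite /t linearZ /= pt0.
have nt : ~ Fil 1 t by move=> ht; apply: ny; rewrite -pt; apply: fil_lin.
pose b : B^o := ar a * q.
have bE : b * e v = b by rewrite /b -mulrA qe.
have eb : e (tgt a) * b = b by rewrite /b mulrA tp_tgt.
have hb : Fil m.+1 b by apply: (fil_ar (M := B^o) a hq).
have nb : ~ Fil m.+2 b by move=> /(path_free_ar fB ml eq)/nq.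
have /ip[y' iy'] : p (b *: t) = 0.
  by rewrite linearZ /= pt; apply/ty; rewrite bE.
exists y'; split.
- by apply: ii; rewrite linearZ /= iy' scalerA eb.
- move=> /fil_split[z [_ ez y'E]].
  have l1 : (l.-1 < l)%N by rewrite prednK // ltnW.
  have := fP l.-1 (fun c => (if c == a then q *: t else 0) - i (z c)) l1.
  move=> /(_ _ _ a); rewrite eqxx.
  (* b t = a q t is also the sum of the c z_c: compare the two at the arrow a *)
  have hE : \sum_c ar c *: ((if c == a then q *: t else 0) - i (z c)) = 0.
    under eq_bigr do rewrite scalerBr.
    rewrite sumrB (bigD1 a) //= eqxx big1 ?addr0; last first.
      by move=> c /negPf->; rewrite scaler0.
    rewrite scalerA -/b -iy' y'E linear_sum -sumrB big1 // => c _.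
    by rewrite linearZ subrr.
  move=> hz; have {hz} : Fil l.-1 (q *: t - i (z a)).
    apply: hz; last by rewrite hE; apply: fil_0.
    move=> c; rewrite scalerBr -[e _ *: i _]linearZ_LR ez; congr (_ - _).
    by case: eqP => [->|_]; rewrite ?scaler0 // scalerA eq.
  move=> /(fil_lin p)/nilM; rewrite linearB linearZ /= pt.
  have -> : p (i (z a)) = 0 by apply/ip; exists (z a).
  by rewrite subr0 => /ty; rewrite qe.
move=> c; have -> : c *: y' = 0 <-> (c * b) *: t = 0.
  rewrite -scalerA -iy' -linearZ_LR; split=> [->|h']; first exact: linear0.
  by apply: ii; rewrite h' linear0.
have lE : (m.+1 + (l - m.+1) = l)%N by rewrite subnKC // ltnW.
split=> [h0|hc].
  have hl : Fil (0 + l) ((c * b) *: t) by rewrite h0; apply: fil_0.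
  have hcb : Fil (m.+1 + (l - m.+1)) (c * b : B^o).
    by have := fil_cancel (r := 0) fP I nt et (leqnn _) hl; rewrite -mulrA bE lE.
  by apply: (fil_cancel fB hb nb eb _ hcb); rewrite lE.
apply: (fil_ge_nil (r := (l - m.+1 + m.+1)%N)); first by rewrite addnC lE.
rewrite -eb mulrA -scalerA; apply: fil_M => //.
exact: fil_Zl.
Qed.

(** Along a path of length [alt l n.+1 m] leaving [v], [path_generator_syzygy]
    would produce a path generator in the projective module [K], together with
    a path that kills it; this is impossible in a free module. *)
Lemma path_generator_no_path_out N L K n (y : L) v m :
  is_syzygy N L -> nth_syzygy L n K -> fin_gen K -> projective K ->
  path_generator y v m -> (0 < m < l)%N -> ~~ has_path_out src tgt (alt l n.+1 m) v.
Proof.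
elim: n N L y v m => [|n IH] N L y v m sL hK fg pr ty ml; apply/negP.
  have KL := nth_syzygy0P hK; subst L; rewrite /= addn0 => /existsP[w /path_elt h].
  have [q [eq qe hq nq]] := h (proj2 (andP ml)); apply: nq.
  have [ey ny hy] := ty; have fK : path_free K := path_free_projective fg pr.
  have hl : Fil (0 + m.+1) (q *: y).
    have -> : q *: y = 0 by apply/hy; rewrite qe.
    exact: fil_0.
  have := fil_cancel (r := 0) fK I ny ey _ hl.
  by rewrite qe; apply; case/andP: ml.
have [L' [sL' hL']] := nth_syzygy_frontP hK.
move=> /existsP[w]; rewrite [alt _ _ _]/= -/(alt l n.+1 (l - m)) addnC.
move=> /reach_split[v' vv' v'w].
have [P [p [i [cov ii ip]]]] := sL'.
have nilL (x : L) : Fil l.-1 x -> x = 0 by apply: syzygy_fil_nil sL.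
have [y' ty'] := path_generator_syzygy cov ii ip nilL ty ml vv'.
have ml' : (0 < l - m < l)%N by lia.
by case/negP: (IH _ _ _ _ _ sL' hL' fg pr ty' ml'); apply/existsP; exists w.
Qed.


(** * The trace of a finite projective dimension *)

(** Going down a minimal resolution.  The state is a generator [y] of the
    current syzygy, its vertex, and the length [rho] of a path leaving
    that vertex, which the descent prolongs backwards.  The lower bounds on [rho] and
    on [rho] plus the order of [y] reproduce themselves, because two
    consecutive orders add up to at least [l]. *)
Lemma syzygy_descent N n L1 L P (p : {linear P -> L1}) (i : {linear L -> P})
    (y : L) v j rho q :
  nth_syzygy N n L1 -> projective_cover p -> injective i ->
  (forall x, p x = 0 <-> exists y, i y = x) ->
  ~ Fil 1 y -> e v *: y = y -> Fil j (i y) -> (0 < j)%N ->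
  has_path_out src tgt rho v -> (alt l q 1 <= rho)%N -> (alt l q.+1 1 <= rho + j)%N ->
  exists K1 P0 (p0 : {linear P0 -> N}) (i0 : {linear K1 -> P0}) (y0 : K1) v0 rho0 r0,
    [/\ [/\ projective_cover p0, injective i0
          & forall x, p0 x = 0 <-> exists y, i0 y = x],
        [/\ ~ Fil 1 y0, e v0 *: y0 = y0, Fil r0 (i0 y0) & ~ Fil r0.+1 (i0 y0)],
        (0 < r0 < l)%N, has_path_out src tgt rho0 v0
      & (alt l (q + n) 1 <= rho0)%N /\ (alt l (q + n).+1 1 <= rho0 + r0)%N].
Proof.
elim: n L1 L P p i y v j rho q => [|n IH] L1 L P p i y v j rho q hL cov ii ip
    ny ey hj j0 hrho q1 q2.
  have iy0 : i y != 0.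
    by apply/eqP => h; apply: ny; rewrite (lin_eq0 ii h); apply: fil_0.
  have [r [jr rl hr nr]] := exact_order iy0 hj.
  have L1N := nth_syzygy0P hL; subst; exists L, P, p, i, y, v, rho, r; split=> //.
  - by rewrite rl (leq_trans j0 jr).
  - by rewrite addn0; split=> //; apply: leq_trans q2 _; rewrite leq_add2l.
have iy0 : i y != 0.
  by apply/eqP => h; apply: ny; rewrite (lin_eq0 ii h); apply: fil_0.
have [r [jr rl hr nr]] := exact_order iy0 hj.
have ei : e v *: i y = i y by rewrite -linearZ_LR ey.
have piy : p (i y) = 0 by apply/ip; exists y.
have [L2 [hL2 [P' [p' [i' [cov' ii' ip']]]]]] := nth_syzygySP hL.
have [||v' [z [vz ez nz hz]]] := path_free_descend (f := i' \o p) (s := l)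
    (projective_cover_free cov) (projective_cover_free cov') hr nr ei _ rl.
- by rewrite (ltnW rl) leqnn.
- by rewrite /= piy linear0; apply: fil_0.
have npz : ~ Fil 1 (p z) by move/(projective_cover_fil1 cov).
have epz : e v' *: p z = p z by rewrite -linearZ_LR ez.
have lr0 : (0 < l - r)%N by rewrite subn_gt0.
have hrho' : has_path_out src tgt (rho + r) v' by apply: has_path_out_cat vz hrho.
have q1' : (alt l q.+1 1 <= rho + r)%N by apply: leq_trans q2 _; rewrite leq_add2l.
have q2' : (alt l q.+2 1 <= rho + r + (l - r))%N.
  by rewrite -addnA subnKC ?(ltnW rl) // altS2 ?(ltnW l_gt1) // addnC leq_add2r.
have := IH _ _ _ _ _ _ _ _ _ _ hL2 cov' ii' ip' npz epz hz lr0 hrho' q1' q2'.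
by rewrite addSnnS.
Qed.

Lemma exists_not_fil1 K : ~ zero_module K -> exists v (y : K), ~ Fil 1 y /\ e v *: y = y.
Proof.
move=> nK; have [x nx] : exists x : K, ~ Fil 1 x.
  apply: contrapT => no; apply: nK; apply: nakayama0 => x.
  by apply: contrapT => h; apply: no; exists x.
have [v nv] := not_fil_vtx nx; exists v, (e v *: x); split=> //; exact: eZ_idem.
Qed.

(** The descent starts from a generator of the last syzygy, which is projective
    and nonzero.  The same projectivity bounds the paths leaving the vertex
    where the descent ends. *)
Lemma proj_dim_vertex N d : fin_gen N -> has_proj_resolution N d.+1 ->
  ~ has_proj_resolution N d ->
  exists v b rho r, [/\ ~~ has_path_out src tgt b v, has_path_out src tgt rho v,
    has_path_in src tgt r v, (alt l d 1 <= rho)%N & (alt l d.+1 1 <= rho + r)%N].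
Proof.
move=> fg res nres; have [K hK] := exists_nth_syzygy d.+1 fg.
have prK := projective_nth_syzygy res hK.
have fgK := nth_syzygy_fin_gen fg hK.
have [L1 [hL1 sK]] := nth_syzygySP hK.
have [P [p [i [cov ii ip]]]] := sK.
have nK : ~ zero_module K.
  move=> K0; apply: nres; apply: (has_proj_resolution_syzygy hL1).
    exact: (nth_syzygy_fin_gen fg hL1).
  have [_ prP ps _] := cov; apply: projective_iso prP.
  exists p; split=> //; apply: lin_inj => x /ip[y <-].
  by rewrite (K0 y) linear0.
have [v [y [ny ey]]] := exists_not_fil1 nK.
have hy : Fil 1 (i y).
  by apply: (projective_cover_ker cov); apply/ip; exists y.
have h0 : has_path_out src tgt 0 v by apply/existsP; exists v => /=.
have := syzygy_descent (q := 0) hL1 cov ii ip ny ey hy isT h0 (leq0n _) (leqnn _).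
move=> [K1 [P0 [p0 [i0 [y0 [v0 [rho0 [r0]]]]]]]].
move=> [[cov0 ii0 ip0] [ny0 ey0 hy0 ny0'] r0l hrho [q1 q2]].
have sK1 : is_syzygy N K1 by exists P0, p0, i0.
have [K2 hK2] := exists_nth_syzygy d (is_syzygy_fin_gen sK1).
have prK2 := projective_nth_syzygy res (nth_syzygy_front sK1 hK2).
have fgK2 := nth_syzygy_fin_gen (is_syzygy_fin_gen sK1) hK2.
have ei : e v0 *: i0 y0 = i0 y0 by rewrite -linearZ_LR ey0.
have r0l' : (r0 <= l)%N by case/andP: r0l => _ /ltnW.
have ty : path_generator y0 v0 (l - r0).
  split=> // c; split=> [cy|hc].
    apply: (fil_cancel (projective_cover_free cov0) hy0 ny0' ei).
      by rewrite subnKC.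
    by rewrite -linearZ_LR cy linear0; apply: fil_0.
  apply: ii0; rewrite linear0 linearZ /= -ei scalerA.
  apply: (fil_ge_nil (r := (l - r0 + r0)%N)); first by rewrite subnK.
  exact: fil_M.
exists v0, (alt l d.+1 (l - r0)), rho0, r0; split=> //.
- by apply: path_generator_no_path_out sK1 hK2 fgK2 prK2 ty _ => //; lia.
- apply: has_path_in_of_fil hy0 ei _; apply/eqP => h; apply: ny0.
  by rewrite (lin_eq0 ii0 h); apply: fil_0.
Qed.

(** * Path modules and simple modules *)

(** [M] is the path module of length [m] at [v], with generator [y]. *)
Definition path_module M (y : M) v m :=
  [/\ e v *: y = y, forall x, exists b : B, x = b *: y
    & forall b : B, b *: y = 0 <-> Fil m (b * e v : B^o)].

Lemma path_module_iso M N (y : M) (t : N) v m : path_module y v m -> path_module t v m -> iso M N.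
Proof.
move=> [ey gy ay] [et gt_ at_].
have sumE (K : rmodType A) (z : K) (b : unit -> B) :
    \sum_(i in [set: unit]) b i *: z = b tt *: z.
  have -> : [set: unit] = [set tt] by apply/setP => -[]; rewrite !inE.
  by rewrite big_set1.
have gen x : exists b : unit -> B, x = \sum_(i in [set: unit]) b i *: y.
  by have [b ->] := gy x; exists (fun _ => b); rewrite sumE.
have [|f fE] := lin_of_gens (n := fun _ => t) gen.
  by move=> b; rewrite !sumE => /ay/at_.
have fE' b : f (b *: y) = b *: t by have := fE (fun _ => b); rewrite !sumE.
exists f; split=> [|z]; last by have [b ->] := gt_ z; exists (b *: y).
by apply: lin_inj => x; have [b ->] := gy x; rewrite fE' => /at_/ay.
Qed.

Lemma path_module0_zero M (y : M) v : path_module y v 0 -> zero_module M.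
Proof. by move=> [_ gy ay] x; have [b ->] := gy x; apply/ay. Qed.

Lemma fin_gen_path_module M (y : M) v m : path_module y v m -> fin_gen M.
Proof.
move=> [_ gy _]; exists 1%N, (fun _ => y) => x; have [b ->] := gy x.
by exists (fun _ => b); rewrite big_ord1.
Qed.

Lemma path_module_generator M (y : M) v m : (0 < m)%N -> path_module y v m -> path_generator y v m.
Proof.
move=> m0 [ey gy ay]; split=> // hy.
have M0 : zero_module M.
  by apply: nakayama0 => x; have [b ->] := gy x; apply: fil_Z.
apply: (@e_not_fil1 v); apply: (fil_le m0).
by rewrite -[e v]e_idem; apply/ay; rewrite [LHS]M0.
Qed.


(** The quotient of the ring by the annihilator that the generator should have. *)
Lemma exists_path_module v m : exists M (y : M), path_module y v m.
Proof.
have U0 : Fil m (0 * e v : B^o) by rewrite mul0r; apply: fil_0.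
have UL (c x y : B) : Fil m (x * e v : B^o) -> Fil m (y * e v : B^o) ->
    Fil m ((c * x + y) * e v : B^o).
  by move=> hx hy; rewrite mulrDl -mulrA; apply: fil_D => //; apply: (fil_Z (M := B^o)).
have [S [p [ps pP]]] := exists_quotient (@Submodule B (B^o)
  (fun b => Fil m (b * e v : B^o)) U0 UL).
pose y := p (e v).
have pE (b : B) : p b = b *: y.
  rewrite -linearZ; apply/eqP; rewrite -subr_eq0 -linearB; apply/eqP/pP.
  have h : Fil m ((b - b * e v) * e v : B^o).
    by rewrite mulrBl -mulrA e_idem subrr; apply: fil_0.
  exact: h.
exists S, y; split.
- by rewrite -linearZ /= [_ *: _]e_idem.
- by move=> x; have [b <-] := ps x; exists b.
- by move=> c; rewrite -pE; apply: pP.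
Qed.

(** The path modules of length 1 are simple: every nonzero element is an
    invertible multiple of the generator. *)
Lemma exists_simple u : exists (S : rmodType A) (y : S),
  [/\ simple S, path_generator y u 1 & forall x : S, Fil 1 x -> x = 0].
Proof.
have [S [y cy]] := exists_path_module u 1; have ty := path_module_generator (ltnSn 0) cy.
have [ey gy ay] := cy; have [_ ny _] := ty.
have S1 (x : S) : Fil 1 x -> x = 0.
  move: x; apply: (fil_ind (S := fun x : S => x = 0)) => // [x z -> ->|b x hb].
    exact: addr0.
  have [c ->] := gy x; rewrite scalerA; apply/ay.
  by rewrite -mulrA; apply: (fil_Zl (M := B^o)).
have y0 : y != 0 by apply/eqP => y0; apply: ny; rewrite y0; apply: fil_0.
exists S, y; split=> //; split; first by exists y.
move=> U Uc; have [all0|no] := EM (forall x, x \in U -> x = 0); first by left.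
right; have [x [xU x0]] : exists x, x \in U /\ x != 0.
  apply: contrapT => no'; apply: no => x xU; apply/eqP/negPn/negP => x0.
  by apply: no'; exists x.
have [b bx] := gy x.
have be : b * e u * e u = b * e u by rewrite -mulrA e_idem.
have [c [z [bE _ _]]] := expand_at be.
have xE : x = sc c *: y.
  rewrite bx -[in LHS]ey scalerA bE scalerDl -scalerA ey.
  by rewrite [X in _ + X](S1 _ (sum_ar_fil1 _ _)) addr0.
have c0 : c != 0.
  by apply: contraNneq x0 => c0; rewrite xE c0 rmorph0 scale0r.
move=> t; have [d ->] := gy t; rewrite -(sc_inv y c0) -xE scalerA.
exact: (submoduleZ (S := submodule_of_pred Uc)).
Qed.

(** An element of smaller exact order survives the multiplication by a path of
    length [m], by [fil_cancel]. *)
Lemma fil_of_annihilated P (q : B^o) (y : P) x m : path_free P ->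
  Fil m q -> ~ Fil m.+1 q -> q * e x = q -> (m < l)%N -> e x *: y = y ->
  q *: y = 0 -> Fil (l - m) y.
Proof.
move=> fP hq nq qx ml ey qy; case: (eqVneq y 0) => [->|y0]; first exact: fil_0.
have [r [_ rl hr nr]] := exact_order y0 (I : fil ar 0 y).
case: (leqP (l - m) r) => [lr|rm]; first exact: fil_le lr hr.
case: nq; rewrite -qx; apply: (fil_cancel fP hr nr ey).
  by move: rm; lia.
by rewrite qy; apply: fil_0.
Qed.

(** Let H be the length of a longest path into [v], with start [u], and S the
    simple module at [u].  By induction the n-th syzygy of S contains a path
    generator [y] of length 1 or l - 1 at the vertex after [alt l n 1] steps.
    The map to a stable summand cannot kill [y], as the correction through a
    projective module falls into the radical by [fil_of_annihilated].  The image
    of [y] then forces, by [has_path_in_of_syzygy], a path into [v] longer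
    than H. *)
Lemma simple_not_summand v b rho r d :
  ~~ has_path_in src tgt b v -> has_path_in src tgt rho v -> has_path_out src tgt r v ->
  (alt l d 1 <= rho)%N -> (alt l d.+1 1 <= rho + r)%N ->
  exists S : rmodType A, simple S /\ forall n, (n <= d)%N ->
    ~ exists K N L, [/\ fin_gen N, nth_syzygy S n K, nth_syzygy N n.+1 L
        & stable_summand K L].
Proof.
move=> nb hrho hr q1 q2.
have exH : exists n, has_path_in src tgt n v by exists rho.
have ubH n : has_path_in src tgt n v -> (n <= b)%N.
  by move=> hn; rewrite leqNgt; apply/negP => /ltnW/has_path_in_le/(_ hn); apply/negP.
case: (ex_maxnP exH ubH) => H hH maxH.
have rhoH := maxH _ hrho.
have [u huv] := existsP hH.
have [S [y0 [simS ty0 nilS]]] := exists_simple u.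
exists S; split=> // n nd [K [N [L [fgN hK hL KL]]]].
(* the length of the path module in the n-th syzygy of S *)
pose mm n := if odd n then l.-1 else 1%N.
have l0 : (0 < l)%N := ltnW l_gt1.
have altS n' : (alt l n'.+1 1 = alt l n' 1 + mm n')%N.
  rewrite !altE // /mm /= uphalf_half mulnDl; case: (odd n') => /=; lia.
have mm_gt0 n' : (0 < mm n' < l)%N by rewrite /mm; case: odd; lia.
have mmS n' : mm n'.+1 = (l - mm n')%N by rewrite /mm /=; case: odd => /=; lia.
have leH n' : (n' <= d)%N -> (alt l n' 1 <= H)%N.
  by move=> n'd; apply: leq_trans (leq_trans q1 rhoH); apply: alt_leq_l.
have [nilK [y [x [ty hx]]]] : (forall z : K, Fil l.-1 z -> z = 0) /\
    exists (y : K) x, path_generator y x (mm n) /\ reach src tgt (H - alt l n 1) x v.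
  elim: n K hK nd {hL KL L} => [|n IH] K hK nd.
    have KS := nth_syzygy0P hK; subst; split=> [z hz|].
      by apply: nilS; apply: fil_le hz; move: l_gt1; lia.
    by exists y0, u; split=> //; rewrite subn0.
  have [X [hX sK]] := nth_syzygySP hK.
  split; first by move=> z; apply: (syzygy_fil_nil sK).
  have [nilX [y [x [ty hx]]]] := IH _ hX (ltnW nd).
  have leH' : (alt l n 1 + mm n <= H)%N by rewrite -altS leH.
  have hE : (H - alt l n 1 = H - alt l n.+1 1 + mm n)%N by rewrite altS; lia.
  move: hx; rewrite hE => /reach_split[x' xx' x'v].
  have [P [p [i [cov ii ip]]]] := sK.
  have [y' ty'] := path_generator_syzygy cov ii ip nilX ty (mm_gt0 n) xx'.
  by exists y', x'; rewrite mmS.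
have ml := proj2 (andP (mm_gt0 n)).
have : has_path_out src tgt (mm n) x.
  apply: has_path_out_le (has_path_out_cat hx hr); move: (altS n) (leH _ nd).
  have := alt_leq_l (n := n.+1) (n' := d.+1) nd l0; lia.
move=> /existsP[w /path_elt h]; have [q [_ qx hq nq]] := h ml.
have [ey ny annq] := ty.
have qy : q *: y = 0 by apply/annq; rewrite qx.
have [f [g [P [a [c [fgP prP gf]]]]]] := stable_summand_maps KL.
have fil1 : Fil 1 (c (a y)).
  apply: fil_lin; apply: (fil_le (s := (l - mm n)%N)); first by rewrite subn_gt0.
  apply: (fil_of_annihilated _ hq nq qx ml).
  - exact: path_free_projective fgP prP.
  - by rewrite -linearZ_LR ey.
  - by rewrite -linearZ_LR qy linear0.
have fy0 : f y != 0.
  apply/eqP => fy; apply: ny; have := gf y; rewrite fy linear0 sub0r => yE.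
  by rewrite -[y]opprK yE; apply: fil_N.
have [L1 [hL1 [P0 [p0 [i0 [cov0 ii0 ip0]]]]]] := nth_syzygySP hL.
have ify0 : i0 (f y) != 0.
  by apply: contra_neq fy0 => /(lin_eq0 ii0).
have eify : e x *: i0 (f y) = i0 (f y) by rewrite -!linearZ_LR ey.
have pify : p0 (i0 (f y)) = 0 by apply/ip0; exists (f y).
have hify : Fil (l - mm n) (i0 (f y)).
  apply: (fil_of_annihilated _ hq nq qx ml eify).
    exact: (projective_cover_free cov0).
  by rewrite -!linearZ_LR qy !linear0.
have := has_path_in_of_syzygy hL1 cov0 pify ify0 eify hify.
move=> /has_path_in_cat/(_ hx)/maxH; apply/negP; rewrite -ltnNge.
have := leH _ nd; have := mm_gt0 n.
rewrite !altE ?leq_subr //= /mm uphalf_half mulnDl; case: (odd n) => /=; lia.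
Qed.


(** * Direct sums of path modules *)

Lemma fil_mulr r w (b : B^o) : Fil r b -> Fil r (b * e w : B^o).
Proof. by move=> hb; apply: (fil_Zl (M := B^o)). Qed.

(** A criterion for elements of exact degrees [r i] to generate independent path
    modules.  The hypothesis says that the leading terms of degree [s] are
    linearly independent modulo multiples of generators of smaller degree.  In
    a relation, the coefficients are shown to lie in deeper and deeper degrees:
    scalar parts vanish by the hypothesis, and arrows are cancelled by
    freeness. *)
Lemma graded_independent (I : finType) P (y : I -> P) (w : I -> V) (r : I -> nat) :
  path_free P -> (forall i, Fil (r i) (y i)) -> (forall i, e (w i) *: y i = y i) ->
  (forall s (c : I -> k) (b : I -> B), (s < l)%N ->
     Fil s.+1 (\sum_i b i *: y i) ->
     (forall i, r i = s -> exists z : Ar -> B,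
        b i = sc (c i) * e (w i) + \sum_a ar a * z a) ->
     forall i, r i = s -> c i = 0) ->
  forall b : I -> B, \sum_i b i *: y i = 0 ->
    forall i, Fil (l - r i) (b i * e (w i) : B^o).
Proof.
move=> fP hy ey H.
have step s (b : I -> B) : (s < l)%N -> (forall i, b i * e (w i) = b i) ->
    (forall i, Fil (s - r i) (b i : B^o)) -> Fil s.+1 (\sum_i b i *: y i) ->
    forall i, (r i <= s)%N -> Fil (s.+1 - r i) (b i : B^o).
  elim: s b => [|s IH] b sl be hb hs i ris.
    have /choice[c cP] : forall i, exists c, exists z : Ar -> B,
        b i = sc c * e (w i) + \sum_a ar a * z a.
      by move=> i'; have [c [z [bE _ _]]] := expand_at (be i'); exists c, z.
    have ri : r i = 0%N by apply/eqP; rewrite -leqn0.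
    have [z bE] := cP i; rewrite ri bE (H _ c b sl hs (fun i _ => cP i) i ri).
    by rewrite rmorph0 mul0r add0r; exists z; split.
  have /choice[c cP] : forall i, exists c, exists z : Ar -> B,
      b i = sc c * e (w i) + \sum_a ar a * z a.
    by move=> i'; have [c [z [bE _ _]]] := expand_at (be i'); exists c, z.
  have fil1 j : r j = s.+1 -> Fil 1 (b j : B^o).
    move=> rj; have [z bE] := cP j; rewrite bE (H _ c b sl hs (fun i _ => cP i) j rj).
    by rewrite rmorph0 mul0r add0r; exists z; split.
  move: ris; rewrite leq_eqVlt => /orP[/eqP ri|]; first by rewrite ri subSnn; apply: fil1.
  rewrite ltnS => ris.
  have /choice[z zP] : forall j, exists z : Ar -> B, (r j <= s)%N ->
      [/\ forall a, Fil (s - r j) (z a : B^o), forall a, e (src a) * z a = z a,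
          forall a, z a * e (w j) = z a & b j = \sum_a ar a * z a].
    move=> j; case: (leqP (r j) s) => rj; last by exists (fun _ => 0).
    have := hb j; rewrite subSn // => /fil_split[z [hz ez bE]].
    exists (fun a => z a * e (w j)) => _; split=> [a|a|a|].
    - exact: fil_mulr.
    - by rewrite mulrA; congr (_ * _); apply: ez.
    - by rewrite -mulrA e_idem.
    - rewrite -be bE mulr_suml; apply: eq_bigr => a _; symmetry; exact: mulrA.
  (* cancel the arrow a from the coefficients that have positive degree; the
     remaining terms of the relation have degree at least s + 2 *)
  pose b' a j := if (r j <= s)%N then z j a else 0.
  have hs' a : Fil s.+1 (\sum_j b' a j *: y j).
    have sumE : \sum_j b j *: y j = \sum_a ar a *: (\sum_j b' a j *: y j)
        + \sum_(j | ~~ (r j <= s)%N) b j *: y j.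
      rewrite (bigID (fun j => r j <= s)%N) /=; congr (_ + _).
      under [RHS]eq_bigr do rewrite scaler_sumr.
      rewrite exchange_big big_mkcond; apply: eq_bigr => j _ /=.
      rewrite /b'; case: ifP => rj; last by rewrite big1 // => c' _; rewrite scale0r scaler0.
      have [_ _ _ ->] := zP _ rj; rewrite scaler_suml; apply: eq_bigr => c' _.
      by rewrite scalerA.
    apply: (fP s.+1 (fun a => \sum_j b' a j *: y j) sl).
      move=> c'; rewrite scaler_sumr; apply: eq_bigr => j _; rewrite scalerA /b'.
      by case: ifP => rj; rewrite ?mulr0 //; have [_ -> _ _] := zP _ rj.
    have -> : \sum_a ar a *: (\sum_j b' a j *: y j) =
        \sum_j b j *: y j - \sum_(j | ~~ (r j <= s)%N) b j *: y j.
      by rewrite sumE addrK.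
    apply: fil_B => //; apply: fil_sum => j; rewrite -ltnNge leq_eqVlt => /orP[/eqP rj|rj].
      by rewrite -add1n; apply: fil_M; [apply: fil1 | rewrite rj; apply: hy].
    by apply: fil_Z; apply: fil_le rj (hy j).
  have [_ _ _ ->] := zP i ris; rewrite (subSn (leqW ris)).
  exists (z i); split=> // a.
  have := IH (b' a) (ltnW sl) _ _ (hs' a) i ris; rewrite /b' ris; apply=> j.
    by case: ifP => rj; rewrite ?mul0r //; have [_ _ -> _] := zP _ rj.
  by case: ifP => rj; [have [] := zP _ rj | apply: fil_0].
move=> b b0; pose b' i := b i * e (w i).
have b'0 : \sum_i b' i *: y i = 0.
  by rewrite -[RHS]b0; apply: eq_bigr => i _; rewrite -scalerA ey.
have all s : (s <= l)%N -> forall i, Fil (s - r i) (b' i : B^o).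
  elim: s => [//|s IH] sl i.
  case: (leqP (r i) s) => ri.
    apply: step => //; last by rewrite b'0; apply: fil_0.
      by move=> j; rewrite -mulrA e_idem.
    exact: IH (ltnW sl).
  by have -> : (s.+1 - r i = 0)%N by apply/eqP; rewrite subn_eq0.
exact: all (leqnn l).
Qed.

(** A decomposition of [M] into path modules of lengths [m i] at [w i]; length 0
    is allowed and stands for a zero summand. *)
Definition path_basis (I : finType) (X : {set I}) M (y : I -> M) (w : I -> V)
    (m : I -> nat) :=
  [/\ forall i, e (w i) *: y i = y i,
      forall x, exists b : I -> B, x = \sum_(i in X) b i *: y i,
      forall b : I -> B, \sum_(i in X) b i *: y i = 0 ->
        forall i, i \in X -> Fil (m i) (b i * e (w i) : B^o)
    & forall i (b : B), i \in X -> Fil (m i) (b * e (w i) : B^o) -> b *: y i = 0].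

Lemma path_basis_split (I : finType) (X : {set I}) M (y : I -> M)
    (w : I -> V) (m : I -> nat) i0 :
  path_basis X y w m -> i0 \in X ->
  exists K1 K2 (y1 : K1) (y2 : I -> K2), [/\ iso (K1 * K2)%type M,
    path_module y1 (w i0) (m i0) & path_basis (X :\ i0) y2 w m].
Proof.
move=> [ey gen rel ann] i0X.
have [K1 [K2 [i1 [i2 [ii1 ii2 h1 h2 iK]]]]] :
    exists (K1 K2 : rmodType A) (i1 : {linear K1 -> M}) (i2 : {linear K2 -> M}),
    [/\ injective i1, injective i2,
      (forall x, gen_submodule [set i0] y x <-> exists y, i1 y = x),
      (forall x, gen_submodule (X :\ i0) y x <-> exists y, i2 y = x)
      & iso (K1 * K2)%type M].
  apply: iso_internal_sum => [x|].
    have [b ->] := gen x; exists (b i0 *: y i0), (\sum_(i in X :\ i0) b i *: y i).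
    by split; [exists b; rewrite big_set1 | exists b | rewrite (big_setD1 i0)].
  move=> _ _ [b ->] [c ->]; rewrite big_set1 => e0.
  have := rel (fun i => if i == i0 then b i0 else c i) _ i0 i0X.
  rewrite eqxx => h; apply: ann => //; apply: h.
  rewrite (big_setD1 i0) //= eqxx -[RHS]e0; congr (_ + _).
  by apply: eq_bigr => i; rewrite !inE => /andP[/negPf-> _].
have /h1[y1 y1E] : gen_submodule [set i0] y (y i0).
  by exists (fun _ => 1); rewrite big_set1 scale1r.
have /choice[y2 y2E] : forall i, exists z : K2,
    if i \in X :\ i0 then i2 z = y i else z = 0.
  move=> i; case iX: (i \in X :\ i0); last by exists 0.
  apply/h2; exists (fun j => if j == i then 1 else 0).
  rewrite (big_setD1 i) //= eqxx scale1r big1 ?addr0 // => j.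
  by rewrite !inE => /andP[/negPf-> _]; rewrite scale0r.
have y2E' i : i \in X :\ i0 -> i2 (y2 i) = y i by move=> iX; have := y2E i; rewrite iX.
have sum2 (b : I -> B) : i2 (\sum_(i in X :\ i0) b i *: y2 i) =
    \sum_(i in X :\ i0) b i *: y i.
  by rewrite linear_sum; apply: eq_bigr => i iX; rewrite linearZ /= y2E'.
exists K1, K2, y1, y2; split=> //.
  split=> [|x|b].
  - by apply: ii1; rewrite linearZ /= y1E.
  - have /h1[b] : exists y, i1 y = i1 x by exists x.
    by rewrite big_set1 -y1E -linearZ => /ii1 ->; exists (b i0).
  split=> [b0|hb]; last first.
    by apply: ii1; rewrite linear0 linearZ /= y1E; apply: ann.
  have := rel (fun i => if i == i0 then b else 0) _ i0 i0X.
  rewrite eqxx; apply; rewrite (big_setD1 i0) //= eqxx big1 ?addr0.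
    by rewrite -y1E -linearZ_LR b0 linear0.
  by move=> i; rewrite !inE => /andP[/negPf-> _]; rewrite scale0r.
split=> [i|x|b b0 i iX|i b iX hb].
- have := y2E i; case: ifP => [iX h|_ ->]; last exact: scaler0.
  by apply: ii2; rewrite linearZ /= h ey.
- have /h2[b bE] : exists y, i2 y = i2 x by exists x.
  by exists b; apply: ii2; rewrite sum2.
- have := rel (fun i => if i == i0 then 0 else b i) _ i.
  move: (iX); rewrite !inE => /andP[/negPf-> ->]; apply=> //.
  rewrite (big_setD1 i0) //= eqxx scale0r add0r.
  under eq_bigr => j.
    rewrite !inE => /andP[/negPf-> _].
    over.
  by rewrite -sum2 b0 linear0.
- apply: ii2; rewrite linear0 linearZ /= y2E' //; apply: ann => //.
  by move: iX; rewrite inE => /andP[].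
Qed.

(** Closure form of a decomposition: it spares the construction of direct sums
    of dependent families. *)
Lemma path_basis_class (F : rmodType A -> Prop) :
  (forall M, zero_module M -> F M) -> (forall M N, iso M N -> F M -> F N) ->
  (forall M N, F M -> F N -> F (M * N)%type) ->
  forall (I : finType) (X : {set I}) M (y : I -> M) (w : I -> V)
    (m : I -> nat), path_basis X y w m ->
  (forall i N (t : N), i \in X -> path_module t (w i) (m i) -> F N) -> F M.
Proof.
move=> F0 Fi Fp I X; move: {2}#|X| (erefl #|X|) => n; elim: n X => [|n IH] X Xn M y w m hb hF.
  apply: F0 => x; have [_ gen _ _] := hb; have [b ->] := gen x.
  by rewrite (cards0_eq Xn) big_set0.
have [i0 i0X] : exists i, i \in X by apply/card_gt0P; rewrite Xn.
have [K1 [K2 [y1 [y2 [iK c1 hb2]]]]] := path_basis_split hb i0X.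
apply: Fi iK _; apply: Fp; first exact: hF c1.
apply: IH hb2 _; first by have := cardsD1 i0 X; rewrite Xn i0X => -[->].
by move=> i N t; rewrite inE => /andP[_ iX]; apply: hF.
Qed.

(** * Syzygies of path modules *)

(** All words of arrows, composable or not, so that the index type is a plain
    product; words that are not paths have value 0. *)
Fixpoint word (m : nat) : finType :=
  if m is m'.+1 then (Ar * word m')%type else unit.

Fixpoint word_val v m : word m -> B^o :=
  match m with
  | 0%N => fun _ => e v
  | m'.+1 => fun p => ar p.1 * word_val v p.2
  end.

Definition word_end v m : word m -> V :=
  match m with
  | 0%N => fun _ => v
  | m'.+1 => fun p => tgt p.1
  end.

Fixpoint is_path v m : word m -> bool :=
  match m with
  | 0%N => fun _ => true
  | m'.+1 => fun p => (src p.1 == word_end v p.2) && is_path v p.2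
  end.

Lemma word_val_end v m (p : word m) : e (word_end v p) * word_val v p = word_val v p.
Proof.
case: m p => [|m] /=; first by move=> _; apply: e_idem.
by move=> [a p] /=; rewrite mulrA tp_tgt.
Qed.

Lemma word_val_fil v m (p : word m) : Fil m (word_val v p).
Proof.
elim: m p => [//|m IH] [a p]; exact: (fil_ar (M := B^o) a (IH p)).
Qed.

Lemma word_val_not_path v m (p : word m) : ~~ is_path v p -> word_val v p = 0.
Proof.
elim: m p => [//|m IH] [a p] /=; rewrite negb_and => /orP[ap|/IH->]; last exact: mulr0.
by rewrite -word_val_end -(tp_src T a) -mulrA (mulrA (e _)) e_orth // mul0r mulr0.
Qed.

Lemma reach_word v m (p : word m) : is_path v p -> reach src tgt m v (word_end v p).
Proof.
elim: m p => [p|m IH [a p]] /=; first by rewrite eqxx.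
by move=> /andP[/eqP ap /IH h]; apply/existsP; exists a; rewrite eqxx ap.
Qed.

Lemma word_of_reach v m x : reach src tgt m v x ->
  exists p : word m, is_path v p /\ word_end v p = x.
Proof.
elim: m x => [|m IH] x /=; first by move/eqP->; exists tt.
case/existsP=> a /andP[/eqP ax /IH[p [hp pa]]].
by exists (a, p) => /=; rewrite hp pa eqxx.
Qed.

(** The projective module [B e v], for which the coefficient [b e v] is unique. *)
Lemma exists_vproj1 v : exists P (g : P),
  [/\ fin_gen P /\ projective P, e v *: g = g, forall x, exists b : B, x = b *: g,
      forall b : B, b *: g = 0 -> b * e v = 0 & ~ Fil 1 g].
Proof.
have [P [g [fg pr eg gen rel]]] := exists_vproj [set tt] (fun _ => v).
exists P, (g tt); split=> //.
- by move=> x; have [b ->] := gen x; exists (b tt); rewrite big_set1.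
- move=> b b0; apply: (rel (fun _ => b) _ tt); first by rewrite big_set1.
  by rewrite inE.
move=> hg; have [|f fE] := lin_of_gens (N := B^o) (n := fun _ => e v) gen.
  by move=> b /rel h; rewrite big_set1; apply: h; rewrite inE.
apply: (@e_not_fil1 v).
have := fil_lin f hg; have := fE (fun _ => 1).
by rewrite !big_set1 !scale1r => ->.
Qed.

Section Words.
Variables (P : rmodType A) (v : V) (g : P).
Hypothesis fP : path_free P.
Hypothesis eg : e v *: g = g.
Hypothesis gen : forall x, exists b : B, x = b *: g.
Hypothesis ng : ~ Fil 1 g.

(** Expand the coefficients modulo the radical, one arrow at a time. *)
Lemma word_leading m x : Fil m x -> exists c : word m -> k,
  Fil m.+1 (x - \sum_p sc (c p) *: (word_val v p *: g)).
Proof.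
elim: m x => [|m IH] x hx.
  have [b xE] := gen x.
  have be : b * e v * e v = b * e v by rewrite -mulrA e_idem.
  have [c [z [bE _ _]]] := expand_at be.
  exists (fun _ => c); rewrite (bigD1 tt) //= big1 ?addr0; last by case.
  rewrite eg xE -eg scalerA bE scalerDl -scalerA eg addrC addKr.
  exact: sum_ar_fil1.
have [z [hz _ ->]] := fil_split hx.
have /choice[c cP] : forall a, exists c : word m -> k,
    Fil m.+1 (z a - \sum_p sc (c p) *: (word_val v p *: g)).
  by move=> a; apply: IH.
exists (fun p => c p.1 p.2).
have -> : \sum_(p : word m.+1) sc (c p.1 p.2) *: (word_val v p *: g) =
    \sum_a ar a *: \sum_p sc (c a p) *: (word_val v p *: g).
  rewrite -(pair_bigA _ (fun a p => sc (c a p) *: (word_val v ((a, p) : word m.+1) *: g))) /=.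
  apply: eq_bigr => a _; rewrite scaler_sumr; apply: eq_bigr => p _.
  by rewrite -(scZ_comm) [ar a *: _]scalerA.
rewrite -sumrB; apply: fil_sum => a _.
by rewrite -scalerBr; apply: fil_ar.
Qed.

(** Distinct paths are independent modulo the next degree: cancel the last
    arrow by freeness. *)
Lemma word_free m (c : word m -> k) : (m < l)%N ->
  Fil m.+1 (\sum_(p | is_path v p) sc (c p) *: (word_val v p *: g)) ->
  forall p, is_path v p -> c p = 0.
Proof.
elim: m c => [|m IH] c ml h.
  case=> _; apply/eqP/negPn/negP => c0; apply: ng; apply: (fil_sc c0).
  by move: h; rewrite (bigD1 tt) //= big1 ?addr0 ?eg //; case.
pose z a : P := \sum_(p | is_path v p && (src a == word_end v p))
  sc (c ((a, p) : word m.+1)) *: (word_val v p *: g).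
have ez a : e (src a) *: z a = z a.
  rewrite scaler_sumr; apply: eq_bigr => p /andP[_ /eqP ap].
  by rewrite -(scZ_comm) [e _ *: _]scalerA ap word_val_end.
have zE : \sum_a ar a *: z a =
    \sum_(p : word m.+1 | is_path v p) sc (c p) *: (word_val v p *: g).
  rewrite /z; under eq_bigr do rewrite scaler_sumr.
  rewrite pair_big_dep /=; apply: eq_big => [[a p]|[a p] _] /=; first by rewrite andbC.
  by rewrite -(scZ_comm) [ar a *: _]scalerA.
move: h; rewrite -zE => /(fP ml ez) h [a p] /= /andP[ap hp].
have := IH (fun p => if src a == word_end v p then c (a, p) else 0) (ltnW ml) _ p hp.
rewrite ap; apply; move: (h a); rewrite /z big_mkcondr.
rewrite [X in Fil _ X -> _](_ : _ = \sum_(p0 | is_path v p0)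
  sc (if src a == word_end v p0 then c (a, p0) else 0) *: (word_val v p0 *: g)) //.
by apply: eq_bigr => p' _; case: ifP => _ //; rewrite rmorph0 scale0r.
Qed.

End Words.

(** The kernel of B e_v -> M is the degree [m] part.  Paths of length [m]
    generate it by Nakayama's lemma, and they are independent by
    [graded_independent]. *)
Lemma path_module_syzygy M (t : M) v m : path_module t v m -> (0 < m < l)%N ->
  exists K (y : word m -> K), is_syzygy M K /\
    path_basis setT y (@word_end v m) (fun p => if is_path v p then (l - m)%N else 0%N).
Proof.
move=> [et gt_ at_] /andP[m0 ml].
have [P [g [[fg pr] eg gen rel ng]]] := exists_vproj1 v.
have fP : path_free P := path_free_projective fg pr.
have gen1 x : exists b : unit -> B, x = \sum_(i in [set tt]) b i *: g.
  by have [b ->] := gen x; exists (fun _ => b); rewrite big_set1.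
have [|f fE] := lin_of_gens (n := fun _ => t) gen1.
  by move=> b; rewrite !big_set1 => /rel h; apply/at_; rewrite h; apply: fil_0.
have fE' b : f (b *: g) = b *: t by have := fE (fun _ => b); rewrite !big_set1.
have filg b : Fil m (b *: g) <-> Fil m (b * e v : B^o).
  split=> h; first by apply: (fil_cancel (r := 0) fP I ng eg (ltnW ml)).
  by rewrite -eg scalerA; apply: fil_Zl.
have kerf x : f x = 0 <-> Fil m x.
  by have [b ->] := gen x; rewrite fE' filg; apply: at_.
have cov : projective_cover f.
  apply: (projective_coverI) => //.
    by move=> x; have [b ->] := gt_ x; exists (b *: g); apply: fE'.
  by move=> x /kerf; apply: fil_le.
have [K [i [ii iP]]] := exists_sub (ker_submodule f).
have sK : is_syzygy M K by exists P, f, i; split.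
have imi x : Fil m x <-> exists y, i y = x by rewrite -kerf; apply: iP.
have hq (p : word m) : Fil m (word_val v p *: g).
  by apply: fil_Zl; apply: word_val_fil.
have /choice[y yE] : forall p : word m, exists y, i y = word_val v p *: g.
  by move=> p; apply/imi.
(* words that are not paths have value 0: degree l turns them into summands of
   length 0 *)
pose r (p : word m) := if is_path v p then m else l.
exists K, y; split=> //.
have ey p : e (word_end v p) *: y p = y p.
  by apply: ii; rewrite linearZ /= yE scalerA word_val_end.
have hr p : Fil (r p) (word_val v p *: g).
  rewrite /r; case: ifP => hp; first exact: hq.
  by rewrite word_val_not_path ?hp // scale0r; apply: fil_0.
have ind := graded_independent fP hr (w := @word_end v m).
split=> //.
- move=> x; pose S := gen_submodule [set: word m] y; move: x.
  apply: (nakayama (S := S)) => x.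
  have /(word_leading eg gen)[c hc] : Fil m (i x) by apply/imi; exists x.
  have [z [hz ez zE]] := fil_split hc.
  have /choice[u uE] : forall a, exists u, i u = z a by move=> a; apply/imi.
  exists (\sum_p sc (c p) *: y p), (\sum_a ar a *: u a); split.
  + by exists (fun p => sc (c p)); apply: eq_bigl => p; rewrite inE.
  + by apply: fil_sum => a _; apply: fil_ar.
  apply: ii; rewrite linearD !linear_sum /=.
  have -> : \sum_a i (ar a *: u a) = \sum_a ar a *: z a.
    by apply: eq_bigr => a _; rewrite linearZ /= uE.
  rewrite -zE; have -> : \sum_p i (sc (c p) *: y p) =
      \sum_p sc (c p) *: (word_val v p *: g).
    by apply: eq_bigr => p _; rewrite linearZ /= yE.
  by rewrite addrC subrK.
- move=> b b0 p _.
  have := ind _ _ b _ p; rewrite /r; case: ifP => hp; last by [].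
  apply.
  + by move=> p'; rewrite scalerA word_val_end.
  + move=> s c b' sl hs hb p' rp'.
    have hp' : is_path v p'.
      by move: rp' sl; rewrite /r; case: ifP => // _ ->; rewrite ltnn.
    have sm : s = m by rewrite -rp' /r hp'.
    rewrite sm in hs; apply: (word_free fP eg ng ml _ hp').
    have -> : \sum_(p0 : word m | is_path v p0) sc (c p0) *: (word_val v p0 *: g) =
        \sum_p0 b' p0 *: (word_val v p0 *: g)
        - \sum_(p0 | is_path v p0) (b' p0 - sc (c p0)) *: (word_val v p0 *: g).
      rewrite [X in _ = X - _](bigID (@is_path v m)) /= [X in _ = _ + X - _]big1 ?addr0.
        by rewrite -sumrB; apply: eq_bigr => q _; rewrite -scalerBl subKr.
      by move=> q hq'; rewrite word_val_not_path // scale0r scaler0.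
    apply: fil_B; first exact: hs.
    apply: fil_sum => q hq'.
    have [z bE] : exists z : Ar -> B, b' q = sc (c q) * e (word_end v q) + \sum_a ar a * z a.
      by apply: hb; rewrite /r hq' sm.
    have -> : (b' q - sc (c q)) *: (word_val v q *: g) =
        (\sum_a ar a * z a) *: (word_val v q *: g).
      rewrite -(word_val_end v q) -[X in _ = _ *: X]scalerA -[X in _ *: X = _]scalerA.
      rewrite [LHS]scalerA [RHS]scalerA mulrBl bE mulrDl -mulrA e_idem addrC addKr.
      by [].
    rewrite scaler_suml; apply: fil_sum => a _; rewrite -scalerA.
    exact/fil_ar/fil_Z/hq.
  rewrite -[RHS](linear0 i) -b0 linear_sum; apply: eq_big => [q|q _]; first by rewrite inE.
  by rewrite linearZ /= yE.
move=> p b _; case: ifP => hp hb; apply: ii; rewrite linear0 linearZ /= yE.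
  apply: (fil_ge_nil (r := (l - m + m)%N)); first by rewrite subnK // ltnW.
  rewrite -(word_val_end v p) -[X in _ *: X]scalerA [X in Fil _ X]scalerA.
  by apply: fil_M.
by rewrite word_val_not_path ?hp // scale0r scaler0.
Qed.


(** * First syzygies are direct sums of path modules *)

Lemma gen_submodule_mem (I : finType) M (X : {set I}) (g : I -> M) i :
  i \in X -> gen_submodule X g (g i).
Proof.
move=> iX; exists (fun j => if j == i then 1 else 0).
rewrite (big_setD1 i) //= eqxx scale1r big1 ?addr0 // => j.
by rewrite !inE => /andP[/negPf-> _]; rewrite scale0r.
Qed.

(** Every first syzygy K lies in the radical of a free module.  Among the
    generating families of K with degrees [r i] >= 1, take one for which the
    total length, the sum of the l - r i, is least.  Its leading terms are
    independent in the sense of [graded_independent]: a dependence would allow a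
    generator to be replaced by an element of larger degree. *)
Lemma syzygy_path_basis M K : is_syzygy M K ->
  exists (I : finType) (y : I -> K) (w : I -> V) (m : I -> nat),
    path_basis setT y w m /\
    forall i, m i = 0%N \/ (0 < m i < l)%N /\ has_path_in src tgt (l - m i) (w i).
Proof.
move=> sK; have fgK := is_syzygy_fin_gen sK.
have [P [p [u [cov ui up]]]] := sK; have fP : path_free P := projective_cover_free cov.
have [I [g [w [ge gen]]]] := vertex_generators fgK.
pose good (y : I -> K) (r : I -> nat) :=
  [/\ forall i, e (w i) *: y i = y i, forall i, (0 < r i <= l)%N,
      forall i, Fil (r i) (u (y i)) & forall x, gen_submodule setT y x].
have exn : exists n, `[< exists (y : I -> K) (r : I -> nat), good y r /\ \sum_i (l - r i)%N = n >].
  exists (\sum_(i : I) (l - 1))%N; apply/asboolP; exists g, (fun _ => 1%N).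
  split=> //; split=> [//|i|i|//]; first by apply/andP; split=> //; apply: ltnW.
  by apply: (projective_cover_ker cov); apply/up; exists (g i).
case: (ex_minnP exn) => n /asboolP[y [r [[ey rl hy gy] rn]]] min_n.
have ru i : e (w i) *: u (y i) = u (y i) by rewrite -linearZ_LR ey.
have ind := graded_independent fP hy ru.
have rel (b : I -> B) : \sum_i b i *: y i = 0 ->
    forall i, Fil (l - r i) (b i * e (w i) : B^o).
  move=> b0; apply: ind; last first.
    by under eq_bigr do rewrite -linearZ_LR; rewrite -linear_sum b0 linear0.
  move=> s c b' sl hs hb i ri; apply/eqP/negPn/negP => c0.
  have [z bE] := hb i ri.
  (* replace y i by the combination y', of degree at least s + 1 *)
  pose t := e (w i) *: \sum_(j | j != i) b' j *: y j.
  pose y' := t + sc (c i) *: y i.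
  have uy' : u y' = e (w i) *: \sum_j b' j *: u (y j)
      - e (w i) *: ((\sum_a ar a * z a) *: u (y i)).
    have -> : u y' = e (w i) *: u (\sum_(j | j != i) b' j *: y j) + sc (c i) *: u (y i).
      by rewrite /y' /t linearD !linearZ.
    rewrite -scalerBr [in RHS](bigD1 i) //=.
    have -> : b' i *: u (y i) = sc (c i) *: u (y i) + (\sum_a ar a * z a) *: u (y i).
      by rewrite bE scalerDl -scalerA ru.
    rewrite addrAC addrK scalerDr addrC -(scZ_comm) ru; congr (_ + _ *: _).
    by rewrite linear_sum; apply: eq_bigr => j _; rewrite linearZ.
  pose y2 j := if j == i then y' else y j.
  pose r2 j := if j == i then s.+1 else r j.
  have good2 : good y2 r2.
    rewrite /y2 /r2; split=> [j|j|j|].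
    - case: eqP => [->|_] //; rewrite /y' scalerDr eZ_idem.
      by rewrite -(scZ_comm) ey.
    - by case: eqP.
    - case: eqP => _ //; rewrite uy'; apply: fil_B; first exact: fil_Z.
      apply: fil_Z; rewrite scaler_suml; apply: fil_sum => a _.
      by rewrite -scalerA; apply/fil_ar/fil_Z; rewrite -ri.
    have hmem j : j != i -> gen_submodule setT y2 (y j).
      by move=> /negPf ji; have := gen_submodule_mem y2 (in_setT j); rewrite {2}/y2 ji.
    have hall j : gen_submodule setT y2 (y j).
      case: (eqVneq j i) => [->|]; last exact: hmem.
      have -> : y i = sc (c i)^-1 *: (y' - t) by rewrite /y' addrC addKr (sc_inv).
      apply: submoduleZ; apply: submoduleB.
        by have := gen_submodule_mem y2 (in_setT i); rewrite {2}/y2 eqxx.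
      by apply: submoduleZ; apply: submodule_sum => j' /hmem; apply: submoduleZ.
    move=> x; have [d ->] := gy x; apply: submodule_sum => j _.
    exact: submoduleZ.
  have : (n <= \sum_j (l - r2 j))%N.
    by apply: min_n; apply/asboolP; exists y2, r2.
  rewrite -rn leqNgt (bigD1 i) //= [X in (_ < X)%N](bigD1 i) //= /r2 eqxx ri.
  under eq_bigr => j ji do rewrite (negPf ji).
  by rewrite ltn_add2r ltn_sub2l.
exists I, y, w, (fun i => l - r i)%N; split.
  split=> // [b b0 i _|i b _ hb].
    by apply: rel; rewrite -[RHS]b0; apply: eq_bigl => j; rewrite inE.
  apply: ui; rewrite linear0 linearZ /= -ru scalerA.
  apply: (fil_ge_nil (r := (l - r i + r i)%N)).
    by rewrite subnK //; case/andP: (rl i).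
  exact: fil_M.
move=> i; have /andP[r0 rl'] := rl i.
case: (leqP l (r i)) => lr; first by left; apply/eqP; rewrite subn_eq0.
right; split; first by lia.
rewrite subKn //; apply: has_path_in_of_fil (hy i) (ru i) _.
apply/eqP => /(lin_eq0 ui) yi0.
have := rel (fun j => if j == i then 1 else 0) _ i; rewrite eqxx mul1r => h.
apply: (@e_not_fil1 (w i)); apply: fil_le (h _).
  by rewrite subn_gt0.
rewrite (bigD1 i) //= eqxx yi0 scaler0 add0r big1 // => j /negPf->.
exact: scale0r.
Qed.

(** * Path modules as high syzygies *)

Lemma syzygy_zero M K : zero_module M -> is_syzygy M K -> zero_module K.
Proof.
move=> M0 [P [p [i [cov ii _]]]] x; apply: ii; rewrite linear0.
apply: nakayama0 => z; exact: (projective_cover_ker cov).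
Qed.

Lemma nth_syzygy_zero M K n : zero_module M -> nth_syzygy M n K -> zero_module K.
Proof.
move=> M0; elim: n K => [|n IH] K; first by move/nth_syzygy0P->.
by move=> /nth_syzygySP[L [/IH L0 sK]]; apply: syzygy_zero sK.
Qed.

Lemma projective_of_syzygy_zero M K : is_syzygy M K -> zero_module K -> projective M.
Proof.
move=> [P [p [i [[_ pr ps _] _ ip]]]] K0; apply: projective_iso pr.
exists p; split=> //; apply: lin_inj => x /ip[y <-].
by rewrite (K0 y) linear0.
Qed.

(** Without a path of length [m] out of [v] the syzygy has no nonzero
    summand. *)
Lemma path_module_projective M (t : M) v m :
  path_module t v m -> (0 < m < l)%N -> ~~ has_path_out src tgt m v -> projective M.
Proof.
move=> ct ml nh; have [K [y [sK [_ gy _ ann]]]] := path_module_syzygy ct ml.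
apply: projective_of_syzygy_zero sK _ => x; have [b ->] := gy x.
rewrite big1 // => p _; rewrite -[y p]scale1r ann ?inE ?scaler0 //.
case: ifP => // /reach_word h; case/negP: nh.
by apply/existsP; exists (word_end v p).
Qed.

(** For a path p from [u] to [x], the left ideal generated by p is the syzygy
    of its cokernel in [B e u], and a path module at [x]. *)
Lemma path_module_as_syzygy u x j : reach src tgt j u x -> (0 < j < l)%N ->
  exists N K (y : K), [/\ fin_gen N, is_syzygy N K & path_module y x (l - j)].
Proof.
move=> hux /andP[j0 jl]; have [q [eq qe hq nq]] := path_elt hux jl.
have [P [g [[fg pr] eg gen rel ng]]] := exists_vproj1 u.
have fP : path_free P := path_free_projective fg pr.
pose S : submodule P := gen_submodule [set tt] (fun _ => q *: g : P).
have SE z : S z <-> exists b : B, z = b *: (q *: g).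
  split=> [[b ->]|[b ->]]; first by exists (b tt); rewrite big_set1.
  by exists (fun _ => b); rewrite big_set1.
have [N [p [ps pP]]] := exists_quotient S.
have [K [i [ii iP]]] := exists_sub S.
have hqg : Fil j (q *: g) by apply: fil_Zl.
have nqg : ~ Fil j.+1 (q *: g).
  by move=> h; apply: nq; rewrite -qe; apply: (fil_cancel (r := 0) fP I ng eg jl).
have eqg : e x *: (q *: g) = q *: g by rewrite scalerA eq.
have sK : is_syzygy N K.
  exists P, p, i; split=> //; last by move=> z; rewrite pP; apply: iP.
  apply: (projective_coverI) => // z /pP/SE[b ->].
  by apply: fil_Z; apply: fil_le hqg.
have [y yE] : exists y, i y = q *: g by apply/iP/SE; exists 1; rewrite scale1r.
exists N, K, y; split=> //; first exact: fin_gen_surj ps fg.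
split.
- by apply: ii; rewrite linearZ /= yE.
- move=> z; have /iP/SE[b bE] : exists y, i y = i z by exists z.
  by exists b; apply: ii; rewrite bE linearZ /= yE.
move=> b; split=> [b0|hb].
  apply: (fil_cancel fP hqg nqg eqg); first by rewrite subnKC // ltnW.
  by rewrite -yE -linearZ_LR b0 linear0; apply: fil_0.
apply: ii; rewrite linear0 linearZ /= yE -eqg scalerA.
by apply: (fil_ge_nil (r := (l - j + j)%N)); [rewrite subnK // ltnW | apply: fil_M].
Qed.

(** Cut off the last piece of the path: the path module at the point reached
    before it is a high syzygy by induction, and the last piece exhibits the
    given path module as a summand of the syzygy of that one. *)
Lemma path_module_nth_syzygy n x m M (t : M) : (0 < n)%N -> (0 < m < l)%N ->
  has_path_in src tgt (alt l n (l - m)) x -> path_module t x m ->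
  exists N K', fin_gen N /\ nth_syzygy N n (M * K')%type.
Proof.
case: n => // n _; elim: n x m M t => [|n IH] x m M t ml hx ct.
  have [Z Z0] := exists_zero_module B.
  move: hx; rewrite /= addn0 => /existsP[u hux].
  have jl : (0 < l - m < l)%N by lia.
  have [N [K [y [fgN sK cy]]]] := path_module_as_syzygy hux jl.
  have lm : (l - (l - m) = m)%N by lia.
  rewrite lm in cy; exists N, Z; split=> //.
  apply: nth_syzygyS (nth_syzygy0 N) _.
  apply: is_syzygy_iso (iso_refl N) _ sK.
  exact: iso_trans (path_module_iso cy ct) (iso_sym (iso_prod0 M Z0)).
have lm : (l - (l - m) = m)%N by lia.
have jl : (0 < l - m < l)%N by lia.
have /existsP[u] := hx.
rewrite [alt _ _ _]/= -/(alt l n.+1 (l - (l - m))).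
move=> /reach_split[x' ux' x'x].
have [M' [t' ct']] := exists_path_module x' (l - m).
have hx' : has_path_in src tgt (alt l n.+1 (l - (l - m))) x' by apply/existsP; exists u.
have [N [K' [fgN hN]]] := IH _ _ _ _ jl hx' ct'.
have [K1 [y [sK1 bK1]]] := path_module_syzygy ct' jl.
have [p [hp px]] := word_of_reach x'x.
have [T1 [K2 [y1 [_ [iK1 cy1 _]]]]] := path_basis_split bK1 (in_setT p).
move: cy1; rewrite hp px lm => cy1.
have fgK' : fin_gen K'.
  have [f fE] := lin_snd M' K'.
  apply: (fin_gen_surj (f := f)); last exact: (nth_syzygy_fin_gen fgN hN).
  by move=> z; exists (0, z); rewrite fE.
have [K'1 sK'1] := exists_syzygy fgK'.
exists N, (K2 * K'1)%type; split=> //.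
apply: nth_syzygyS hN _.
apply: is_syzygy_iso (iso_refl _) _ (is_syzygy_prod sK1 sK'1).
apply: iso_trans (iso_prod (iso_sym iK1) (iso_refl K'1)) _.
apply: iso_trans (iso_sym (iso_prodA _ _ _)) _.
exact: iso_prod (path_module_iso cy1 ct) (iso_refl _).
Qed.

(** A summand of an n-th syzygy up to projective modules, in a form that is
    visibly closed under products. *)
Definition syzygy_summand n K := exists N L L' P,
  [/\ fin_gen N, nth_syzygy N n L, fin_gen P, projective P
    & iso (K * L')%type (L * P)%type].

Lemma syzygy_summand_iso n K K' : iso K K' -> syzygy_summand n K -> syzygy_summand n K'.
Proof.
move=> iK [N [L [L' [P [h1 h2 h3 h4 h5]]]]]; exists N, L, L', P; split=> //.
exact: iso_trans (iso_prod (iso_sym iK) (iso_refl L')) h5.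
Qed.

Lemma syzygy_summand_prod n K K' :
  syzygy_summand n K -> syzygy_summand n K' -> syzygy_summand n (K * K')%type.
Proof.
move=> [N [L [L' [P [h1 h2 h3 h4 h5]]]]] [N2 [L2 [L2' [P2 [g1 g2 g3 g4 g5]]]]].
exists (N * N2)%type, (L * L2)%type, (L' * L2')%type, (P * P2)%type; split.
- exact: fin_gen_prod h1 g1.
- exact: (nth_syzygy_prod h2 g2).
- exact: fin_gen_prod h3 g3.
- exact: projective_prod h4 g4.
apply: iso_trans (iso_prodACA _ _ _ _) _.
exact: iso_trans (iso_prod h5 g5) (iso_prodACA _ _ _ _).
Qed.

Lemma syzygy_summand_projective n P : fin_gen P -> projective P -> syzygy_summand n P.
Proof.
move=> fg pr; have [Z Z0] := exists_zero_module B.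
have fgZ : fin_gen Z by apply: fin_gen_zero.
have [L hL] := exists_nth_syzygy n fgZ.
exists Z, L, L, P; split=> //; exact: iso_prodC.
Qed.

Lemma syzygy_summand_zero n Z : zero_module Z -> syzygy_summand n Z.
Proof.
by move=> Z0; apply: syzygy_summand_projective; [apply: fin_gen_zero | apply: projective_zero].
Qed.

Lemma syzygy_summand_fst n N K K' :
  fin_gen N -> nth_syzygy N n (K * K')%type -> syzygy_summand n K.
Proof.
move=> fg h; have [Z Z0] := exists_zero_module B.
exists N, (K * K')%type, K', Z; split=> //.
- exact: fin_gen_zero.
- exact: projective_zero.
- exact: iso_sym (iso_prod0 _ Z0).
Qed.

Lemma stable_summand_of_syzygy_summand n K : syzygy_summand n K ->
  exists N L, [/\ fin_gen N, nth_syzygy N n L & stable_summand K L].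
Proof.
move=> [N [L [L' [P [h1 h2 h3 h4 h5]]]]]; exists N, L; split=> //.
exact: (stable_summand_iso h5 (nth_syzygy_fin_gen h1 h2) h3 h4).
Qed.

(** Inherits the closure properties of [F], so that it can be checked on the
    summands of a decomposition. *)
Definition syzygy_class n (F : rmodType A -> Prop) K :=
  exists X, nth_syzygy K n X /\ F X.

Lemma syzygy_class_of_basis n (F : rmodType A -> Prop) :
  (forall M, zero_module M -> F M) -> (forall M N, iso M N -> F M -> F N) ->
  (forall M N, F M -> F N -> F (M * N)%type) ->
  forall (I : finType) (X : {set I}) M (y : I -> M) (w : I -> V) (m : I -> nat),
    path_basis X y w m ->
    (forall i N (t : N), i \in X -> path_module t (w i) (m i) -> syzygy_class n F N) ->
    syzygy_class n F M.
Proof.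
move=> F0 Fi Fp; apply: path_basis_class.
- move=> M M0; have [X hX] := exists_nth_syzygy n (fin_gen_zero M0).
  by exists X; split=> //; apply: F0; apply: nth_syzygy_zero M0 hX.
- move=> M N iMN [X [hX FX]]; have [X' [iX hX']] := nth_syzygy_iso iMN hX.
  by exists X'; split=> //; apply: Fi iX FX.
- move=> M N [X [hX FX]] [Y [hY FY]]; exists (X * Y)%type; split; last exact: Fp.
  exact: (nth_syzygy_prod hX hY).
Qed.

Lemma syzygy_class_zero n (F : rmodType A -> Prop) M :
  (forall M, zero_module M -> F M) -> zero_module M -> syzygy_class n F M.
Proof.
move=> F0 M0; have [X hX] := exists_nth_syzygy n (fin_gen_zero M0).
by exists X; split=> //; apply: F0; apply: nth_syzygy_zero M0 hX.
Qed.

(** Each summand of a syzygy comes with a longer path into its vertex, so that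
    after [n] steps every summand is a [d]-th syzygy; the hypothesis then
    improves [d] to [d.+1] for the summands that are not projective. *)
Lemma path_module_syzygy_summand d s n v m M (t : M) :
  (forall x m', (0 < m' < l)%N -> has_path_in src tgt (alt l d (l - m')) x ->
     has_path_out src tgt m' x -> has_path_in src tgt (alt l d.+1 (l - m')) x) ->
  (s + n)%N = d -> path_module t v m -> (0 < m < l)%N ->
  has_path_in src tgt (alt l s (l - m)) v ->
  syzygy_class n (syzygy_summand d.+1) M.
Proof.
move=> hd; elim: n s v m M t => [|n IH] s v m M t snd ct ml hv.
  move: snd; rewrite addn0 => sd; rewrite sd in hv.
  exists M; split; first exact: nth_syzygy0.
  case: (boolP (has_path_out src tgt m v)) => hm; last first.
    apply: syzygy_summand_projective; first exact: fin_gen_path_module ct.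
    exact: path_module_projective ct ml hm.
  have [N [K' [fg h]]] := path_module_nth_syzygy (ltn0Sn d) ml (hd _ _ ml hv hm) ct.
  exact: syzygy_summand_fst fg h.
have [K [y [sK bK]]] := path_module_syzygy ct ml.
suff [X [hX FX]] : syzygy_class n (syzygy_summand d.+1) K.
  by exists X; split=> //; apply: nth_syzygy_front sK hX.
apply: syzygy_class_of_basis bK _.
- exact: syzygy_summand_zero.
- exact: syzygy_summand_iso.
- exact: syzygy_summand_prod.
move=> p N z _; case: ifP => [hp cz|_ /path_module0_zero N0]; last first.
  by apply: syzygy_class_zero N0; apply: syzygy_summand_zero.
apply: (IH s.+1 (word_end v p) (l - m)%N _ z _ cz).
- by rewrite addSnnS.
- by lia.
rewrite /= subKn; last by case/andP: ml => _ /ltnW.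
exact: has_path_in_cat hv (reach_word hp).
Qed.

(** The first syzygy decomposes into path modules, to each of which
    [path_module_syzygy_summand] applies. *)
Lemma delooping_bound d M : (0 < d)%N -> fin_gen M ->
  (forall x m', (0 < m' < l)%N -> has_path_in src tgt (alt l d (l - m')) x ->
     has_path_out src tgt m' x -> has_path_in src tgt (alt l d.+1 (l - m')) x) ->
  exists K N L, [/\ fin_gen N, nth_syzygy M d K, nth_syzygy N d.+1 L
    & stable_summand K L].
Proof.
case: d => // d _ fg hd; have [K sK] := exists_syzygy fg.
have [I [y [w [m [bK hm]]]]] := syzygy_path_basis sK.
have [X [hX FX]] : syzygy_class d (syzygy_summand d.+2) K.
  apply: syzygy_class_of_basis bK _.
  - exact: syzygy_summand_zero.
  - exact: syzygy_summand_iso.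
  - exact: syzygy_summand_prod.
  move=> i N t _; case: (hm i) => [->|[ml hi]].
    by move=> /path_module0_zero N0; apply: syzygy_class_zero N0; apply: syzygy_summand_zero.
  move=> ct; apply: (path_module_syzygy_summand (s := 1) hd _ ct ml); first by rewrite add1n.
  by rewrite /= addn0.
have [N [L [fgN hL KL]]] := stable_summand_of_syzygy_summand FX.
by exists X, N, L; split=> //; apply: nth_syzygy_front sK hX.
Qed.

(** * Projective dimensions of path modules *)

Definition fg_projective K := fin_gen K /\ projective K.

(** Each syzygy shortens the available paths, until the path modules obtained
    are projective. *)
Lemma path_module_finite_resolution n v m M (t : M) : path_module t v m -> (0 < m < l)%N ->
  ~~ has_path_out src tgt (alt l n.+1 m) v -> syzygy_class n fg_projective M.
Proof.
elim: n v m M t => [|n IH] v m M t ct ml nh.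
  exists M; split; first exact: nth_syzygy0.
  split; first exact: fin_gen_path_module ct.
  by apply: path_module_projective ct ml _; move: nh; rewrite /= addn0.
have [K [y [sK bK]]] := path_module_syzygy ct ml.
have F0 (Z : rmodType A) : zero_module Z -> fg_projective Z.
  by move=> Z0; split; [apply: fin_gen_zero | apply: projective_zero].
suff [X [hX FX]] : syzygy_class n fg_projective K.
  by exists X; split=> //; apply: nth_syzygy_front sK hX.
apply: syzygy_class_of_basis bK _ => //.
- by move=> X Y iXY [fg pr]; split; [apply: fin_gen_iso iXY fg | apply: projective_iso iXY pr].
- by move=> X Y [fg pr] [fg' pr']; split; [apply: fin_gen_prod | apply: projective_prod].
move=> p N z _; case: ifP => [hp cz|_ /path_module0_zero N0]; last exact: syzygy_class_zero N0.
apply: IH cz _ _; first by lia.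
apply: contra nh => h; rewrite [alt _ _ _]/= -/(alt l n.+1 (l - m)) addnC.
exact: has_path_out_cat (reach_word hp) h.
Qed.

(** The path of length l - j into [x] makes the path module of length [j] at
    [x] the syzygy of some N; the two conditions on paths out of [x] bound the
    projective dimension from above and from below. *)
Lemma exists_proj_dim d x j : (0 < j < l)%N -> (0 < d)%N ->
  has_path_out src tgt (alt l d j) x -> ~~ has_path_out src tgt (alt l d.+1 j) x ->
  has_path_in src tgt (l - j) x ->
  exists N, [/\ fin_gen N, has_proj_resolution N d.+1 & ~ has_proj_resolution N d].
Proof.
move=> jl; case: d => // d _ hx nx /existsP[u hu].
have jl' : (0 < l - j < l)%N by lia.
have [N [K [y [fg sK cy]]]] := path_module_as_syzygy hu jl'.
have lj : (l - (l - j) = j)%N by lia.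
rewrite lj in cy; exists N; split=> //.
  have [X [hX [fgX prX]]] := path_module_finite_resolution cy jl nx.
  exact: has_proj_resolution_syzygy (nth_syzygy_front sK hX) fgX prX.
move=> res; have fgK := is_syzygy_fin_gen sK.
have [X hX] := exists_nth_syzygy d fgK.
have prX := projective_nth_syzygy res (nth_syzygy_front sK hX).
have fgX := nth_syzygy_fin_gen fgK hX.
have ty : path_generator y x j by apply: path_module_generator cy; case/andP: jl.
by case/negP: (path_generator_no_path_out sK hX fgX prX ty jl).
Qed.


End Truncated.

(** * Coefficients and powers of the arrow ideal in a path algebra *)

Definition rmorphism_pack (R S : pzRingType) (f : R -> S) (fD : zmod_morphism f)
    (fM : monoid_morphism f) : {rmorphism R -> S} :=
  HB.pack f (GRing.isZmodMorphism.Build R S f fD)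
    (GRing.isMonoidMorphism.Build R S f fM).

Section PathAlgebraOrder.
Variables (k : fieldType) (Q : quiver).
Local Notation R := (pathalg k Q).
Local Notation U p := (<< p >> : pathalg k Q).
Implicit Types (x y z : R) (p q r : qpath Q) (c d : k).

Definition plen p := size (val p).2.

Definition vanishes n x := forall p, (plen p < n)%N -> x@_p = 0.

Lemma vanishes0 n : vanishes n 0.
Proof. by move=> p _; apply: mcoeff0. Qed.

Lemma vanishesD n x y : vanishes n x -> vanishes n y -> vanishes n (x + y).
Proof. by move=> hx hy p pn; rewrite mcoeffD hx // hy // addr0. Qed.

Lemma vanishesN n x : vanishes n x -> vanishes n (- x).
Proof. by move=> hx p pn; rewrite mcoeffN hx // oppr0. Qed.

Lemma vanishes_sum n (I : Type) (s : seq I) (P : pred I) (F : I -> R) :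
  (forall i, P i -> vanishes n (F i)) -> vanishes n (\sum_(i <- s | P i) F i).
Proof. by move=> h; apply: big_ind => //; [apply: vanishes0 | apply: vanishesD]. Qed.

Lemma mcoeff_bigsum (I : Type) (s : seq I) (P : pred I) (F : I -> R) p :
  (\sum_(i <- s | P i) F i)@_p = \sum_(i <- s | P i) (F i)@_p.
Proof.
by apply: (big_morph (fun x : R => x@_p)); [move=> x y; apply: mcoeffD | apply: mcoeff0].
Qed.

Lemma coefZU c q p : (c *: (U q))@_p = if q == p then c else 0.
Proof. by rewrite mcoeffZ mcoeffU; case: eqP; rewrite ?mulr1 ?mulr0. Qed.

Lemma vanishesU n c p : (n <= plen p)%N -> vanishes n (<< c *g p >> : R).
Proof.
move=> np q qn; rewrite mcoeffU; case: eqP => // e.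
by rewrite -e ltnNge np in qn.
Qed.

Lemma path_cat_len p q r : path_cat p q = Some r -> plen r = (plen p + plen q)%N.
Proof.
by case: path_catP => // r' _ er [<-]; rewrite /plen er size_cat.
Qed.

Lemma vanishesM m n x y : vanishes m x -> vanishes n y -> vanishes (m + n) (x * y).
Proof.
move=> hx hy; have -> : x * y = pathalg_mul x y by [].
apply: vanishes_sum => p _; apply: vanishes_sum => q _.
rewrite /scaled_cat; case e: path_cat => [r|]; last exact: vanishes0.
case: (ltnP (plen p) m) => pm; first by rewrite hx // mul0r monalgU0; apply: vanishes0.
case: (ltnP (plen q) n) => qn; first by rewrite hy // mulr0 monalgU0; apply: vanishes0.
by apply: vanishesU; rewrite (path_cat_len e) leq_add.
Qed.

Lemma path_front p : (0 < plen p)%N ->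
  exists a q, path_cat (arrow_path a) q = Some p /\ plen p = (plen q).+1.
Proof.
case: p => [[v [|a s]] h] // _.
have /andP[/eqP av hs] := h.
exists a, (@QPath Q (target a, s) hs); split=> //.
case: path_catP => [r _ er|]; last by [].
by congr Some; apply: val_inj; rewrite er /path_src /= av.
Qed.

Lemma path_back p : (0 < plen p)%N ->
  exists a q, path_cat q (arrow_path a) = Some p /\ plen p = (plen q).+1.
Proof.
case: p => [[v s] h]; case/lastP: s h => // s a h _.
have : is_qpath v (s ++ [:: a]) by rewrite cats1.
rewrite is_qpath_cat => /andP[hs /=]; rewrite andbT => /eqP e.
exists a, (@QPath Q (v, s) hs); split; last by rewrite /plen /= size_rcons.
case: path_catP => [r _ er|n]; last by case: n; rewrite /path_tgt /path_src /= e.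
by congr Some; apply: val_inj; rewrite er /path_src /= cats1.
Qed.

Lemma mulUx (x : R) p : (U p) * x = \sum_(q <- msupp x) scaled_cat (x@_q) p q.
Proof.
have -> : (U p) * x = pathalg_mul (U p) x by [].
rewrite (pathalg_mulw msuppU_le (fsubset_refl _)) big_seq_fset1.
by apply: eq_bigr => q _; rewrite mcoeffUU mul1r.
Qed.

Lemma mulxU (x : R) p : x * (U p) = \sum_(q <- msupp x) scaled_cat (x@_q) q p.
Proof.
have -> : x * (U p) = pathalg_mul x (U p) by [].
rewrite (pathalg_mulw (fsubset_refl _) msuppU_le).
by apply: eq_bigr => q _; rewrite big_seq_fset1 mcoeffUU mulr1.
Qed.

(** Sums over the support of [x] in which only the term of one path [p] can
    contribute, whether or not [p] is in the support. *)
Lemma coef_sum_supp (x : R) (F : qpath Q -> R) r p (b : bool) :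
  (F p)@_r = (if b then x@_p else 0) ->
  (forall q, q != p -> (F q)@_r = 0) -> (x@_p = 0 -> F p = 0) ->
  (\sum_(q <- msupp x) F q)@_r = if b then x@_p else 0.
Proof.
move=> hp hq h0; rewrite mcoeff_bigsum; case: (boolP (p \in msupp x)) => px.
  by rewrite (big_fsetD1 p) //= hp big_seq big1 ?addr0 // => q /fsetD1P[qp _]; apply: hq.
rewrite big_seq big1 => [|q qx].
  by rewrite (mcoeff_outdom px); case: b {hp}.
by apply: hq; apply: contraNneq px => <-.
Qed.

Lemma coef_scaled_cat c p q r :
  (scaled_cat c p q : R)@_r = if path_cat p q == Some r then c else 0.
Proof.
rewrite /scaled_cat; case: path_cat => [s|]; last by rewrite mcoeff0.
by rewrite mcoeffU (inj_eq (@Some_inj _)); case: eqP.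
Qed.

Lemma arrow_front_inj a b p q r :
  path_cat (arrow_path a) p = Some r -> path_cat (arrow_path b) q = Some r ->
  a = b /\ p = q.
Proof.
case: path_catP => // r1 e1 v1 [rr1]; case: path_catP => // r2 e2 v2 [rr2].
move: v1 v2; rewrite rr1 rr2 => ->; rewrite /path_src /= => -[_ ab pq].
split=> //; apply: val_inj; rewrite [LHS]surjective_pairing [RHS]surjective_pairing.
congr pair; last exact: pq.
by move: e1 e2; rewrite /path_tgt /path_src /= ab => <- <-.
Qed.

Lemma arrow_back_inj a b p q r :
  path_cat p (arrow_path a) = Some r -> path_cat q (arrow_path b) = Some r ->
  a = b /\ p = q.
Proof.
case: path_catP => // r1 e1 v1 [rr1]; case: path_catP => // r2 e2 v2 [rr2].
move: v1 v2; rewrite rr1 rr2 => ->; rewrite /path_src /= !cats1 => -[s1 s2].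
have [s3 ab] := rcons_inj s2; split=> //; apply: val_inj.
by rewrite [LHS]surjective_pairing [RHS]surjective_pairing; congr pair.
Qed.

Lemma coef_arrow_mul (x : R) a b p r : path_cat (arrow_path a) p = Some r ->
  ((U (arrow_path b)) * x)@_r = if b == a then x@_p else 0.
Proof.
move=> e; rewrite mulUx; apply: coef_sum_supp.
- rewrite coef_scaled_cat; case: (eqVneq b a) => [->|ba]; first by rewrite e eqxx.
  by case: eqP => // e'; have [ab _] := arrow_front_inj e e'; rewrite ab eqxx in ba.
- move=> q qp; rewrite coef_scaled_cat; case: eqP => // e'.
  by have [_ pq] := arrow_front_inj e e'; rewrite pq eqxx in qp.
- by move=> ->; rewrite scaled_cat0.
Qed.

Lemma coef_mul_arrow (x : R) a b p r : path_cat p (arrow_path a) = Some r ->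
  (x * (U (arrow_path b)))@_r = if b == a then x@_p else 0.
Proof.
move=> e; rewrite mulxU; apply: coef_sum_supp.
- rewrite coef_scaled_cat; case: (eqVneq b a) => [->|ba]; first by rewrite e eqxx.
  by case: eqP => // e'; have [ab _] := arrow_back_inj e e'; rewrite ab eqxx in ba.
- move=> q qp; rewrite coef_scaled_cat; case: eqP => // e'.
  by have [_ pq] := arrow_back_inj e e'; rewrite pq eqxx in qp.
- by move=> ->; rewrite scaled_cat0.
Qed.

Lemma coef_vertex_mul (x : R) v p :
  ((U (trivial_path v)) * x)@_p = if v == path_src p then x@_p else 0.
Proof.
rewrite mulUx; apply: coef_sum_supp.
- by rewrite coef_scaled_cat path_cat1p; case: (v == _); rewrite ?eqxx.
- move=> q qp; rewrite coef_scaled_cat path_cat1p; case: (v == _) => //.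
  by rewrite (inj_eq (@Some_inj _)) (negPf qp).
- by move=> ->; rewrite scaled_cat0.
Qed.

Lemma coef_mul_vertex (x : R) v p :
  (x * (U (trivial_path v)))@_p = if v == path_tgt p then x@_p else 0.
Proof.
rewrite mulxU; apply: coef_sum_supp.
- by rewrite coef_scaled_cat path_catp1; case: (v == _); rewrite ?eqxx.
- move=> q qp; rewrite coef_scaled_cat path_catp1; case: (v == _) => //.
  by rewrite (inj_eq (@Some_inj _)) (negPf qp).
- by move=> ->; rewrite scaled_cat0.
Qed.

Lemma mulUU c d p q : (<< c *g p >> : R) * (<< d *g q >> : R) = scaled_cat (c * d) p q :> R.
Proof. exact: pathalg_mulUU. Qed.

Definition vanishing_ideal (n : nat) : ideal R.
Proof.
exists (vanishes n); first exact: vanishes0.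
- by move=> x y hx hy; apply: vanishesD => //; apply: vanishesN.
- by move=> a x hx; rewrite -[n]add0n; apply: vanishesM.
- by move=> a x hx; rewrite -[n]addn0; apply: vanishesM.
Defined.

Lemma ideal_sum (I : ideal R) (J : Type) (s : seq J) (P : pred J) (F : J -> R) :
  (forall i, P i -> I (F i)) -> I (\sum_(i <- s | P i) F i).
Proof. by move=> h; apply: big_ind => //; [apply: ideal0 | apply: idealD]. Qed.

(** Lengths add up in products, and conversely a path of length at least [n]
    splits off [n] arrows at its beginning. *)
Lemma arrow_ideal_powP n x : ideal_pow (arrow_ideal k Q) n x <-> vanishes n x.
Proof.
split.
  elim: n x => [//|n IH] _ [s [hs ->]].
  have -> : \sum_(u <- s) u.1 * u.2 = \sum_(u <- s | u \in s) u.1 * u.2.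
    by rewrite -big_seq.
  apply: vanishes_sum => u /hs[u1 /IH u2]; rewrite -add1n; apply: vanishesM => //.
  apply: (u1 (vanishing_ideal 1)) => _ [a ->]; exact: vanishesU.
move=> hx; rewrite [x]monalgE; apply: ideal_sum => p _.
case: (ltnP (plen p) n) => pn; first by rewrite hx // monalgU0; apply: ideal0.
move: (x@_p) => c; elim: n p pn {hx} => [//|n IH] p pn.
have [a [q [e lq]]] := path_front (leq_ltn_trans (leq0n n) pn).
exists [:: ((U (arrow_path a)), (<< c *g q >> : R))]; split.
  move=> u; rewrite inE => /eqP-> /=; split; last by apply: IH; rewrite -ltnS -lq.
  by move=> I; apply; exists a.
by rewrite big_seq1 /= mulUU /scaled_cat e mul1r.
Qed.

End PathAlgebraOrder.

Arguments plen {Q}.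

(** * Truncated path algebras are truncated path rings on both sides *)

Section Instance.
Variables (k : fieldType) (Q : quiver) (l : nat) (beta : bool).
Hypothesis l_gt1 : (1 < l)%N.
Local Notation R := (pathalg k Q).
Local Notation U p := (<< p >> : pathalg k Q).
Variables (B : pzRingType) (pi : {additive R -> B}).
(** Both one-sided structures are treated at once: [beta] tells whether arrows
    act by multiplication on the left or on the right in the path algebra. *)
Definition side (x y : R) : R := if beta then x * y else y * x.
Hypothesis pi_surj : forall b, exists x, pi x = b.
Hypothesis pi_ker : forall x, pi x = 0 <-> vanishes l x.
Hypothesis piM : forall x y, pi (side x y) = pi x * pi y.
Hypothesis pi1 : pi 1 = 1.

Let src := if beta then @target Q else @source Q.
Let tgt := if beta then @source Q else @target Q.
Let ar (a : arrow Q) : B := pi (U (arrow_path a)).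
Let e (v : vertex Q) : B := pi (U (trivial_path v)).

Lemma side_vanishes m n x y : vanishes m x -> vanishes n y -> vanishes (m + n) (side x y).
Proof.
rewrite /side; case: beta => hx hy; first exact: vanishesM.
by rewrite addnC; apply: vanishesM.
Qed.

Lemma side_path (p : qpath Q) : (0 < plen p)%N -> exists a q,
  plen p = (plen q).+1 /\
  forall c : k, side (U (arrow_path a)) (<< c *g q >> : R) = (<< c *g p >> : R).
Proof.
move=> hp; rewrite /side; case: beta.
  have [a [q [eq lq]]] := path_front hp; exists a, q; split=> // c.
  by rewrite mulUU /scaled_cat eq mul1r.
have [a [q [eq lq]]] := path_back hp; exists a, q; split=> // c.
by rewrite mulUU /scaled_cat eq mulr1.
Qed.

Lemma side_coef (z : arrow Q -> R) a p :
  (forall b, side (U (trivial_path (src b))) (z b) = z b) ->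
  (z a)@_p = 0 \/ exists r, plen r = (plen p).+1 /\
    (\sum_b side (U (arrow_path b)) (z b))@_r = (z a)@_p.
Proof.
rewrite /src /side; case: beta => ez.
  case: (eqVneq (target a) (path_src p)) => ap; last first.
    by left; rewrite -ez coef_vertex_mul (negPf ap).
  right; case eq: (path_cat (arrow_path a) p) => [r|]; last first.
    by move: eq; case: path_catP => //; rewrite {1}/path_tgt /= ap.
  exists r; split; first by rewrite (path_cat_len eq).
  rewrite mcoeff_bigsum (eq_bigr _ (fun b _ => coef_arrow_mul (z b) b eq)).
  rewrite (bigD1 a) // eqxx big1 /= ?addr0 // => b /negPf ba; by rewrite ba.
case: (eqVneq (source a) (path_tgt p)) => ap; last first.
  by left; rewrite -ez coef_mul_vertex (negPf ap).
right; case eq: (path_cat p (arrow_path a)) => [r|]; last first.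
  by move: eq; case: path_catP => //; rewrite /path_src /= ap.
exists r; split; first by rewrite (path_cat_len eq) addn1.
rewrite mcoeff_bigsum (eq_bigr _ (fun b _ => coef_mul_arrow (z b) b eq)).
rewrite (bigD1 a) // eqxx big1 /= ?addr0 // => b /negPf ba; by rewrite ba.
Qed.

Lemma pi_eq x y : pi x = pi y -> vanishes l (x - y).
Proof. by move=> exy; apply/pi_ker; rewrite raddfB /= exy subrr. Qed.

Lemma vanishes_le m n (x : R) : (m <= n)%N -> vanishes n x -> vanishes m x.
Proof. by move=> mn hx p pm; apply: hx; apply: leq_trans pm mn. Qed.

(** Every path of positive length splits off an arrow on either side.  Beyond
    degree [l] the right-hand side depends on the representative [x]. *)
Lemma fil_vanishes s x : (s <= l)%N -> fil ar s (pi x : B^o) <-> vanishes s x.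
Proof.
elim: s x => [|s IH] x sl; first by [].
split.
  move=> [z [hz xE]].
  have /choice[y yE] : forall a, exists y, pi y = z a by move=> a; apply: pi_surj.
  have hy a : vanishes s (y a) by apply/(IH _ (ltnW sl)); rewrite yE; apply: hz.
  pose t := \sum_a side (U (arrow_path a)) (y a).
  rewrite -[x](subrK t); apply: vanishesD.
    apply: vanishes_le sl _; apply: pi_eq.
    by rewrite xE raddf_sum; apply: eq_bigr => a _; rewrite piM yE.
  apply: vanishes_sum => a _; rewrite -add1n; apply: side_vanishes; last exact: hy.
  exact: vanishesU.
move=> hx; rewrite [x]monalgE raddf_sum; apply: fil_sum => p _.
case: (ltnP (plen p) s.+1) => ps.
  by rewrite hx // monalgU0 raddf0; apply: fil_0.
have [a [q [pq eq]]] := side_path (leq_ltn_trans (leq0n s) ps).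
rewrite -eq piM; exists (fun b => if b == a then pi (<< x@_p *g q >> : R) else 0); split.
  move=> b; case: eqP => _; last exact: fil_0.
  by apply/(IH _ (ltnW sl)); apply: vanishesU; rewrite -ltnS -pq.
rewrite (bigD1 a) //= eqxx big1 ?addr0 // => b /negPf->; exact: scaler0.
Qed.

Lemma pathalg_truncated_path_ring : inhabited (truncated_path_ring k src tgt l B).
Proof.
have l0 : (0 < l)%N := ltnW l_gt1.
have sideZ c (x : R) : side (c *: (1 : R)) x = c *: x :> R.
  by rewrite /side; case: beta; rewrite -?pathalg_scaleAl -?pathalg_scaleAr ?mul1r ?mulr1.
have sideZr c (x : R) : side x (c *: (1 : R)) = c *: x :> R.
  by rewrite /side; case: beta; rewrite -?pathalg_scaleAl -?pathalg_scaleAr ?mul1r ?mulr1.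
pose scf (c : k) : B := pi (c *: (1 : R)).
have scD : zmod_morphism scf by move=> c d; rewrite /scf scalerBl raddfB.
have scM : monoid_morphism scf.
  split; first by rewrite /scf scale1r pi1.
  by move=> c d; rewrite /scf -piM sideZ scalerA.
have [sc scE] : exists sc : {rmorphism k -> B}, forall c, sc c = scf c.
  by exists (rmorphism_pack scD scM).
have sce c v : sc c * e v = pi (c *: (U (trivial_path v))).
  by rewrite scE -(sideZ c (U (trivial_path v))) piM.
constructor; apply: (@TruncatedPathRing k _ _ src tgt l B sc e ar).
- move=> c b; have [x <-] := pi_surj b.
  by rewrite scE /scf -!piM sideZ sideZr.
- move=> v w; rewrite /e -piM /side.
  have -> : (if beta then (U (trivial_path v)) * (U (trivial_path w))
      else (U (trivial_path w)) * (U (trivial_path v))) =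
      if v == w then (U (trivial_path v)) else 0 :> R.
    have srcT u : path_src (@trivial_path Q u) = u by [].
    case: beta; rewrite mulUU mulr1 /scaled_cat path_cat1p srcT.
      by case: eqP => [->|].
    by rewrite eq_sym; case: eqP.
  by case: ifP => // _; rewrite raddf0.
- rewrite -pi1 -raddf_sum; congr (pi _).
- move=> a; rewrite /e /ar -piM; congr (pi _); rewrite /tgt /side; case: beta.
    by rewrite mulUU mulr1 /scaled_cat path_cat1p /= eqxx.
  by rewrite mulUU mulr1 /scaled_cat path_catp1 /= eqxx.
- move=> a; rewrite /e /ar -piM; congr (pi _); rewrite /src /side; case: beta.
    by rewrite mulUU mulr1 /scaled_cat path_catp1 /= eqxx.
  by rewrite mulUU mulr1 /scaled_cat path_cat1p /= eqxx.
- move=> b; have [x <-] := pi_surj b.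
  pose t := \sum_v x@_(trivial_path v) *: (U (trivial_path v)).
  have ht : vanishes 1 (x - t).
    move=> p; rewrite /plen ltnS leqn0 => /nilP p0.
    have pE : p = trivial_path (path_src p).
      by apply: val_inj; rewrite [LHS]surjective_pairing; congr pair; exact: p0.
    rewrite mcoeffB; apply/eqP; rewrite subr_eq0; apply/eqP.
    rewrite /t mcoeff_bigsum (eq_bigr _ (fun v _ => coefZU _ (trivial_path v) p)).
    rewrite (bigD1 (path_src p)) // -pE eqxx big1 /= ?addr0 // => v vp.
    by case: eqP => // vE; rewrite -vE eqxx in vp.
  have [z [_ zE]] := (fil_vanishes _ l0).2 ht.
  exists (fun v => x@_(trivial_path v)), z.
  have -> : pi x = pi t + pi (x - t) by rewrite -raddfD addrC subrK.
  rewrite [pi (x - t)]zE; congr (_ + _).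
  by rewrite /t raddf_sum; apply: eq_bigr => v _; rewrite sce.
- move=> c v; rewrite sce => /(fil_vanishes _ l0)/(_ (trivial_path v) isT).
  by rewrite coefZU eqxx.
- move=> b; have [x <-] := pi_surj b => /(fil_vanishes _ (leqnn l)).
  by move/pi_ker.
- move=> s z sl ez hs a.
  have /choice[y yE] : forall b, exists y, pi y = z b by move=> b; apply: pi_surj.
  pose y' b := side (U (trivial_path (src b))) (y b).
  have y'E b : pi (y' b) = z b by rewrite /y' piM yE; apply: ez.
  have ey' b : side (U (trivial_path (src b))) (y' b) = y' b.
    rewrite /y' /side; case: beta.
      by rewrite mulrA mulUU mulr1 /scaled_cat path_cat1p eqxx.
    by rewrite -mulrA mulUU mulr1 /scaled_cat path_cat1p eqxx.
  rewrite -y'E; apply/(fil_vanishes _ (ltnW sl)) => p ps.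
  have hv : vanishes s.+1 (\sum_b side (U (arrow_path b)) (y' b)).
    apply/(fil_vanishes _ sl); rewrite raddf_sum.
    by under eq_bigr do rewrite piM y'E.
  have [//|[r [rp <-]]] := side_coef a p ey'.
  by apply: hv; rewrite rp ltnS.
Qed.

End Instance.

Section TruncatedPathAlgebra.
Variables (k : fieldType) (Q : quiver) (l : nat).
Hypothesis l_gt1 : (1 < l)%N.
Local Notation A := (truncated_pathalg k Q l).

Lemma truncated_pathalg_ker (x : pathalg k Q) :
  qproj (ideal_pow (arrow_ideal k Q) l) x = 0 <-> vanishes l x.
Proof.
by rewrite -(raddf0 (qproj _)) qprojP subr0; apply: arrow_ideal_powP.
Qed.

Lemma truncated_pathalg_right :
  inhabited (truncated_path_ring k (@source Q) (@target Q) l A^c).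
Proof.
pose pi : {additive pathalg k Q -> A^c} := qproj (ideal_pow (arrow_ideal k Q) l).
apply: (@pathalg_truncated_path_ring k Q l false l_gt1 A^c pi).
- exact: qproj_surj.
- exact: truncated_pathalg_ker.
- by move=> x y; apply: (rmorphM (qproj _)).
- exact: (rmorph1 (qproj _)).
Qed.

Lemma truncated_pathalg_left :
  inhabited (truncated_path_ring k (@target Q) (@source Q) l (A^c)^c).
Proof.
pose pi : {additive pathalg k Q -> (A^c)^c} := qproj (ideal_pow (arrow_ideal k Q) l).
apply: (@pathalg_truncated_path_ring k Q l true l_gt1 (A^c)^c pi).
- exact: qproj_surj.
- exact: truncated_pathalg_ker.
- by move=> x y; apply: (rmorphM (qproj _)).
- exact: (rmorph1 (qproj _)).
Qed.

End TruncatedPathAlgebra.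

(** * The delooping levels and the finitistic dimension *)

Section ExtendedNaturals.
Implicit Types (S : nat -> Prop) (U : enat -> Prop) (x y z : enat) (n d : nat).

Lemma enat_le_trans y x z : enat_le x y -> enat_le y z -> enat_le x z.
Proof. by case: x y z => [x|] [y|] [z|] //=; apply: leq_trans. Qed.

Lemma enat_le_anti x y : enat_le x y -> enat_le y x -> x = y.
Proof. by case: x y => [x|] [y|] //= xy yx; congr Some; apply/eqP; rewrite eqn_leq xy. Qed.

Lemma enat_inf_lower S n : S n -> enat_le (enat_inf S) (Some n).
Proof.
move=> Sn; rewrite /enat_inf; case: pselect => [ex|no].
  by case: ex_minnP => m _ /=; apply; apply/asboolP.
by case: no; exists n; apply/asboolP.
Qed.

Lemma enat_inf_greatest S d : (forall n, S n -> (d <= n)%N) ->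
  enat_le (Some d) (enat_inf S).
Proof.
move=> h; rewrite /enat_inf; case: pselect => // ex.
by case: ex_minnP => m /asboolP /h.
Qed.

Lemma enat_inf_Some S d : enat_inf S = Some d -> S d /\ forall n, S n -> (d <= n)%N.
Proof.
rewrite /enat_inf; case: pselect => // ex; case: ex_minnP => m /asboolP Sm min_m [<-].
by split=> // n Sn; apply: min_m; apply/asboolP.
Qed.

Lemma enat_sup_upper U x : U x -> enat_le x (enat_sup U).
Proof.
move=> Ux; rewrite /enat_sup; case E: enat_inf => [d|]; last by case: x Ux.
by have [h _] := enat_inf_Some E; apply: h.
Qed.

Lemma enat_sup_least U y : (forall x, U x -> enat_le x y) -> enat_le (enat_sup U) y.
Proof. by case: y => [d|] h; [apply: enat_inf_lower | case: enat_sup]. Qed.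

End ExtendedNaturals.

Lemma proj_dim_Some (A : pzRingType) (M : rmodType A) d :
  has_proj_resolution M d.+1 -> ~ has_proj_resolution M d -> proj_dim M = Some d.+1.
Proof.
move=> res nres; apply: enat_le_anti; first exact: enat_inf_lower.
apply: enat_inf_greatest => n [P [D [ep [h1 h2 h3 h4 h5]]]].
rewrite ltnNge; apply/negP => nd; apply: nres; exists P, D, ep; split=> // i di.
by apply: h5; apply: leq_ltn_trans di.
Qed.

Section Comparison.
Variables (A : pzRingType).

Lemma simple_fin_gen (S : rmodType A) : simple S -> fin_gen S.
Proof.
move=> [[x x0] hS].
have U0 : exists b : A^c, 0 = b *: x by exists 0; rewrite scale0r.
have UL (a : A^c) (y z : S) : (exists b : A^c, y = b *: x) ->
    (exists b : A^c, z = b *: x) -> exists b : A^c, a *: y + z = b *: x.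
  by move=> [b ->] [c ->]; exists (a * b + c); rewrite scalerDl scalerA.
pose U := Submodule U0 UL.
exists 1%N, (fun _ => x) => y.
have [all0|allU] := hS _ (submodule_pred_closed U).
  by case/eqP: x0; apply: all0; apply/asboolP; exists 1; rewrite scale1r.
have /asboolP[b ->] := allU y.
by exists (fun _ => b); rewrite big_ord1.
Qed.

Lemma dell_le_Dell : enat_le (dell A) (Dell A).
Proof.
apply: enat_sup_least => _ [S [simS ->]]; apply: enat_sup_upper.
by exists S; split=> //; apply: simple_fin_gen.
Qed.

Variables (k : fieldType) (V Ar : finType) (src tgt : Ar -> V) (l : nat).
Hypothesis l_gt1 : (1 < l)%N.
Variables (T : truncated_path_ring k src tgt l A^c)
  (T' : truncated_path_ring k tgt src l (A^c)^c).

(** The vertex found in the quiver of left modules is used in the opposite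
    quiver, where paths into it become paths out of it. *)
Lemma findim_le_dell : enat_le (findim A^c) (dell A).
Proof.
apply: enat_sup_least => _ [N [fgN pdN ->]].
case pdE: (proj_dim N) pdN => [[|d]|] // _; first by case: (dell A).
have [res min_d] := enat_inf_Some pdE.
have nres : ~ has_proj_resolution N d by move=> /min_d; rewrite ltnn.
have [v [b [rho [r [nb hrho hr q1 q2]]]]] := proj_dim_vertex T' l_gt1 fgN res nres.
rewrite -!has_path_in_rev in nb hrho; rewrite has_path_in_rev in hr.
have [S [simS hS]] := simple_not_summand T l_gt1 nb hrho hr q1 q2.
apply: (@enat_le_trans (dell_mod S)); last by apply: enat_sup_upper; exists S.
apply: enat_inf_greatest => n hn; rewrite ltnNge; apply/negP => nd.
exact: hS nd hn.
Qed.

(** Positivity of the finitistic dimension enters through [delooping_bound],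
    which needs at least one syzygy to reach submodules of projective modules. *)
Lemma Dell_le_findim : enat_lt (Some 0%N) (findim A^c) ->
  enat_le (Dell A) (findim A^c).
Proof.
move=> pos; apply: enat_sup_least => _ [M [fgM ->]].
case E: (findim A^c) pos => [d|] pos; last by case: dell_mod.
apply: enat_inf_lower; apply: (delooping_bound T l_gt1) => //.
  by move: pos; rewrite /enat_lt /= -ltnNge.
move=> x m ml hx hm.
case: (boolP (has_path_in src tgt (alt l d.+1 (l - m)) x)) => // nx; exfalso.
have d0 : (0 < d)%N by move: pos; rewrite /enat_lt /= -ltnNge.
have jl : (0 < l - m < l)%N by lia.
have lm : (l - (l - m) = m)%N by lia.
rewrite has_path_in_rev in hx; rewrite has_path_in_rev in nx; rewrite -has_path_in_rev in hm.
have [|N [fgN res nres]] := exists_proj_dim T' l_gt1 jl d0 hx nx; first by rewrite lm.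
have : enat_le (Some d.+1) (findim A^c).
  apply: enat_sup_upper; exists N.
  by rewrite (proj_dim_Some res nres).
by rewrite E /= ltnn.
Qed.

End Comparison.

Theorem theorem4p18 (k : fieldType) (Q : quiver) (l : nat)
    (hQ : connected_quiver Q) (hl : (2 <= l)%N) :
  let A := truncated_pathalg k Q l in
  enat_lt (Some 0%N) (findim A^c) ->
  dell A = Dell A /\ Dell A = findim A^c.
Proof.
move=> A pos.
have [T] := truncated_pathalg_right k Q hl.
have [T'] := truncated_pathalg_left k Q hl.
have h1 := dell_le_Dell A.
have h2 := Dell_le_findim hl T T' pos.
have h3 := findim_le_dell hl T T'.
split; apply: enat_le_anti => //.
- exact: enat_le_trans h2 h3.
- exact: enat_le_trans h3 h1.
Qed.
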